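(* Let $T$ be a complete theory, $M$ a small model, $\mu_x\in\mathfrak M(\mathcal U)$ a global dependent Keisler measure that is definable over $M$, and $\lambda_y\in\mathfrak M(\mathcal U)$ a global Keisler measure finitely satisfiable in $M$. Then $\mu_x\otimes\lambda_y=\lambda_y\otimes\mu_x$.
   Context: $\mathcal U$ is the monster model. Keisler measures are identified with complete regular Borel probability measures on type spaces; global means over $\mathcal U$. $\mu$ is definable over $M$ if for every formula $\phi(x,y)$ the value $\mu(\phi(x,b))$ depends only on $\mathrm{tp}(b/M)$ and the induced map $S_y(M)\to[0,1]$ is continuous. $\lambda$ is finitely satisfiable in $M$ if every formula of positive $\lambda$-measure is realized in $M$. Morley product: for global $\mu_x,\lambda_y$, an $L(\mathcal U)$-formula $\phi(x,y;b)$ and a small model $N\supseteq Mb$, let $\phi^*(y,x;b)=\phi(x,y;b)$, $f(q)=\mu(\phi(x,d;b))$ for $q\in S_{\phi^*}(N)$, $d\models q$; when $f$ is $\lambda|_N$-measurable, $\mu_x\otimes\lambda_y(\phi(x,y;b))=\int_{S_{\phi^*}(N)}f\,d\lambda|_N$ (independent of $N$). $\lambda_y\otimes\mu_x$ is defined symmetrically, integrating $p\mapsto\lambda(\phi(c,y;b))$ ($c\models p\in S_\phi(N)$) against $\mu|_N$. Under the hypotheses both products are well defined. Dependence of a global measure $\nu$: for $A\subseteq B\subseteq\mathcal U$ and a formula $\psi(x,z)$, let $S_\psi(B)$ be the space of complete $\psi$-types over $B$, $\psi(p,c)\in\{0,1\}$ the truth value of $\psi(x,c)\in p$, and $\nu_{\psi,B}$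 the pushforward of $\nu|_B$ to $S_\psi(B)$. $\nu$ is dependent over $B$ and in $A$ if for every $\psi$ there is no measurable $E\subseteq S_\psi(B)$ with $\nu_{\psi,B}(E)>0$ such that for all $k\ge1$, $\nu_{\psi,B}^k(D_k)=(\nu_{\psi,B}(E))^k$, where $D_k=\{(p_1,\dots,p_k)\in E^k:\forall I\subseteq\{1,\dots,k\}\ \exists c\in A\ (\psi(p_i,c)=0 \text{ for } i\in I,\ \psi(p_i,c)=1 \text{ for } i\notin I)\}$. $\nu$ is dependent if this holds for all $A\subseteq B\subseteq\mathcal U$.
   Formalization: The function f on the φ*-types over N defining μ⊗λ need not be well defined; the products are therefore taken as integrals over the space of all complete types over N, and shown to agree with the integral over φ*-types (or φ-types) whenever that function exists. *)

(* Defs.v *)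
From HB Require Import structures.
From mathcomp Require Import all_boot all_order all_algebra.
From mathcomp Require Import all_classical all_reals all_analysis.

Set Implicit Arguments.
Unset Strict Implicit.
Unset Printing Implicit Defensive.

Import Order.TTheory GRing.Theory Num.Theory.
Import numFieldNormedType.Exports.
Local Open Scope classical_set_scope.
Local Open Scope ring_scope.

Record language := Language {
  fun_sym : Type;
  fun_arity : fun_sym -> nat;
  rel_sym : Type;
  rel_arity : rel_sym -> nat }.

Inductive term (L : language) (V : Type) : Type :=
| Var of V
| App (f : fun_sym L) of ('I_(fun_arity f) -> term L V).
Arguments Var {L V}.

(* [formula L V] is the type of formulas with free variables in [V]; a
   quantifier binds the extra variable [None]. An L(B)-formula in the tuple of
   variables [X] is a [formula L (X + B)]: the elements of [B] act as
   constants. *)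
Inductive formula (L : language) (V : Type) : Type :=
| Falsum
| Equal of term L V & term L V
| Rel (r : rel_sym L) of ('I_(rel_arity r) -> term L V)
| Implies of formula L V & formula L V
| Forall of formula L (option V).
Arguments Falsum {L V}.

Notation sentence L := (formula L void).

Definition extend (V U : Type) (u : U) (v : V -> U) (o : option V) : U :=
  if o is Some x then v x else u.

Fixpoint term_rename (L : language) (V W : Type) (h : V -> W) (t : term L V) :
    term L W :=
  match t with
  | Var x => Var (h x)
  | App f s => App (fun i => term_rename h (s i))
  end.

Fixpoint rename (L : language) (V W : Type) (h : V -> W) (phi : formula L V) :
    formula L W :=
  match phi with
  | Falsum => Falsum
  | Equal s t => Equal (term_rename h s) (term_rename h t)
  | Rel r s => Rel (fun i => term_rename h (s i))
  | Implies phi psi => Implies (rename h phi) (rename h psi)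
  | Forall phi => Forall (rename (omap h) phi)
  end.

(* [pointedType] only records that carriers are nonempty. *)
Record structure (L : language) := Structure {
  carrier :> pointedType;
  fun_interp : forall f : fun_sym L, ('I_(fun_arity f) -> carrier) -> carrier;
  rel_interp : forall r : rel_sym L, ('I_(rel_arity r) -> carrier) -> Prop }.

Fixpoint eval (L : language) (U : structure L) (V : Type) (v : V -> U)
    (t : term L V) : U :=
  match t with
  | Var x => v x
  | App f s => fun_interp (fun i => eval v (s i))
  end.

Fixpoint sat (L : language) (U : structure L) (V : Type) (phi : formula L V) :
    (V -> U) -> Prop :=
  match phi with
  | Falsum => fun=> False
  | Equal s t => fun v => eval v s = eval v t
  | Rel r s => fun v => rel_interp (fun i => eval v (s i))
  | Implies phi psi => fun v => sat phi v -> sat psi v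
  | Forall phi => fun v => forall u : U, sat phi (extend u v)
  end.

Lemma eval_rename (L : language) (U : structure L) (V W : Type) (h : V -> W)
  (t : term L V) (v : W -> U) : eval v (term_rename h t) = eval (v \o h) t.
Proof.
elim: t => [//|f s IH] /=.
by congr fun_interp; apply/funext => i; exact: IH.
Qed.

Lemma sat_rename (L : language) (U : structure L) (V : Type)
  (phi : formula L V) (W : Type) (h : V -> W) (v : W -> U) :
  sat (rename h phi) v = sat phi (v \o h).
Proof.
elim: phi W h v => {V} /= [//|V s t|V r s|V p IHp q IHq|V p IHp] W h v.
- by rewrite !eval_rename.
- by congr rel_interp; apply/funext => i; rewrite eval_rename.
- by rewrite IHp IHq.
- apply: eq_forall => u; rewrite IHp; congr (sat p _).
  by apply/funext => -[].
Qed.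

Definition theory (L : language) := set (sentence L).

Definition empty_env (U : Type) (x : void) : U := match x with end.

Definition models (L : language) (U : structure L) (T : theory L) : Prop :=
  forall s, T s -> sat s (@empty_env U).

Definition entails (L : language) (T : theory L) (s : sentence L) : Prop :=
  forall U : structure L, models U T -> sat s (@empty_env U).

Definition complete_theory (L : language) (T : theory L) : Prop :=
  (exists U : structure L, models U T) /\
  forall s, entails T s \/ entails T (Implies s Falsum).

Definition assign (X P U : Type) (a : X -> U) (c : P -> U) (v : X + P) : U :=
  match v with inl x => a x | inr z => c z end.

(* Complete types with respect to a family [D] of definable sets [D i] of
   realizations in [A]: the truth values [p i] have to be simultaneously
   finitely satisfiable. The family of all L(B)-formulas gives the complete
   types over B and the family of all instances of psi over B the complete
   psi-types over B. *)
Record typ (A : pointedType) (I : Type) (D : I -> set A) := Typ {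
  truth :> I -> bool;
  finitely_satisfiable : forall n (s : 'I_n -> I),
    exists a : A, forall j, truth (s j) = `[< D (s j) a >] }.

Section type_space.
Variables (A : pointedType) (I : Type) (D : I -> set A).

Lemma type_of_subproof (a : A) n (s : 'I_n -> I) :
  exists b : A, forall j, `[< D (s j) a >] = `[< D (s j) b >].
Proof. by exists a. Qed.

Definition type_of (a : A) : typ D :=
  @Typ A I D (fun i => `[< D i a >]) (@type_of_subproof a).

Lemma typ_inj (p q : typ D) : truth p =1 truth q -> p = q.
Proof.
case: p q => [p hp] [q hq] /= /funext pq.
by rewrite -pq in hq *; congr Typ; exact: Prop_irrelevance.
Qed.

HB.instance Definition _ := gen_eqMixin (typ D).
HB.instance Definition _ := gen_choiceMixin (typ D).
HB.instance Definition _ := isPointed.Build (typ D) (type_of point).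

(* The topology generated by the sets [fun p => p i] and their complements. *)
HB.instance Definition _ := Topological.copy (typ D)
  (initial_topology (fun p : typ D => (truth p : {ptws I -> bool}))).

End type_space.

HB.instance Definition _ (I : Type) (T : ptopologicalType) :=
  isPointed.Build {ptws I -> T} (fun=> point).

Notation borel T := (g_sigma_algebraType (@open T)).

Lemma continuous_borel_measurable (S T : ptopologicalType) (f : S -> T) :
  continuous f -> measurable_fun [set: borel S] (f : borel S -> borel T).
Proof.
move=> /continuousP cf.
apply: (@measurability _ _ (borel S) (borel T) _ _ (@open T)) => //.
by move=> _ [B oB <-]; rewrite setTI; apply: sub_sigma_algebra; exact: cf.
Qed.

Definition image_measure (R : realType) (S T : ptopologicalType) (f : S -> T)
    (cf : continuous f) (m : probability (borel S) R) :
    probability (borel T) R :=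
  distribution m
    (mfun_Sub (mem_set (continuous_borel_measurable cf))).

Section type_map.
Variables (A : pointedType) (I J : Type) (D : I -> set A) (E : J -> set A).
Variables (h : J -> I) (hE : forall j, D (h j) = E j).

Lemma type_map_subproof (p : typ D) n (s : 'I_n -> J) :
  exists a : A, forall j, p (h (s j)) = `[< E (s j) a >].
Proof.
have [a pa] := finitely_satisfiable p (h \o s).
by exists a => j; rewrite -hE -pa.
Qed.

Definition type_map (p : typ D) : typ E :=
  @Typ A J E (fun j => p (h j)) (@type_map_subproof p).

Lemma truth_continuous (i : I) : continuous (fun p : typ D => p i).
Proof.
move=> p; have c := @initial_continuous _ {ptws I -> bool} (@truth A I D) p.
have /cvg_sup/(_ i) {}c := c.
move=> B /(@initial_continuous (I -> bool : choiceType) bool (@^~ i)).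
by apply: c; exact: (fmap_filter _ (nbhs_filter p)).
Qed.

Lemma type_map_continuous : continuous type_map.
Proof.
apply: continuous_comp_initial => p.
apply/cvg_sup; first exact: (fmap_filter _ (nbhs_filter p)).
move=> j.
apply: (@continuous_comp_initial _ (typ D) _ (fun f : J -> bool => f j)).
by move=> q; apply: (@truth_continuous (h j)).
Qed.

End type_map.

Section types.
Variables (L : language) (U : structure L).

Definition instances (P : Type) (c : P -> U) (X : Type)
  (phi : formula L (X + P)) : set (X -> U) := [set a | sat phi (assign a c)].

Definition global_type (X : Type) := typ (@instances U id X).

Definition type_over (B : set U) (X : Type) := typ (@instances B set_val X).

Definition tp (B : set U) (X : Type) (a : X -> U) : type_over B X :=
  type_of _ a.

Definition local_instances (X Z : Type) (psi : formula L (X + Z)) (B : set U)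
  (c : Z -> B) : set (X -> U) := [set a | sat psi (assign a (set_val \o c))].

Definition local_type (X Z : Type) (psi : formula L (X + Z)) (B : set U) :=
  typ (@local_instances X Z psi B).

Definition subst (X P Q : Type) (c : Q -> P) (v : X + Q) : X + P :=
  match v with inl x => inl x | inr z => inr (c z) end.

Definition inst (X P Q : Type) (psi : formula L (X + Q)) (c : Q -> P) :
  formula L (X + P) := rename (subst c) psi.

Lemma instances_inst (P Q : Type) (c : P -> U) (X : Type)
  (psi : formula L (X + Q)) (h : Q -> P) :
  instances c (inst psi h) = instances (c \o h) psi.
Proof.
by apply/seteqP; split => a; rewrite /instances /= sat_rename;
  congr (sat psi _); apply/funext => -[].
Qed.

Definition restrict_type (B : set U) (X : Type) :
    global_type X -> type_over B X :=
  type_map (fun phi => instances_inst (X := X) id phi (@set_val U B)).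

Definition psi_part (X Z : Type) (psi : formula L (X + Z)) (B : set U) :
    type_over B X -> local_type psi B :=
  type_map (instances_inst set_val psi).

End types.
Arguments global_type {L} U X.
Arguments restrict_type {L U} B {X}.
Arguments psi_part {L U X Z} psi B.

Lemma restrict_type_continuous (L : language) (U : structure L) (B : set U)
  (X : Type) : continuous (@restrict_type L U B X).
Proof. exact: type_map_continuous. Qed.

Lemma psi_part_continuous (L : language) (U : structure L) (X Z : Type)
  (psi : formula L (X + Z)) (B : set U) : continuous (psi_part psi B).
Proof. exact: type_map_continuous. Qed.

Definition regular (R : realType) (T : ptopologicalType)
    (m : set (borel T) -> \bar R) : Prop :=
  forall A : set (borel T), measurable A -> forall e : R, 0 < e ->
  exists K G : set T,
    [/\ compact K, open G, K `<=` A, A `<=` G & (m (G `\` K) < e%:E)%E].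

Record keisler (R : realType) (L : language) (U : structure L) (X : Type) :=
  Keisler {
    keisler_measure :> probability (borel (global_type U X)) R;
    keisler_regular : regular keisler_measure }.

(* Measures are given on Borel sigma-algebras; measurability of sets and of
   integrands, measures and integrals refer to their completions. The
   sigma-algebra of the completion of a probability measure consists of the
   sets that are Caratheodory measurable for its outer measure. *)
Notation completed_space m := (caratheodory_type (mu_ext m)).
Notation completion m := (@completed_measure_extension _ _ _ m).

(* The product measure m^k, as a regular Borel measure on the compact space
   T^k. For a regular Borel probability measure m on a compact Hausdorff space
   there is exactly one such P (the Radon product). The sets D_k below are
   relatively open in E^k, hence measurable for its completion, while they need
   not belong to the completed product sigma-algebra when A is uncountable. *)
Definition is_power (R : realType) (T : ptopologicalType)
    (m : probability (borel T) R) (k : nat)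
    (P : probability (borel {ptws 'I_k -> T}) R) : Prop :=
  regular P /\
  forall E : 'I_k -> set (borel T), (forall i, measurable (E i)) ->
    P [set p | forall i, E i (p i)] = (\prod_(i < k) m (E i))%E.

Section measures.
Variables (R : realType) (L : language) (U : structure L).

(* nu(phi(x, c)) *)
Definition value (X P : Type) (nu : keisler R U X) (phi : formula L (X + P))
  (c : P -> U) : \bar R := nu [set p : global_type U X | p (inst phi c)].

Definition restriction (X : Type) (nu : keisler R U X) (B : set U) :
    probability (borel (type_over B X)) R :=
  image_measure (@restrict_type_continuous L U B X) nu.

(* nu_{psi, B} *)
Definition local_measure (X Z : Type) (nu : keisler R U X)
    (psi : formula L (X + Z)) (B : set U) :
    probability (borel (local_type psi B)) R :=
  image_measure (@psi_part_continuous L U X Z psi B) (restriction nu B).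

(* D_k *)
Definition shattered (X Z : Type) (psi : formula L (X + Z)) (A B : set U)
    (E : set (local_type psi B)) (k : nat) :
    set {ptws 'I_k -> local_type psi B} :=
  [set p | (forall i, E (p i)) /\
    forall I : {set 'I_k}, exists c : Z -> B,
      (forall z, A (set_val (c z))) /\ forall i, p i c = (i \notin I)].

Definition dependent_over_in (X : Type) (nu : keisler R U X) (B A : set U) :
    Prop :=
  forall (Z : finType) (psi : formula L (X + Z)),
  let m := local_measure nu psi B in
  ~ exists E : set (completed_space m),
    [/\ measurable E, (0 < completion m E)%E &
      forall (k : nat) (P : probability
          (borel {ptws 'I_k -> local_type psi B}) R),
        (0 < k)%N -> is_power m P ->
        completion P (@shattered X Z psi A B E k) =
        (completion m E ^+ k)%E].

Definition dependent (X : Type) (nu : keisler R U X) : Prop :=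
  forall A B : set U, A `<=` B -> dependent_over_in nu B A.

Definition definable (X : Type) (nu : keisler R U X) (M : set U) : Prop :=
  forall (Y : finType) (phi : formula L (X + Y)),
  exists F : type_over M Y -> R,
    continuous F /\ forall b : Y -> U, value nu phi b = (F (tp M b))%:E.

Definition satisfiable_in (X : Type) (nu : keisler R U X) (M : set U) : Prop :=
  forall phi : formula L (X + U), (0 < value nu phi id)%E ->
  exists a : X -> U, (forall x, M (a x)) /\ sat phi (assign a id).

Definition swap (X Y Z : Type) (v : X + (Y + Z)) : Y + (X + Z) :=
  match v with
  | inl x => inr (inl x)
  | inr (inl y) => inl y
  | inr (inr z) => inr (inr z)
  end.

(* phi^*(y, x; b) *)
Definition dual (X Y Z : Type) (phi : formula L (X + (Y + Z))) :
  formula L (Y + (X + Z)) := rename (@swap X Y Z) phi.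

(* S_{phi^*}(N), for the L(U)-formula phi(x, y; b) *)
Definition fiber_type (X Y Z : Type) (phi : formula L (X + (Y + Z)))
    (b : Z -> U) (N : set U) :=
  typ (fun c : X -> N => instances (assign (set_val \o c) b) (dual phi)).

Definition fiber_tp (X Y Z : Type) (phi : formula L (X + (Y + Z)))
    (b : Z -> U) (N : set U) (d : Y -> U) : fiber_type phi b N :=
  type_of _ d.

Definition fiber_part (X Y Z : Type) (phi : formula L (X + (Y + Z)))
    (b : Z -> U) (N : set U) : global_type U Y -> fiber_type phi b N :=
  type_map (fun c : X -> N =>
    instances_inst id (dual phi) (assign (set_val \o c) b)).

Lemma fiber_part_continuous (X Y Z : Type) (phi : formula L (X + (Y + Z)))
  (b : Z -> U) (N : set U) : continuous (fiber_part phi b N).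
Proof. exact: type_map_continuous. Qed.

(* The image of nu|_N on S_{phi^*}(N), obtained directly from nu since b is
   not typed as a tuple of N. *)
Definition fiber_measure (X Y Z : Type) (nu : keisler R U Y)
    (phi : formula L (X + (Y + Z))) (b : Z -> U) (N : set U) :
    probability (borel (fiber_type phi b N)) R :=
  image_measure (@fiber_part_continuous X Y Z phi b N) nu.

(* [morley_value mu lambda phi b N r]: the Morley product of mu and lambda is
   defined at phi(x, y; b) over N and has the value r there, i.e. r is the
   integral with respect to lambda|_N of q |-> mu(phi(x, d; b)), d |= q.
   The first clause takes q in S_y(N). The second one is the definition over
   S_{phi^*}(N), for the integrands that exist there: mu(phi(x, d; b)) need not
   be a function of the phi^*-type of d over N, even for a definable type of an
   NIP theory. For instance in dense linear orders with a dense codense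
   predicate Q, for phi(x, y) := (y < x /\ Q(y)) and mu the type at +oo, all
   d > N have the same phi^*-type, whereas mu(phi(x, d)) = 1 iff Q(d). *)
Definition morley_value (X Y Z : Type) (mu : keisler R U X)
    (lambda : keisler R U Y) (phi : formula L (X + (Y + Z))) (b : Z -> U)
    (N : set U) (r : R) : Prop :=
  (let m := restriction lambda N in
   exists f : completed_space m -> R,
     [/\ forall d : Y -> U, value mu phi (assign d b) = (f (tp N d))%:E,
         measurable_fun [set: completed_space m] f &
         (\int[completion m]_q (f q)%:E = r%:E)%E]) /\
  (let m := fiber_measure lambda phi b N in
   forall f : completed_space m -> R,
     (forall d : Y -> U,
       value mu phi (assign d b) = (f (fiber_tp phi b N d))%:E) ->
     measurable_fun [set: completed_space m] f /\
     (\int[completion m]_q (f q)%:E = r%:E)%E).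

End measures.

Definition smaller (T : Type) (A : set T) (K : Type) : Prop :=
  ~~ ([set: K] #<= A)%card.

Definition saturated (L : language) (U : structure L) (K : Type) : Prop :=
  forall (A : set U) (X : finType) (p : type_over A X),
  smaller A K -> exists a : X -> U, tp A a = p.

Definition automorphism (L : language) (U : structure L) (s : U -> U) : Prop :=
  [/\ bijective s,
      forall f v, s (@fun_interp L U f v) = fun_interp (s \o v) &
      forall r v, @rel_interp L U r v <-> rel_interp (s \o v)].

Definition strongly_homogeneous (L : language) (U : structure L) (K : Type) :
    Prop :=
  forall (A : set U) (g : A -> U), smaller A K ->
  (forall phi : formula L A, sat phi set_val <-> sat phi g) ->
  exists s : U -> U, automorphism s /\ forall a : A, s (set_val a) = g a.

(* [K] is the cardinal kappa; [formula L nat] has cardinality |L| + aleph_0. *)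
Definition monster (L : language) (T : theory L) (U : structure L) (K : Type) :
    Prop :=
  [/\ models U T, smaller [set: formula L nat] K,
      saturated U K & strongly_homogeneous U K].

Definition elementary_submodel (L : language) (U : structure L) (M : set U) :
    Prop :=
  exists (M' : structure L) (j : M' -> U),
    range j = M /\
    forall (V : Type) (phi : formula L V) (v : V -> M'),
      sat phi v <-> sat phi (j \o v).

Definition small_model (L : language) (U : structure L) (K : Type)
    (M : set U) : Prop :=
  elementary_submodel M /\ smaller M K.

(* Main.v *)
(* Let m be the image of mu on the space of phi-types over N, and let
   g(p) = lambda(phi(p, y; b)). Definability of mu makes mu(phi(x, d; b)) a
   continuous function of tp(d), so the first product exists and equals some r.
   The difficulty is to show that g, about which nothing is known a priori, is
   measurable for the completion of m, with integral r.

   As lambda is finitely satisfiable in M, any p_1, ..., p_n have some d in M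
   for which the empirical sum of the indicators of phi(p_i, d), compared with
   n mu(phi(x, d; b)), is at least as large as the sum of g(p_i) compared with
   n r, and likewise for smaller. Hence if the upper integral of exp(s (g - r))
   is greater than cosh s, for s of either sign, symmetrization against a second
   sample shows that the expected number of patterns
   (truth value of phi(p_i, d))_i, d in M, on a random sample grows
   exponentially. Otherwise letting s tend to 0 squeezes g between bounded Borel
   functions with integrals close to r.

   Exponential growth contradicts dependence: among the pairs (F true, F false)
   of sets such that the patterns taking the value b only at points of F b still
   grow like t^n, t > 1, and the subfamilies of formulas witnessing this, a
   minimal one is full: almost every sample in it realizes all patterns. Its
   mass is at least t > 1, so E = F true /\ F false has positive measure, and E
   is almost surely shattered.

   The families of formulas are uncountable, and the measures are only Borel.
   Therefore expected numbers of patterns are defined as iterated integrals of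
   functionals that are approximated by finite families; inner regularity of m
   on open sets makes them well behaved. *)

Require Import Defs.
From mathcomp Require Import all_boot all_order all_algebra.
From mathcomp Require Import all_classical all_reals all_analysis.
From mathcomp Require Import measurable_realfun ring lra.

Set Implicit Arguments.
Unset Strict Implicit.
Unset Printing Implicit Defensive.

Import Order.TTheory GRing.Theory Num.Theory.
Import numFieldNormedType.Exports.

Local Open Scope classical_set_scope.
Local Open Scope ring_scope.

(** * Bounded integrands *)

(** The deviation of [g] from [r] enters the exponent linearly in [s], while symmetrization costs
    only the factor [cosh s], which is 1 up to order [s ^+ 2]. A majorant [h] of [1 + s * (g - r)]
    of expectation near [cosh s] thus yields the majorant [(h - 1) / s + r] of [g], of expectation
    [r] up to order [s]; the sign [- s] does the same for [1 - g]. Exponentials are chosen because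
    they multiply along a sample: the comparison is made between n-th powers, and all subexponential
    losses vanish when the n-th root is taken. The event that some formula of an uncountable family
    leaves a given pattern on n points is open in the n-th power of the type space, but may lie
    outside the product sigma-algebra. Hence the counting of patterns uses no product measure: the
    family itself is the state, a drawn point [x] replaces [G] by [sieve G b x], and each step
    integrates over a single copy of the space. Genuine powers of the measure appear only when the
    set [E] found in this way is confronted with dependence, in [completion_shattered]. *)

Section bounded_integrands.
Context (d : measure_display) (T : measurableType d) (R : realType).
Variable m : probability T R.

Definition bounded_measurable (f : T -> R) : Prop :=
  measurable_fun setT f /\ exists K, forall x, 0 <= f x <= K.

Definition expect (f : T -> R) : R := \int[m]_x f x.

Definition weight (A : set T) : R := fine (m A).

Lemma bounded_measurable_ge0 f x : bounded_measurable f -> 0 <= f x.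
Proof. by case=> _ [K /(_ x)/andP[]]. Qed.

Lemma bounded_measurable_cst c : 0 <= c -> bounded_measurable (fun=> c).
Proof. by move=> c0; split; [exact: measurable_cst|exists c => x; rewrite c0 lexx]. Qed.

Lemma bounded_measurableD f g : bounded_measurable f -> bounded_measurable g ->
  bounded_measurable (fun x => f x + g x).
Proof.
move=> [mf [K fK]] [mg [K' gK]]; split; first exact: measurable_funD.
exists (K + K') => x; have /andP[f0 f1] := fK x; have /andP[g0 g1] := gK x.
by rewrite addr_ge0// lerD.
Qed.

Lemma bounded_measurableM f g : bounded_measurable f -> bounded_measurable g ->
  bounded_measurable (fun x => f x * g x).
Proof.
move=> [mf [K fK]] [mg [K' gK]]; split; first exact: measurable_funM.
exists (K * K') => x; have /andP[f0 f1] := fK x; have /andP[g0 g1] := gK x.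
by rewrite mulr_ge0// ler_pM.
Qed.

Lemma bounded_measurableZ c f : 0 <= c -> bounded_measurable f ->
  bounded_measurable (fun x => c * f x).
Proof. by move=> c0; apply: bounded_measurableM; exact: bounded_measurable_cst. Qed.

Lemma bounded_measurable_sum (J : Type) (s : seq J) (P : pred J) f :
  (forall j, bounded_measurable (f j)) ->
  bounded_measurable (fun x => \sum_(j <- s | P j) f j x).
Proof.
move=> fP; elim: s => [|j s IH].
  rewrite (_ : (fun _ => _) = fun=> 0); first exact: bounded_measurable_cst.
  by apply/funext => x; rewrite big_nil.
have [Pj|Pj] := boolP (P j); last first.
  by rewrite (_ : (fun _ => _) = fun x => \sum_(j <- s | P j) f j x)//;
    apply/funext => x; rewrite big_cons (negbTE Pj).
rewrite (_ : (fun _ => _) = fun x => f j x + \sum_(j <- s | P j) f j x).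
  exact: bounded_measurableD.
by apply/funext => x; rewrite big_cons Pj.
Qed.

Lemma bounded_measurable_indic A : measurable A ->
  bounded_measurable (\1_A : T -> R).
Proof.
move=> mA; split; first exact: measurable_indic.
by exists 1 => x; rewrite indicE; case: (_ \in _); rewrite ?lexx ler01.
Qed.

Lemma bounded_measurable_integrable f : bounded_measurable f ->
  m.-integrable setT (EFin \o f).
Proof.
move=> [mf [K fK]]; apply: measurable_bounded_integrable => //.
  by rewrite [X in (X < _)%E](@probability_setT _ _ _ m) ltry.
exists K; split; first by rewrite num_real.
move=> M KM x _ /=; have /andP[f0 f1] := fK x.
by rewrite ger0_norm// (le_trans f1)// ltW.
Qed.

Lemma expectD f g : bounded_measurable f -> bounded_measurable g ->
  expect (fun x => f x + g x) = expect f + expect g.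
Proof.
by move=> bf bg; rewrite /expect RintegralD//; exact: bounded_measurable_integrable.
Qed.

Lemma expectZ c f : bounded_measurable f ->
  expect (fun x => c * f x) = c * expect f.
Proof.
by move=> bf; rewrite /expect RintegralZl//; exact: bounded_measurable_integrable.
Qed.

Lemma expect_le f g : bounded_measurable f -> bounded_measurable g ->
  (forall x, f x <= g x) -> expect f <= expect g.
Proof.
by move=> bf bg fg; rewrite /expect le_Rintegral//; exact: bounded_measurable_integrable.
Qed.

Lemma expect_ge0 f : (forall x, 0 <= f x) -> 0 <= expect f.
Proof. by move=> f0; apply: Rintegral_ge0. Qed.

Lemma expect_eq f g : f =1 g -> expect f = expect g.
Proof. by move=> /funext ->. Qed.

Lemma weightE A : measurable A -> (weight A)%:E = m A.
Proof.
move=> mA; rewrite /weight fineK// ge0_fin_numE//.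
by rewrite (le_lt_trans (probability_le1 m mA))// ltry.
Qed.

Lemma expect_indic A : measurable A -> expect (\1_A : T -> R) = weight A.
Proof. by move=> mA; rewrite /expect /Rintegral integral_indic// setIT. Qed.

Lemma weight_ge0 A : 0 <= weight A.
Proof. by rewrite fine_ge0. Qed.

Lemma weight0 : weight set0 = 0.
Proof. by rewrite /weight measure0. Qed.

Lemma weight_le1 A : measurable A -> weight A <= 1.
Proof. by move=> mA; rewrite -lee_fin weightE// probability_le1. Qed.

Lemma weightT : weight setT = 1.
Proof. by rewrite /weight (@probability_setT _ _ _ m). Qed.

Lemma expect_cst c : expect (fun=> c) = c.
Proof.
rewrite /expect Rintegral_cst//; rewrite -[RHS]mulr1; congr (_ * _).
exact: weightT.
Qed.

Lemma weight_le A B : measurable A -> measurable B -> A `<=` B ->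
  weight A <= weight B.
Proof.
by move=> mA mB AB; rewrite -lee_fin !weightE// le_measure// inE.
Qed.

Lemma weightD A B : measurable A -> measurable B -> A `<=` B ->
  weight (B `\` A) = weight B - weight A.
Proof.
move=> mA mB AB; apply: EFin_inj; rewrite EFinB !weightE//; last exact: measurableD.
rewrite measureD//; first by rewrite setIidr.
by rewrite (le_lt_trans (probability_le1 m mB))// ltry.
Qed.

Lemma weightU_le A B : measurable A -> measurable B ->
  weight (A `|` B) <= weight A + weight B.
Proof.
move=> mA mB; rewrite -lee_fin EFinD !weightE//; last exact: measurableU.
exact: measureU2.
Qed.

Lemma expect_sum (J : Type) (s : seq J) (P : pred J) f :
  (forall j, bounded_measurable (f j)) ->
  expect (fun x => \sum_(j <- s | P j) f j x) = \sum_(j <- s | P j) expect (f j).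
Proof.
move=> fP; elim: s => [|j s IH].
  by rewrite big_nil -[RHS](expect_cst 0); apply: expect_eq => x; rewrite big_nil.
rewrite big_cons; case: ifPn => Pj.
  rewrite -IH -expectD//; last exact: bounded_measurable_sum.
  by apply: expect_eq => x; rewrite big_cons Pj.
by rewrite -IH; apply: expect_eq => x; rewrite big_cons (negbTE Pj).
Qed.

End bounded_integrands.

(** * Geometric growth *)

Section geometric_growth.
Variable R : realType.
Implicit Types (c t y K B M : R) (a : nat -> R).

Lemma bernoulli_le (z : R) k : 0 <= z <= 1 -> 1 - k%:R * z <= (1 - z) ^+ k.
Proof.
move=> /andP[z0 z1]; elim: k => [|k IH]; first by rewrite mul0r subr0 expr0.
have k0 : (0 : R) <= k%:R by [].
have : (1 - k%:R * z) * (1 - z) <= (1 - z) ^+ k * (1 - z).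
  by rewrite ler_wpM2r//; lra.
rewrite exprSr -natr1; apply: le_trans.
have kz : 0 <= k%:R * z * z by rewrite !mulr_ge0.
by lra.
Qed.

Lemma bernoulli_ge (z : R) k : 0 <= z -> 1 + k%:R * z <= (1 + z) ^+ k.
Proof.
move=> z0; elim: k => [|k IH]; first by rewrite mul0r addr0 expr0.
have k0 : (0 : R) <= k%:R by [].
have : (1 + k%:R * z) * (1 + z) <= (1 + z) ^+ k * (1 + z).
  by rewrite ler_wpM2r//; lra.
rewrite exprSr -natr1; apply: le_trans.
have kz : 0 <= k%:R * z * z by rewrite !mulr_ge0.
by lra.
Qed.

(** Stands in for the k-th root of [y]: by Bernoulli's inequality the explicit rate [t * (1 - z)] is
    still large enough. *)
Lemma root_below t y k : 0 < t -> 0 <= y -> (0 < k)%N -> y < t ^+ k ->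
  exists c, [/\ 0 < c, c < t & y <= c ^+ k].
Proof.
move=> t0 y0 k0 yt; set s := t ^+ k in yt *; have s0 : 0 < s by exact: exprn_gt0.
have k1 : (0 : R) < k.+1%:R by [].
set z := (s - y) / (s * k.+1%:R).
have z0 : 0 < z by rewrite divr_gt0 ?mulr_gt0 ?subr_gt0.
have kz : k.+1%:R * (s * z) = s - y.
  by rewrite /z; field; rewrite ?gt_eqF.
have z1 : z < 1.
  rewrite ltr_pdivrMr ?mulr_gt0// mul1r.
  have : s * 2 <= s * k.+1%:R by rewrite ler_pM2l// ler_nat.
  by lra.
have sE : t ^+ k = s by [].
clearbody z s; exists (t * (1 - z)); split.
- by rewrite mulr_gt0//; lra.
- by rewrite gtr_pMr//; lra.
- rewrite exprMn sE; apply: (@le_trans _ _ (s * (1 - k%:R * z))).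
    have sz : 0 < s * z by rewrite mulr_gt0.
    by move: kz; rewrite -natr1 mulrDl mul1r mulrBr mulr1 [s * (_ * _)]mulrCA; lra.
  by rewrite ler_pM2l// bernoulli_le// !ltW.
Qed.

Lemma geometric_gap c t K : 0 < c -> c < t -> exists n,
  K * n.+1%:R * c ^+ n < t ^+ n.
Proof.
move=> c0 ct; set s := (t - c) / c.
have s0 : 0 < s by rewrite divr_gt0//; lra.
have tE : t = c * (1 + s) by rewrite /s; field; rewrite gt_eqF.
have [k] : exists k : nat, 3 * `|K| / s ^+ 2 + 1 < k%:R.
  exists (Num.bound (3 * `|K| / s ^+ 2 + 1)); apply: archi_boundP.
  apply: addr_ge0 => //; apply: divr_ge0; first exact: mulr_ge0.
  exact/exprn_ge0/ltW.
(* With exponent [k + k], Bernoulli's inequality at [k] can be squared; the result is quadratic in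
   [k] and beats the linear factor [n.+1]. *)
move=> kK; exists (k + k)%N; rewrite tE exprMn mulrC ltr_pM2l ?exprn_gt0//.
have s20 : 0 < s ^+ 2 by rewrite exprn_gt0.
have K0 : 0 <= `|K| by [].
have k1 : 1 <= k%:R :> R.
  have : 0 <= 3 * `|K| / s ^+ 2 by apply: divr_ge0; [exact: mulr_ge0|exact: ltW].
  by lra.
have : 1 + k%:R * s <= (1 + s) ^+ k by rewrite bernoulli_ge// ltW.
have ks0 : 0 <= k%:R * s by rewrite mulr_ge0// ltW.
move=> h; have h2 : (k%:R * s) * (k%:R * s) < (1 + s) ^+ (k + k).
  by rewrite exprD; apply: ltr_pM => //; lra.
apply: le_lt_trans h2.
have : K * (k + k).+1%:R <= `|K| * (3 * k%:R).
  apply: (@le_trans _ _ (`|K| * (k + k).+1%:R)).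
    by rewrite ler_wpM2r ?ler_norm.
  by rewrite ler_wpM2l// -natr1 natrD; lra.
move=> /le_trans; apply.
have : 3 * `|K| / s ^+ 2 * s ^+ 2 <= k%:R * s ^+ 2 by rewrite ler_wpM2r ?ltW//; lra.
rewrite divfK ?gt_eqF// => h3.
have : k%:R * (3 * `|K|) <= k%:R * (k%:R * s ^+ 2) by rewrite ler_wpM2l//; lra.
by rewrite expr2; lra.
Qed.

(** Fekete's argument: each block of length [k] contributes [c ^+ k], and [(1 + M / c) ^+ k] pays
    for the remainder shorter than [k]. One good exponent thus controls the growth at all [n]. *)
Lemma submultiplicative_bound a c M k : (forall n, 0 <= a n) ->
  (forall n j, a (n + j)%N <= a n * a j) -> (forall n, a n <= M ^+ n) ->
  0 < c -> 0 <= M -> (0 < k)%N -> a k <= c ^+ k ->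
  forall n, a n <= (1 + M / c) ^+ k * c ^+ n.
Proof.
move=> a0 aM aB c0 M0 k0 ak; have Mc : 0 <= M / c by rewrite divr_ge0// ltW.
elim/ltn_ind => n IH; have [nk|kn] := ltnP n k.
  rewrite (le_trans (aB n))//.
  have -> : M ^+ n = (M / c) ^+ n * c ^+ n by rewrite -exprMn divfK// gt_eqF.
  rewrite ler_wpM2r ?exprn_ge0 ?(ltW c0)//.
  apply: (@le_trans _ _ ((1 + M / c) ^+ n)); first by rewrite lerXn2r ?nnegrE; lra.
  by rewrite ler_weXn2l// ?(ltnW nk)//; lra.
rewrite -(subnKC kn) (le_trans (aM _ _))// exprD mulrCA ler_pM//.
by apply: IH; rewrite -subn_gt0 subKn.
Qed.

End geometric_growth.

(** * Smooth functionals of families of clopen sets *)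

Lemma grid_cell (R : realType) (e v : R) n : 0 < e -> v <= n%:R * e ->
  v <= 0 \/ exists j, [/\ (j < n)%N, j%:R * e < v & v <= j%:R * e + e].
Proof.
move=> e0; elim: n => [|n IH] vn; first by left; rewrite mul0r in vn.
have [/IH[|[j [jn h1 h2]]]|nv] := leP v (n%:R * e); first by left.
  by right; exists j; split => //; exact: ltnW.
right; exists n; split => //.
by rewrite -[X in _ + X]mul1r -mulrDl -natr1 // in vn *.
Qed.

(** [List.In] is used because the index type comes without decidable equality. *)
Definition members (I : Type) (s : seq I) : set I := [set a | List.In a s].

Lemma members_catl (I : Type) (s s' : seq I) : members s `<=` members (s ++ s').
Proof. by move=> a ?; apply: List.in_or_app; left. Qed.

Lemma members_catr (I : Type) (s s' : seq I) : members s' `<=` members (s ++ s').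
Proof. by move=> a ?; apply: List.in_or_app; right. Qed.

Lemma members_cat_sub (I : Type) (s s' : seq I) G :
  members s `<=` G -> members s' `<=` G -> members (s ++ s') `<=` G.
Proof. by move=> sG sG' a h; case: (List.in_app_or s s' a h) => [/sG|/sG']. Qed.

Section functionals.
Context (R : realType) (T : ptopologicalType) (I : Type).
Variables (m : probability (borel T) R) (C : I -> set T).
Notation bm := (@bounded_measurable _ (borel T) R).
Notation w := (weight m).

Definition sieve (G : set I) (b : bool) (x : T) : set I :=
  [set a | G a /\ `[< C a x >] = b].

Definition functional := set I -> R.

Implicit Types (F : bool -> set (borel T)) (G : set I) (Phi Psi : functional).

(* The functionals to which monotone approximation by finite families applies;
   on clopen families they are lower semicontinuous along [sieve], which is what
   makes iterated expectations over uncountable families legitimate. *)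
Definition smooth (Phi : functional) : Prop :=
  [/\ forall G H, G `<=` H -> Phi G <= Phi H,
      exists K, forall G, 0 <= Phi G <= K &
      forall G e, 0 < e -> exists s, members s `<=` G /\
        Phi G <= Phi (members s) + e].

Lemma sieve_sub G b x : sieve G b x `<=` G.
Proof. by move=> a []. Qed.

Lemma sieveS G H b x : G `<=` H -> sieve G b x `<=` sieve H b x.
Proof. by move=> GH a [/GH]. Qed.

Lemma sieveC G b x b' y : sieve (sieve G b x) b' y = sieve (sieve G b' y) b x.
Proof. by apply/seteqP; split => a [[Ga h1] h2]. Qed.

Lemma smooth_ge0 Phi G : smooth Phi -> 0 <= Phi G.
Proof. by case=> _ [K /(_ G)/andP[]]. Qed.

Lemma smooth_le Phi G H : smooth Phi -> G `<=` H -> Phi G <= Phi H.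
Proof. by case=> mono _ _; exact: mono. Qed.

Lemma smoothD Phi Psi : smooth Phi -> smooth Psi ->
  smooth (fun G => Phi G + Psi G).
Proof.
move=> [mP [K PK] iP] [mQ [K' QK] iQ]; split.
- by move=> G H GH; rewrite lerD ?mP ?mQ.
- exists (K + K') => G; have /andP[f0 f1] := PK G; have /andP[g0 g1] := QK G.
  by rewrite addr_ge0 ?lerD.
- move=> G e e0; have e20 : 0 < e / 2 by lra.
  have [s [sG Ps]] := iP G _ e20; have [s' [sG' Qs]] := iQ G _ e20.
  exists (s ++ s'); split; first exact: members_cat_sub.
  have := mP _ _ (@members_catl _ s s'); have := mQ _ _ (@members_catr _ s s').
  lra.
Qed.

Lemma smoothZ c Phi : 0 <= c -> smooth Phi -> smooth (fun G => c * Phi G).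
Proof.
move=> c0 [mP [K PK] iP]; split.
- by move=> G H GH; rewrite ler_wpM2l ?mP.
- exists (c * K) => G; have /andP[f0 f1] := PK G.
  by rewrite mulr_ge0 ?ler_wpM2l.
- move=> G e e0; have ec0 : 0 < e / (c + 1) by rewrite divr_gt0//; lra.
  have [s [sG Ps]] := iP G _ ec0; exists s; split => //.
  have : c * Phi G <= c * (Phi (members s) + e / (c + 1)) by rewrite ler_wpM2l.
  have : c * (e / (c + 1)) <= e.
    rewrite mulrA ler_pdivrMr; last lra.
    by rewrite mulrC ler_pM2l//; lra.
  by rewrite mulrDr; lra.
Qed.

Definition has_member : functional := fun G => (`[< G !=set0 >])%:R.

Lemma has_member1 (G : set I) : G !=set0 -> has_member G = 1.
Proof. by move=> nG; rewrite /has_member asboolT. Qed.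

Lemma has_member0 (G : set I) : ~ (G !=set0) -> has_member G = 0.
Proof. by move=> nG; rewrite /has_member asboolF. Qed.

Lemma smooth_has_member : smooth has_member.
Proof.
split.
- move=> G H GH; rewrite {1}/has_member; case: asboolP => [[a Ga]|_]; last exact: ler0n.
  by rewrite /has_member asboolT//; exists a; exact: GH.
- by exists 1 => G; rewrite /has_member; case: asboolP; rewrite ?lexx ler01.
- move=> G e e0; rewrite {1}/has_member; case: asboolP => [[a Ga]|nG].
    exists [:: a]; split; first by move=> b [<-|[]].
    rewrite /has_member asboolT; first by rewrite lerDl ltW.
    by exists a; left.
  exists [::]; split; first by move=> a [].
  by rewrite addr_ge0 // ?ltW // /has_member ler0n.
Qed.

Hypothesis C_clopen : forall a, clopen (C a).

Hypothesis inner_regular : forall O : set T, open O -> forall e : R, 0 < e ->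
  exists K : set T, [/\ compact K, measurable (K : set (borel T)), K `<=` O &
    weight m O <= weight m K + e].

Lemma near_sieve (s : seq I) b x (G : set I) : members s `<=` sieve G b x ->
  \forall y \near x, members s `<=` sieve G b y.
Proof.
elim: s => [|a s IH] sG; first by apply: nearW => y a [].
have /IH h : members s `<=` sieve G b x by move=> c cs; apply: sG; right.
have [Ga ax] := sG a (or_introl erefl).
have : \forall y \near x, `[< C a y >] = b.
  have [Co Cc] := C_clopen a; case: b {sG IH h} ax => /asboolP ax.
    have : nbhs x (C a) by apply: open_nbhs_nbhs.
    by apply: filterS => y ?; apply/asboolP.
  have : nbhs x (~` C a) by apply: open_nbhs_nbhs; split => //; exact: closed_openC.
  by apply: filterS => y ?; apply/asboolP.
move: h; apply: filterS2 => y h1 h2 c [<-//|/h1//].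
Qed.

(** Lower semicontinuity: a finite subfamily nearly attaining the value at [x] stays, its sets being
    clopen, inside the sieve of every nearby point. *)
Lemma smooth_open Phi G b t : smooth Phi -> open [set x | t < Phi (sieve G b x)].
Proof.
move=> [mP _ iP]; rewrite openE => x /= tx.
have e0 : 0 < (Phi (sieve G b x) - t) / 2 by lra.
have [s [sG Ps]] := iP (sieve G b x) _ e0.
have := near_sieve sG; apply: filterS => y sy /=.
by have := mP _ _ sy; lra.
Qed.

Lemma smooth_measurable Phi G b : smooth Phi ->
  measurable_fun setT (fun x : borel T => Phi (sieve G b x)).
Proof.
move=> sP; apply: (measurability _ (RGenOInfty.measurableE R)).
move=> _ [_ [t ->] <-]; rewrite setTI; apply: sub_sigma_algebra.
rewrite (_ : _ @^-1` _ = [set x | t < Phi (sieve G b x)]); first exact: smooth_open.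
by apply/seteqP; split => x /=; rewrite in_itv/= andbT.
Qed.

Lemma smooth_bounded_measurable Phi G b : smooth Phi ->
  bounded_measurable (fun x : borel T => Phi (sieve G b x)).
Proof.
move=> sP; split; first exact: smooth_measurable.
by case: sP => _ [K PK] _; exists K => x.
Qed.

(** Finite subfamilies that witness the bound at single points give an open cover of [K]; by
    monotonicity the finitely many that suffice can be concatenated. *)
Lemma compact_finite_family Phi G b t (K : set T) : smooth Phi -> compact K ->
  (forall x, K x -> t < Phi (sieve G b x)) ->
  exists s, members s `<=` G /\ forall x, K x -> t < Phi (sieve (members s) b x).
Proof.
move=> sP cK Kt; rewrite compact_cover in cK.
have [|x Kx|D DG KD] := cK {classic (seq I)} [set s | members s `<=` G]
    (fun s => [set x | t < Phi (sieve (members s) b x)]).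
- by move=> s _; exact: smooth_open.
- have e0 : 0 < (Phi (sieve G b x) - t) / 2 by have := Kt x Kx; lra.
  have [mP _ iP] := sP; have [s [sG Ps]] := iP (sieve G b x) _ e0.
  exists s; first by move=> a /sG[].
  rewrite /=; have : members s `<=` sieve (members s) b x.
    by move=> a as_; split => //; case: (sG a as_).
  by move=> /mP; have := Kt x Kx; lra.
have /finite_seqP[r Dr] := finite_fset D.
have [s [sG sD]] : exists s : seq I, members s `<=` G /\
    forall s', s' \in r -> members s' `<=` members s.
  have : forall s', s' \in r -> members s' `<=` G.
    move=> s' s'r; have : [set` r] s' by [].
    by rewrite -Dr => /DG; rewrite inE.
  elim: r {Dr} => [|u r IH] h; first by exists [::]; split => // a [].
  have [|s [sG sr]] := IH; first by move=> s' s'r; apply: h; rewrite inE s'r orbT.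
  exists ((u : seq I) ++ s); split.
    by apply: members_cat_sub => //; apply: h; exact: mem_head.
  move=> s'; rewrite inE => /predU1P[->|/sr s's]; first exact: members_catl.
  exact: (subset_trans s's (@members_catr _ _ _)).
exists s; split => // x /KD[s' s'D /= /lt_le_trans]; apply.
by apply: (smooth_le sP); apply: sieveS; apply: sD; move: s'D; rewrite Dr.
Qed.

(** Only finitely many levels [j * e] matter for a bounded functional. At each, the open superlevel
    set is replaced by a compact subset, on which a finite family suffices; the discarded
    differences form [B]. *)
Lemma finite_family_approx Phi G b e : smooth Phi -> 0 < e ->
  exists s, exists B : set (borel T), [/\ members s `<=` G, measurable B,
    weight m B <= e &
    forall x, ~ B x -> Phi (sieve G b x) <= Phi (sieve (members s) b x) + e].
Proof.
move=> sP e0; have [mP [K PK] _] := sP.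
have [n nK] : exists n : nat, K <= n%:R * e.
  exists (Num.bound `|K / e|); rewrite -ler_pdivrMr//.
  by rewrite (le_trans (ler_norm _))// ltW// archi_boundP.
(* Induction on the number [k] of levels treated; each adds at most [e / n.+1%:R] to the weight of
   [B]. *)
suff: forall k : nat, exists s, exists B : set (borel T), [/\ members s `<=` G,
    measurable B, weight m B <= k%:R * (e / n.+1%:R) &
    forall x j, (j < k)%N -> ~ B x -> j%:R * e < Phi (sieve G b x) ->
      j%:R * e < Phi (sieve (members s) b x)].
  move=> /(_ n)[s [B [sG mB wB h]]]; exists s, B; split => //.
    rewrite (le_trans wB)// mulrCA ler_piMr//; first exact: ltW.
    by rewrite ler_pdivrMr// mul1r ler_nat.
  move=> x Bx; have /andP[P0 PK'] := PK (sieve G b x).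
  have [v0|[j [jn h1 h2]]] := grid_cell e0 (le_trans PK' nK).
    by rewrite (le_trans v0)// addr_ge0 ?(smooth_ge0 _ sP) ?ltW.
  by have := h x j jn Bx h1; lra.
elim=> [|k [s [B [sG mB wB h]]]].
  by exists [::], set0; split => //; rewrite weight0 mul0r.
set O := [set x | k%:R * e < Phi (sieve G b x)].
have oO : open O by exact: smooth_open.
have mO : measurable (O : set (borel T)) by exact: sub_sigma_algebra.
have e'0 : 0 < e / n.+1%:R by rewrite divr_gt0.
have [Q [cQ mQ QO wQ]] := inner_regular oO e'0.
have [s' [sG' h']] := @compact_finite_family Phi G b (k%:R * e) Q sP cQ QO.
exists (s ++ s'), (B `|` (O `\` Q)); split.
- exact: members_cat_sub.
- by apply: measurableU => //; exact: measurableD.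
- rewrite (le_trans (weightU_le _ _ _))//; first exact: measurableD.
  by rewrite weightD// -[k.+1%:R]natr1 mulrDl mul1r lerD// lerBlDl.
- move=> x j; rewrite ltnS => jk /not_orP[Bx OQ] jG.
  have [jk'|jk'] := ltnP j k.
    rewrite (lt_le_trans (h x j jk' Bx jG))// (smooth_le sP)//; apply: sieveS; exact: members_catl.
  have {jk jk'} jk : j = k by apply/eqP; rewrite eqn_leq jk jk'.
  subst j; have Qx : Q x by apply: contrapT => nQ; apply: OQ.
  rewrite (lt_le_trans (h' x Qx))// (smooth_le sP)//; apply: sieveS; exact: members_catr.
Qed.

Definition draw (al : T -> R) (b : bool) (Phi : functional) : functional :=
  fun G => expect m (fun x => al x * Phi (sieve G b x)).

Lemma drawE al b Phi G :
  draw al b Phi G = expect m (fun x => al x * Phi (sieve G b x)).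
Proof. by []. Qed.

Lemma draw_integrand al b Phi G : bm al -> smooth Phi ->
  bm (fun x => al x * Phi (sieve G b x)).
Proof.
by move=> bal sP; apply: bounded_measurableM => //; exact: smooth_bounded_measurable.
Qed.

(** Smoothness survives taking expectations, which is what permits iteration. *)
Lemma smooth_draw al b Phi : bm al -> smooth Phi -> smooth (draw al b Phi).
Proof.
move=> bal sP; have [mal [A alA]] := bal; have [mP [K PK] iP] := sP.
have al0 x : 0 <= al x by have /andP[] := alA x.
have A0 : 0 <= A by have /andP[+ h] := alA point => /le_trans; exact.
have K0 : 0 <= K by have /andP[+ h] := PK set0 => /le_trans; exact.
split.
- move=> G H GH; apply: expect_le; [exact: draw_integrand..|move=> x].
  by rewrite ler_wpM2l// mP//; exact: sieveS.
- exists (A * K) => G; apply/andP; split.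
    by apply: expect_ge0 => x; rewrite mulr_ge0// (smooth_ge0 _ sP).
  rewrite -[leRHS](expect_cst m); apply: expect_le; first exact: draw_integrand.
    by apply: bounded_measurable_cst; rewrite mulr_ge0.
  by move=> x; have /andP[? ?] := alA x; have /andP[? ?] := PK (sieve G b x);
     rewrite ler_pM.
(* With [e'] the quotient below, passing to the finite family costs at most [A * e'] off [B] and at
   most [A * K] on [B], where the weight of [B] is at most [e']. *)
- move=> G e e0; have c0 : 0 < A + A * K + 1 by rewrite ltr_wpDl// addr_ge0// mulr_ge0.
  have e'0 : 0 < e / (A + A * K + 1) by rewrite divr_gt0.
  have [s [B [sG mB wB h]]] := finite_family_approx G b sP e'0.
  exists s; split => //; set e' := e / _ in e'0 wB h.
  apply: (@le_trans _ _ (expect m (fun x =>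
      al x * Phi (sieve (members s) b x) + (A * e' + A * K * \1_B x)))).
    apply: expect_le; first exact: draw_integrand.
      apply: bounded_measurableD; first exact: draw_integrand.
      apply: bounded_measurableD.
        by apply: bounded_measurable_cst; rewrite mulr_ge0// ltW.
      apply: bounded_measurableZ; first by rewrite mulr_ge0.
      exact: bounded_measurable_indic.
    move=> x; have /andP[a0 aA] := alA x.
    have /andP[p0 pK] := PK (sieve G b x); have /andP[q0 qK] := PK (sieve (members s) b x).
    rewrite indicE; have [Bx|nBx] := boolP (x \in B).
      have : al x * Phi (sieve G b x) <= A * K by rewrite ler_pM.
      have : 0 <= al x * Phi (sieve (members s) b x) by rewrite mulr_ge0.
      have : 0 <= A * e' by rewrite mulr_ge0// ltW.
      by rewrite mulr1; lra.
    have {}h := h x; rewrite notin_setE in nBx; have {}h := h nBx.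
    have : al x * Phi (sieve G b x) <= al x * (Phi (sieve (members s) b x) + e').
      by rewrite ler_wpM2l.
    have : al x * e' <= A * e' by rewrite ler_wpM2r// ltW.
    by rewrite mulr0 mulrDr; lra.
  rewrite expectD; last 2 first.
  - exact: draw_integrand.
  - apply: bounded_measurableD.
      by apply: bounded_measurable_cst; rewrite mulr_ge0// ltW.
    apply: bounded_measurableZ; first by rewrite mulr_ge0.
    exact: bounded_measurable_indic.
  rewrite lerD2l expectD; last 2 first.
  - by apply: bounded_measurable_cst; rewrite mulr_ge0// ltW.
  - apply: bounded_measurableZ; first by rewrite mulr_ge0.
    exact: bounded_measurable_indic.
  rewrite expect_cst expectZ; last exact: bounded_measurable_indic.
  rewrite expect_indic//.
  have : A * K * weight m B <= A * K * e' by rewrite ler_wpM2l// mulr_ge0.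
  have : (A + A * K + 1) * e' = e by rewrite mulrCA divff ?mulr1// gt_eqF.
  have := ltW e'0; lra.
Qed.

Definition trace (s : seq I) (x : T) : (size s).-tuple bool :=
  map_tuple (fun a => `[< C a x >]) (in_tuple s).

Lemma traceP s x y : trace s x = trace s y ->
  forall a, List.In a s -> `[< C a x >] = `[< C a y >].
Proof.
move=> /(congr1 val) /=; elim: s => [//|a s IH] /= [ha hs] c [<-//|].
exact: IH.
Qed.

Lemma sieve_trace s b x y G : G `<=` members s -> trace s x = trace s y ->
  sieve G b x = sieve G b y.
Proof.
move=> Gs /traceP h; apply/seteqP.
by split => a [Ga <-]; split => //; rewrite h//; exact: Gs.
Qed.

Lemma measurable_trace s t :
  measurable ([set x | trace s x = t] : set (borel T)).
Proof.
rewrite (_ : [set x | _] = [set x | [seq `[< C a x >] | a <- s] = t]); last first.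
  by apply/seteqP; split => x /=; [move=> <-|move=> h; exact: val_inj].
move: (tval t) => {t} t; elim: s t => [|a s IH] [|b t] /=.
- rewrite (_ : [set x | _] = setT); last by apply/seteqP.
  exact: measurableT.
- rewrite (_ : [set x | _] = set0); last by apply/seteqP; split => x.
  exact: measurable0.
- rewrite (_ : [set x | _] = set0); last by apply/seteqP; split => x.
  exact: measurable0.
rewrite (_ : [set x | _] = [set x | `[< C a x >] = b] `&`
    [set x | [seq `[< C c x >] | c <- s] = t]); last first.
  by apply/seteqP; split => x /= [-> ->].
apply: measurableI; last exact: IH.
have [Co _] := C_clopen a.
have mC : measurable (C a : set (borel T)) by exact: sub_sigma_algebra.
case: b.
  by rewrite (_ : [set x | _] = C a)//; apply/seteqP; split => x /= /asboolP.
rewrite (_ : [set x | _] = ~` C a); first exact: measurableC.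
apply/seteqP; split => x /=; first by move=> /negbT/asboolPn.
by move=> /asboolPn/negbTE.
Qed.

(** On an empty cell this is the default [point]; in [expect_trace] such a cell carries the factor
    0. *)
Definition trace_point s t : T := xget point [set x | trace s x = t].

Lemma trace_pointK s x : trace s (trace_point (trace s x)) = trace s x.
Proof. exact: (@xgetPex _ point [set y | trace s y = trace s x] (ex_intro _ x erefl)). Qed.

Lemma expect_trace s al h : bm al -> (forall x, 0 <= h x) ->
  (forall x y, trace s x = trace s y -> h x = h y) ->
  expect m (fun x => al x * h x) =
  \sum_(t : (size s).-tuple bool)
    expect m (fun x => al x * \1_[set x | trace s x = t] x) * h (trace_point t).
Proof.
move=> bal h0 hs.
have bi t : bm (fun x => al x * \1_[set x | trace s x = t] x).
  apply: bounded_measurableM => //; apply: bounded_measurable_indic.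
  exact: measurable_trace.
under eq_bigr do rewrite mulrC -expectZ//.
rewrite -expect_sum; last by move=> t; exact: bounded_measurableZ.
apply: expect_eq => x; rewrite (bigD1 (trace s x))//= big1.
  rewrite addr0 indicE mem_set//= mulr1 mulrC; congr (_ * _).
  by apply: hs; rewrite trace_pointK.
move=> t tx; rewrite indicE memNset ?mulr0//= => xt.
by rewrite xt eqxx in tx.
Qed.

(** On a finite family both iterated expectations are the same finite double sum over traces, which
    replaces Fubini's theorem. *)
Lemma draw_comm_members al b be b' Phi s : bm al -> bm be ->
  smooth Phi ->
  draw al b (draw be b' Phi) (members s) =
  draw be b' (draw al b Phi) (members s).
Proof.
move=> bal bbe sP; have be0 x := @bounded_measurable_ge0 _ _ _ _ x bbe.
have al0 x := @bounded_measurable_ge0 _ _ _ _ x bal.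
have dbl al' b1 be' b2 : bm al' -> bm be' ->
    draw al' b1 (draw be' b2 Phi) (members s) =
    \sum_(t : (size s).-tuple bool) \sum_(u : (size s).-tuple bool)
      expect m (fun x => al' x * \1_[set x | trace s x = t] x) *
      expect m (fun x => be' x * \1_[set x | trace s x = u] x) *
      Phi (sieve (sieve (members s) b1 (trace_point t)) b2 (trace_point u)).
  move=> ba bb; have bb0 x := @bounded_measurable_ge0 _ _ _ _ x bb.
  rewrite {1}/draw (@expect_trace s _
      (fun x => draw be' b2 Phi (sieve (members s) b1 x)))//; last 2 first.
  - by move=> x; apply: expect_ge0 => y; rewrite mulr_ge0// (smooth_ge0 _ sP).
  - by move=> x y xy; rewrite (sieve_trace _ _ xy).
  apply: eq_bigr => t _; rewrite /draw (@expect_trace s _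
      (fun y => Phi (sieve (sieve (members s) b1 (trace_point t)) b2 y)))//; last 2 first.
  - by move=> x; rewrite (smooth_ge0 _ sP).
  - by move=> x y xy; rewrite (sieve_trace _ _ xy)//; exact: sieve_sub.
  by rewrite mulr_sumr; apply: eq_bigr => u _; rewrite mulrA.
rewrite dbl// dbl// exchange_big/=.
apply: eq_bigr => u _; apply: eq_bigr => t _.
by rewrite sieveC [in LHS]mulrAC mulrAC -mulrA mulrCA mulrA.
Qed.

(** A smooth functional is the supremum of its values on finite subfamilies. *)
Lemma smooth_ext Phi Psi :
  smooth Phi -> smooth Psi -> (forall s, Phi (members s) = Psi (members s)) ->
  Phi =1 Psi.
Proof.
move=> sP sQ PQ G; apply/eqP; rewrite eq_le; apply/andP; split.
  apply/ler_addgt0Pr => e e0; have [_ _ iP] := sP; have [s [sG h]] := iP G e e0.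
  by rewrite (le_trans h)// PQ lerD2r (smooth_le sQ).
apply/ler_addgt0Pr => e e0; have [_ _ iP] := sQ; have [s [sG h]] := iP G e e0.
by rewrite (le_trans h)// -PQ lerD2r (smooth_le sP).
Qed.

Lemma draw_comm al b be b' Phi : bm al -> bm be -> smooth Phi ->
  draw al b (draw be b' Phi) =1 draw be b' (draw al b Phi).
Proof.
move=> bal bbe sP; apply: smooth_ext => [||s]; last exact: draw_comm_members.
- by do 2!apply: smooth_draw => //.
- by do 2!apply: smooth_draw => //.
Qed.

Lemma drawD al b Phi Psi G : bm al -> smooth Phi -> smooth Psi ->
  draw al b (fun G => Phi G + Psi G) G = draw al b Phi G + draw al b Psi G.
Proof.
move=> bal sP sQ; rewrite !drawE -expectD//; try exact: draw_integrand.
by apply: expect_eq => x; rewrite mulrDr.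
Qed.

Lemma draw_cst c b Phi G : smooth Phi ->
  draw (fun=> c) b Phi G = c * draw (fun=> 1) b Phi G.
Proof.
move=> sP; rewrite !drawE -expectZ.
  by apply: expect_eq => x; rewrite mul1r.
by apply: draw_integrand => //; exact: bounded_measurable_cst.
Qed.

Lemma draw_le al b Phi Psi G : bm al -> smooth Phi -> smooth Psi ->
  (forall x, 0 < al x -> Phi (sieve G b x) <= Psi (sieve G b x)) ->
  draw al b Phi G <= draw al b Psi G.
Proof.
move=> bal sP sQ PQ; apply: expect_le; [exact: draw_integrand..|move=> x].
have := bounded_measurable_ge0 x bal; rewrite le_eqVlt => /predU1P[<-|al0].
  by rewrite !mul0r.
by rewrite ler_wpM2l ?PQ// ltW.
Qed.

(* One step of a sampling process: a random point splits the family into the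
   members that contain it and those that do not, and both parts are pursued. *)
Definition level (al : bool -> T -> R) Phi : functional :=
  fun G => draw (al true) true Phi G + draw (al false) false Phi G.

Lemma levelE al Phi G :
  level al Phi G = draw (al true) true Phi G + draw (al false) false Phi G.
Proof. by []. Qed.

Lemma smooth_level al Phi : (forall b, bm (al b)) -> smooth Phi ->
  smooth (level al Phi).
Proof. by move=> bal sP; apply: smoothD; exact: smooth_draw. Qed.

Lemma smooth_iter_level al n Phi : (forall b, bm (al b)) -> smooth Phi ->
  smooth (iter n (level al) Phi).
Proof. by move=> bal sP; elim: n => [//|n IH]; exact: smooth_level. Qed.

Lemma level_le al Phi Psi G : (forall b, bm (al b)) -> smooth Phi -> smooth Psi ->
  (forall b x, 0 < al b x -> Phi (sieve G b x) <= Psi (sieve G b x)) ->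
  level al Phi G <= level al Psi G.
Proof. by move=> bal sP sQ PQ; rewrite lerD// draw_le// => x; exact: PQ. Qed.

Lemma levelD al Phi Psi G : (forall b, bm (al b)) -> smooth Phi -> smooth Psi ->
  level al (fun G => Phi G + Psi G) G = level al Phi G + level al Psi G.
Proof. by move=> bal sP sQ; rewrite /level !drawD// addrACA. Qed.

Lemma levelZ al c Phi G : (forall b, bm (al b)) -> smooth Phi ->
  level al (fun G => c * Phi G) G = c * level al Phi G.
Proof.
move=> bal sP; rewrite levelE !drawE mulrDr -!expectZ; try exact: draw_integrand.
by congr (_ + _); apply: expect_eq => x; rewrite mulrCA.
Qed.

Lemma level_comm al be Phi : (forall b, bm (al b)) -> (forall b, bm (be b)) ->
  smooth Phi -> level al (level be Phi) =1 level be (level al Phi).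
Proof.
move=> bal bbe sP G; rewrite !levelE.
have split al' be' b : (forall b, bm (al' b)) -> (forall b, bm (be' b)) ->
    draw (al' b) b (level be' Phi) G =
    draw (al' b) b (draw (be' true) true Phi) G +
    draw (al' b) b (draw (be' false) false Phi) G.
  by move=> ba bb; apply: (drawD _ _ (ba b)); exact: smooth_draw.
rewrite (split al be true bal bbe) (split al be false bal bbe).
rewrite (split be al true bbe bal) (split be al false bbe bal) addrACA.
rewrite (draw_comm true true (bal true) (bbe true) sP G).
rewrite (draw_comm true false (bal true) (bbe false) sP G).
rewrite (draw_comm false true (bal false) (bbe true) sP G).
by rewrite (draw_comm false false (bal false) (bbe false) sP G).
Qed.

(** * Growth of the number of patterns *)

Definition on F : bool -> T -> R := fun b => \1_(F b).

Definition mass F : R := w (F true) + w (F false).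

(* Expected number of the patterns that members of [G] leave on [n] independent
   points; [F b] restricts the points at which the pattern has the value [b]. *)
Definition patterns F n : functional := iter n (level (on F)) has_member.

Definition meas F := forall b, measurable (F b).

Lemma bm_on F : meas F -> forall b, bm (on F b).
Proof. by move=> mF b; exact: bounded_measurable_indic. Qed.

Lemma smooth_cst (c : R) : 0 <= c -> smooth (fun _ : set I => c).
Proof.
move=> c0; split => //; first by exists c => _; rewrite c0 lexx.
by move=> G e e0; exists [::]; split; [move=> a []|rewrite lerDl ltW].
Qed.

Lemma has_member_le1 G : has_member G <= 1.
Proof.
by have [h|h] := pselect (G !=set0); [rewrite has_member1|rewrite has_member0].
Qed.

Lemma smooth_patterns F n : meas F -> smooth (patterns F n).
Proof.
move=> mF; apply: smooth_iter_level => //; first exact: bm_on.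
exact: smooth_has_member.
Qed.

Lemma patternsS F n G : patterns F n.+1 G = level (on F) (patterns F n) G.
Proof. by []. Qed.

Lemma patterns_ge0 F n G : meas F -> 0 <= patterns F n G.
Proof. by move=> mF; rewrite (smooth_ge0 _ (smooth_patterns n mF)). Qed.

Lemma patterns_le F n G H : meas F -> G `<=` H -> patterns F n G <= patterns F n H.
Proof. by move=> mF; apply: smooth_le; exact: smooth_patterns. Qed.

Lemma mass_ge0 F : 0 <= mass F.
Proof. by rewrite addr_ge0 ?weight_ge0. Qed.

Lemma mass_le2 F : meas F -> mass F <= 2.
Proof. by move=> mF; have := weight_le1 m (mF true); have := weight_le1 m (mF false);
  rewrite /mass; lra. Qed.

Lemma mass_le F F' : meas F -> meas F' -> (forall b, F b `<=` F' b) ->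
  mass F <= mass F'.
Proof. by move=> mF mF' FF'; rewrite lerD// weight_le. Qed.

Lemma draw_on F b c G : meas F -> 0 <= c ->
  draw (on F b) b (fun=> c) G = w (F b) * c.
Proof.
move=> mF c0; rewrite -(expect_indic m (mF b)) mulrC -expectZ; last exact: bm_on.
by apply: expect_eq => x; rewrite mulrC.
Qed.

Lemma level_on_cst F c G : meas F -> 0 <= c ->
  level (on F) (fun=> c) G = mass F * c.
Proof. by move=> mF c0; rewrite levelE !draw_on// mulrDl. Qed.

Lemma on_gt0 F b x : 0 < on F b x -> F b x.
Proof.
by rewrite /on indicE; case: (boolP (x \in F b)) => [/set_mem//|_]; rewrite ltxx.
Qed.

Lemma level_on_ub F Phi c G : meas F -> smooth Phi -> 0 <= c ->
  (forall b x, F b x -> Phi (sieve G b x) <= c) -> level (on F) Phi G <= mass F * c.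
Proof.
move=> mF sP c0 h; rewrite -(level_on_cst G)//; apply: level_le => //.
- exact: bm_on.
- exact: smooth_cst.
- by move=> b x /on_gt0; exact: h.
Qed.

Lemma level_on_lb F Phi c G : meas F -> smooth Phi ->
  (forall b x, F b x -> c <= Phi (sieve G b x)) -> mass F * c <= level (on F) Phi G.
Proof.
move=> mF sP h; have [c0|c0] := leP 0 c; last first.
  apply: (@le_trans _ _ 0); first by rewrite mulr_ge0_le0 ?mass_ge0// ltW.
  by rewrite (smooth_ge0 _ (smooth_level (bm_on mF) sP)).
rewrite -(level_on_cst G)//; apply: level_le => //.
- exact: bm_on.
- exact: smooth_cst.
- by move=> b x /on_gt0; exact: h.
Qed.

(** The factor [has_member G] records that an empty family leaves no pattern; submultiplicativity
    relies on it at [n = 0]. *)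
Lemma patterns_ub F n G : meas F -> patterns F n G <= mass F ^+ n * has_member G.
Proof.
move=> mF; elim: n G => [|n IH] G; first by rewrite mul1r.
have ne0 : 0 <= has_member G by rewrite (smooth_ge0 _ smooth_has_member).
rewrite patternsS exprS -mulrA; apply: level_on_ub => //.
- exact: smooth_patterns.
- by rewrite mulr_ge0// exprn_ge0// mass_ge0.
- move=> b x _; rewrite (le_trans (IH _))// ler_wpM2l ?exprn_ge0 ?mass_ge0//.
  by apply: (smooth_le smooth_has_member); exact: sieve_sub.
Qed.

Lemma patterns_ub1 F n G : meas F -> patterns F n G <= mass F ^+ n.
Proof.
move=> mF; rewrite (le_trans (patterns_ub _ _ mF))// ler_piMr ?has_member_le1//.
by rewrite exprn_ge0// mass_ge0.
Qed.

(** A pattern on [n + k] points is one on the first [n] followed by one left by a subfamily on the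
    last [k]; monotonicity enlarges that subfamily to [G]. *)
Lemma patternsD_le F n k G : meas F ->
  patterns F (n + k) G <= patterns F n G * patterns F k G.
Proof.
move=> mF; elim: n G => [|n IH] G.
  rewrite add0n; have -> : patterns F 0 G = has_member G by [].
  have [nG|nG] := pselect (G !=set0); first by rewrite has_member1// mul1r.
  by rewrite has_member0// mul0r (le_trans (patterns_ub _ _ mF))// has_member0// mulr0.
rewrite addSn !patternsS mulrC -levelZ//; last 2 first.
- exact: bm_on.
- exact: smooth_patterns.
apply: level_le => //; first exact: bm_on.
- exact: smooth_patterns.
- by apply: smoothZ; [exact: patterns_ge0|exact: smooth_patterns].
move=> b x _; rewrite (le_trans (IH _))// mulrC ler_wpM2r//.
  exact: patterns_ge0.
by apply: patterns_le => //; exact: sieve_sub.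
Qed.

Lemma level_onD F T' H Phi G : meas T' -> meas H -> smooth Phi ->
  (forall b, F b = T' b `|` H b) -> (forall b, T' b `&` H b = set0) ->
  level (on F) Phi G = level (on T') Phi G + level (on H) Phi G.
Proof.
move=> mT mH sP FE dTH.
have split b : draw (on F b) b Phi G = draw (on T' b) b Phi G + draw (on H b) b Phi G.
  rewrite !drawE -expectD; try by apply: draw_integrand => //; exact: bm_on.
  apply: expect_eq => x; rewrite -mulrDl /on !indicE FE in_setU; congr (_ * _).
  case: (boolP (x \in T' b)) => xT; case: (boolP (x \in H b)) => xH /=;
    rewrite ?addr0 ?add0r//.
  have : (T' b `&` H b) x by split; exact: set_mem.
  by rewrite dTH.
by rewrite !levelE !split addrACA.
Qed.

Lemma iter_levelD al n Phi Psi c : (forall b, bm (al b)) -> smooth Phi ->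
  smooth Psi -> 0 <= c ->
  iter n (level al) (fun G => Phi G + c * Psi G) =
  (fun G => iter n (level al) Phi G + c * iter n (level al) Psi G).
Proof.
move=> bal sP sQ c0; elim: n => [//|n IH].
apply/funext => G; rewrite !iterS IH levelD// ?levelZ//; try exact: smooth_iter_level.
by apply: smoothZ => //; exact: smooth_iter_level.
Qed.

(* Splitting a sample at its first point in [H]: after that point only
   geometrically few patterns remain, so the growth comes from [T']. *)
Fixpoint first_hit (c : R) T' n : functional :=
  if n is n'.+1 then
    fun G => level (on T') (first_hit c T' n') G + c ^+ n * has_member G
  else has_member.

Lemma smooth_first_hit c T' n : 0 <= c -> meas T' -> smooth (first_hit c T' n).
Proof.
move=> c0 mT; elim: n => [|n IH] /=; first exact: smooth_has_member.
apply: smoothD; first by apply: smooth_level => //; exact: bm_on.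
by apply: smoothZ; [exact: exprn_ge0|exact: smooth_has_member].
Qed.

(** After a first point in [H], at most [B * c ^+ n] patterns remain on the [n] further points, and
    [mass H] is at most 2. [first_hit] charges [c ^+ n.+1] for this, whence the division by [c]; the
    summand 1 serves the empty sample. *)
Lemma patterns_first_hit F T' H c B n G : meas F -> meas T' -> meas H ->
  (forall b, F b = T' b `|` H b) -> (forall b, T' b `&` H b = set0) ->
  0 < c -> 0 <= B ->
  (forall b x k, H b x -> patterns F k (sieve G b x) <= B * c ^+ k) ->
  patterns F n G <= (1 + 2 * B / c) * first_hit c T' n G.
Proof.
move=> mF mT mH FE dTH c0 B0; have cge0 := ltW c0.
have Bc0 : 0 <= 2 * B / c by apply: divr_ge0 => //; exact: mulr_ge0.
elim: n G => [|n IH] G hH.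
  apply: ler_peMl; last by rewrite lerDl.
  exact: (smooth_ge0 G smooth_has_member).
have sF := smooth_patterns n mF.
rewrite patternsS (level_onD _ mT mH)//= mulrDr lerD//.
  rewrite -levelZ//; last 2 first.
  - exact: bm_on.
  - exact: smooth_first_hit.
  apply: level_le => //; first exact: bm_on.
    by apply: smoothZ; [exact: addr_ge0|exact: smooth_first_hit].
  move=> b x _; apply: IH => b' y k Hy; rewrite (le_trans _ (hH b' y k Hy))//.
  by apply: patterns_le => //; apply: sieveS; exact: sieve_sub.
have [[a Ga]|nG] := pselect (G !=set0); last first.
  apply: (@le_trans _ _ (mass H * 0)); last first.
    rewrite mulr0; apply: mulr_ge0; first exact: addr_ge0.
    apply: mulr_ge0; first exact: exprn_ge0.
    exact: (smooth_ge0 _ smooth_has_member).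
  apply: level_on_ub => // b x _; rewrite (le_trans (patterns_ub _ _ mF))//.
  rewrite has_member0 ?mulr0// => -[a [Ga _]].
  by apply: nG; exists a.
apply: (@le_trans _ _ (mass H * (B * c ^+ n))).
  by apply: level_on_ub => //; [rewrite mulr_ge0// exprn_ge0|move=> b x /hH].
apply: (@le_trans _ _ (2 * (B * c ^+ n))).
  by rewrite ler_wpM2r ?mass_le2// mulr_ge0// exprn_ge0.
rewrite has_member1; last by exists a.
rewrite mulr1 exprS.
have -> : (1 + 2 * B / c) * (c * c ^+ n) = c * c ^+ n + 2 * (B * c ^+ n).
  by field; rewrite gt_eqF.
rewrite lerDr.
by rewrite mulr_ge0// exprn_ge0.
Qed.

(** [i] counts the steps in [T'] already unfolded. Each of the [n.+1] terms, one per position of the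
    first hit and one for no hit, is at most [B * c ^+ (n + i)]. *)
Lemma first_hit_bound T' c B n i G : meas T' -> 0 < c ->
  (forall k, patterns T' k G <= B * c ^+ k) ->
  iter i (level (on T')) (first_hit c T' n) G <= n.+1%:R * B * c ^+ (n + i).
Proof.
move=> mT c0 hB; have cge0 := ltW c0; elim: n i => [|n IH] i.
  by rewrite mul1r; exact: hB.
rewrite [first_hit c T' n.+1]/= iter_levelD; last 4 first.
- exact: bm_on.
- by apply: smooth_level => //; [exact: bm_on|exact: smooth_first_hit].
- exact: smooth_has_member.
- exact: exprn_ge0.
rewrite -iterSr -[n.+2%:R]natr1 mulrDl mul1r mulrDl lerD//.
  by rewrite (le_trans (IH i.+1))// addnS.
by rewrite exprD mulrCA ler_wpM2l ?exprn_ge0//; exact: hB.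
Qed.

Definition rich (t : R) G F := forall n, t ^+ n <= patterns F n G.

Lemma rich_sub t G G' F : meas F -> G `<=` G' -> rich t G F -> rich t G' F.
Proof. by move=> mF GG' h n; rewrite (le_trans (h n))// patterns_le. Qed.

Lemma rich_mass t G F : meas F -> rich t G F -> t <= mass F.
Proof. by move=> mF /(_ 1%N); rewrite expr1 => /le_trans; apply; exact: patterns_ub1. Qed.

Lemma not_rich t G F : meas F -> 0 < t -> ~ rich t G F ->
  exists k, (0 < k)%N /\ patterns F k G < t ^+ k.
Proof.
move=> mF t0 /existsNP[k /negP]; rewrite -ltNge => kt.
case: k kt => [|k] kt; last by exists k.+1.
exists 1%N; split => //; rewrite expr1 (le_lt_trans _ t0)//.
rewrite (le_trans (patterns_ub _ _ mF))//.
have [nG|nG] := pselect (G !=set0); last by rewrite has_member0// mulr0.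
by move: kt; rewrite /patterns /= expr0 has_member1// ltxx.
Qed.

(** If the rest of the box grew more slowly than [t], splitting at the first point in [H] would
    bound the patterns of [F] by a constant times [n.+1%:R * d ^+ n] with [d < t], against richness
    by [geometric_gap]. *)
Lemma rich_remove t G F H c B : meas F -> meas H -> 0 < t -> 0 < c -> c < t ->
  0 <= B -> (forall b, H b `<=` F b) ->
  (forall b x k, H b x -> patterns F k (sieve G b x) <= B * c ^+ k) ->
  rich t G F -> rich t G (fun b => F b `\` H b).
Proof.
move=> mF mH t0 c0 ct B0 HF hB rF; apply: contrapT.
have mT : meas (fun b => F b `\` H b) by move=> b; exact: measurableD.
move=> /(not_rich mT t0)[k [k0 kt]].
have [c' [c'0 c't kc']] := root_below t0 (patterns_ge0 _ _ mT) k0 kt.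
have := submultiplicative_bound (fun n => patterns_ge0 n G mT)
  (fun n j => patternsD_le n j G mT) (fun n => patterns_ub1 n G mT)
  c'0 (mass_ge0 _) k0 kc'.
set B' := (1 + _) ^+ k => hB'.
have B'0 : 0 <= B'.
  apply: exprn_ge0; apply: addr_ge0 => //.
  by apply: divr_ge0; [exact: mass_ge0|exact: ltW].
pose d := Num.max c c'; have d0 : 0 < d by rewrite lt_max c0.
have dt : d < t by rewrite gt_max ct c't.
have up x (xs : 0 < x) : x <= d -> forall n, x ^+ n <= d ^+ n.
  by move=> xd n; rewrite lerXn2r ?nnegrE// ltW.
have FE b : F b = (F b `\` H b) `|` H b by rewrite setUC setDUK.
have dis b : (F b `\` H b) `&` H b = set0 by rewrite setDKI.
have hit n : patterns F n G <=
    (1 + 2 * B / d) * first_hit d (fun b => F b `\` H b) n G.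
  apply: (patterns_first_hit _ mF mT mH FE dis d0 B0) => b x j Hx.
  rewrite (le_trans (hB b x j Hx))// ler_wpM2l// up//.
  by rewrite le_max lexx.
have bnd n := @first_hit_bound _ d B' n 0 G mT d0.
have [n] := geometric_gap ((1 + 2 * B / d) * B') d0 dt.
apply/negP; rewrite -leNgt (le_trans (rF n))// (le_trans (hit n))//.
rewrite -[leRHS]mulrA -[leRHS]mulrA ler_wpM2l//.
  by apply: addr_ge0 => //; apply: divr_ge0; [exact: mulr_ge0|exact: ltW].
rewrite mulrA [B' * _]mulrC -[n in d ^+ n]addn0; apply: bnd => j.
rewrite (le_trans (hB' j))// ler_wpM2l// up//.
by rewrite le_max lexx orbT.
Qed.

Notation full G F := (forall k, mass F ^+ k <= patterns F k G).

(** The bound is uniform in the family, so richness passes to decreasing intersections of boxes with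
    [G] held fixed. *)
Lemma patterns_lipschitz n : exists kappa : R, 0 <= kappa /\
  forall F F' G, meas F -> meas F' -> (forall b, F b `<=` F' b) ->
    patterns F' n G <= patterns F n G + kappa * (mass F' - mass F).
Proof.
elim: n => [|n [kappa [k0 IH]]].
  by exists 0; split => // F F' G _ _ _; rewrite mul0r addr0.
(* [2 ^+ n] accounts for a first point in the difference of the boxes; the error of the later steps
   is multiplied by a mass of at most 2. *)
exists (2 ^+ n + 2 * kappa); split; first by rewrite addr_ge0 ?mulr_ge0 ?exprn_ge0.
move=> F F' G mF mF' FF'; have D0 : 0 <= mass F' - mass F by rewrite subr_ge0 mass_le.
have {}IH H := IH F F' H mF mF' FF'; set D := mass F' - mass F in D0 IH *.
have mD : meas (fun b => F' b `\` F b) by move=> b; exact: measurableD.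
have kD0 : 0 <= kappa * D by rewrite mulr_ge0.
have sF := smooth_patterns n mF.
have sc : smooth (fun _ : set I => kappa * D) by exact: smooth_cst.
apply: (@le_trans _ _ (level (on F') (fun G => patterns F n G + kappa * D) G)).
  apply: level_le => //; first exact: bm_on.
  - exact: smooth_patterns.
  - exact: smoothD.
rewrite levelD//; last exact: bm_on.
rewrite (level_onD G mF mD)//; last 2 first.
- by move=> b; rewrite setDUK.
- by move=> b; rewrite setDE setICA setICr setI0.
rewrite -patternsS -addrA lerD2l mulrDl lerD//.
  apply: (@le_trans _ _ (mass (fun b => F' b `\` F b) * 2 ^+ n)).
    apply: level_on_ub => //.
    move=> b x _; rewrite (le_trans (patterns_ub1 _ _ mF))//.
    by rewrite lerXn2r ?nnegrE ?mass_ge0 ?mass_le2.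
  by rewrite mulrC ler_wpM2l ?exprn_ge0// /mass !weightD// /D /mass; lra.
by rewrite level_on_cst// -mulrA ler_wpM2r ?mass_le2.
Qed.

Lemma weight_bigcap (A : nat -> set (borel T)) e : (forall i, measurable (A i)) ->
  (forall i j, (i <= j)%N -> A j `<=` A i) -> 0 < e ->
  exists i, w (A i) <= w (\bigcap_n A n) + e.
Proof.
move=> mA dA e0; have mI : measurable (\bigcap_n A n) by exact: bigcapT_measurable.
have A0 : (m (A 0%N) < +oo)%E by rewrite -weightE ?ltry.
have cv : (m \o A) x @[x --> \oo] --> m (\bigcap_n A n).
  apply: nonincreasing_cvg_mu => // i j ij.
  by apply/subsetPset; exact: dA.
rewrite -weightE// in cv.
have /fine_cvgP[_] := cv.
move/cvgrPdist_le => /(_ e e0)[N _ /(_ N (leqnn N))] /= h.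
exists N; move: h; rewrite /weight ler_norml => /andP[h _].
by rewrite /weight; lra.
Qed.

Lemma mass_bigcap (F : nat -> bool -> set (borel T)) e : (forall i, meas (F i)) ->
  (forall i j b, (i <= j)%N -> F j b `<=` F i b) -> 0 < e ->
  exists i, mass (F i) <= mass (fun b => \bigcap_n F n b) + e.
Proof.
move=> mF dF e0; have e20 : 0 < e / 2 by lra.
have [i hi] := weight_bigcap (fun n => mF n true) (fun i j => dF i j true) e20.
have [j hj] := weight_bigcap (fun n => mF n false) (fun i j => dF i j false) e20.
exists (maxn i j); rewrite /mass.
have := weight_le m (mF (maxn i j) true) (mF i true) (dF _ _ _ (leq_maxl i j)).
have := weight_le m (mF (maxn i j) false) (mF j false) (dF _ _ _ (leq_maxr i j)).
by lra.
Qed.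

Lemma meas_bigcap (F : nat -> bool -> set (borel T)) : (forall i, meas (F i)) ->
  meas (fun b => \bigcap_n F n b).
Proof. by move=> mF b; apply: bigcapT_measurable => n; exact: mF. Qed.

Lemma rich_bigcap t G (F : nat -> bool -> set (borel T)) : (forall i, meas (F i)) ->
  (forall i j b, (i <= j)%N -> F j b `<=` F i b) -> (forall i, rich t G (F i)) ->
  rich t G (fun b => \bigcap_n F n b).
Proof.
move=> mF dF rF n; apply/ler_addgt0Pr => e e0; have mI := meas_bigcap mF.
have [kappa [kappa0 h]] := patterns_lipschitz n.
have k10 : 0 < kappa + 1 by lra.
have [i hi] := mass_bigcap mF dF (divr_gt0 e0 k10).
rewrite (le_trans (rF i n))// (le_trans (h _ _ G mI (mF i) _))//.
  by move=> b; apply: bigcap_inf.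
rewrite lerD2l; set M := mass (F i) - _.
apply: (@le_trans _ _ (kappa * (e / (kappa + 1)))).
  by rewrite ler_wpM2l// /M lerBlDl.
by rewrite mulrA ler_pdivrMr// mulrC ler_pM2l//; lra.
Qed.

Lemma patterns_ub2 F n G : meas F -> patterns F n G <= 2 ^+ n.
Proof.
move=> mF; rewrite (le_trans (patterns_ub1 _ _ mF))//.
by rewrite lerXn2r ?nnegrE ?mass_ge0 ?mass_le2.
Qed.

(** Points whose sieve grows more slowly than [t] may be discarded. They are exhausted by the sets
    [H i], where the rate is at most [c i] and [c i] increases to [t]; each removal is made from [F]
    itself, and the limit is taken at the end. *)
Lemma rich_step t G F : meas F -> 0 < t -> rich t G F -> exists F',
  [/\ meas F', forall b, F' b `<=` F b, rich t G F' &
      forall b x, F' b x -> rich t (sieve G b x) F].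
Proof.
move=> mF t0 rF; pose c (i : nat) : R := t * (1 - i.+2%:R^-1).
have iv (i : nat) : i.+2%:R^-1 < 1 :> R by rewrite invf_lt1// ltr1n.
have iv0 (i : nat) : 0 < i.+2%:R^-1 :> R by rewrite invr_gt0.
have c0 i : 0 < c i by rewrite mulr_gt0// subr_gt0.
have ct i : c i < t by rewrite /c gtr_pMr// gtrDl oppr_lt0.
have cc i j : (i <= j)%N -> c i <= c j.
  move=> ij; rewrite ler_pM2l// lerD2l lerN2 lef_pV2 ?posrE// ler_nat.
  by rewrite !ltnS.
pose H i b := F b `&` [set x | exists2 k, (k < i)%N &
  patterns F k.+1 (sieve G b x) <= c i ^+ k.+1].
have mH i : meas (H i).
  move=> b; apply: measurableI => //.
  rewrite (_ : [set x | _] = \bigcup_(k in [set k | (k < i)%N])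
      [set x | patterns F k.+1 (sieve G b x) <= c i ^+ k.+1]); last first.
    by apply/seteqP; split => x /= [k]; exists k.
  apply: bigcup_measurable => k _.
  have := @smooth_measurable (patterns F k.+1) G b (smooth_patterns _ mF).
  move=> /(_ measurableT `]-oo, (c i ^+ k.+1)]%classic (measurable_itv _)).
  rewrite setTI (_ : _ @^-1` _ =
    [set x | patterns F k.+1 (sieve G b x) <= c i ^+ k.+1]); last first.
    by apply/seteqP; split => x /=; rewrite in_itv.
  exact.
have HH i j b : (i <= j)%N -> H i b `<=` H j b.
  move=> ij x [Fx [k ki h]]; split => //; exists k; first exact: leq_trans ki ij.
  by rewrite (le_trans h)// lerXn2r ?nnegrE ?(ltW (c0 _))//; exact: cc.
have mD i : meas (fun b => F b `\` H i b).
  by move=> b; apply: measurableD; [exact: mF|exact: mH].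
have rD i : rich t G (fun b => F b `\` H i b).
  have c2 : 0 <= 2 / c i by rewrite divr_ge0// ltW.
  apply: (@rich_remove t G F (H i) (c i) ((1 + 2 / c i) ^+ i)) => //.
  - by apply: exprn_ge0; exact: addr_ge0.
  - by move=> b x [].
  move=> b x n [_ [k ki h]].
  (* As [k.+1 <= i], the constant obtained here is uniform over [H i]. *)
  have := submultiplicative_bound
    (fun n => patterns_ge0 n (sieve G b x) mF)
    (fun n j => patternsD_le n j (sieve G b x) mF)
    (fun n => patterns_ub2 n (sieve G b x) mF) (c0 i) (ler0n _ 2) (ltn0Sn k) h n.
  move=> /le_trans; apply; rewrite ler_wpM2r ?exprn_ge0 ?(ltW (c0 _))//.
  by rewrite ler_weXn2l// lerDl.
exists (fun b => \bigcap_i (F b `\` H i b)); split.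
- exact: meas_bigcap.
- by move=> b x /(_ 0%N Logic.I)[].
- apply: rich_bigcap => // i j b ij x [Fx Hx]; split => // /(HH _ _ _ ij).
  exact: Hx.
- move=> b x Tx; apply: contrapT => /(not_rich mF t0)[k [k0 kt]].
  have [c' [c'0 c't kc']] := root_below t0 (patterns_ge0 _ _ mF) k0 kt.
  have tc : 0 < t - c' by rewrite subr_gt0.
  (* Large enough for the sample size [k] to be tested in [H i] and for [c'] to lie below [c i]. *)
  pose i := maxn k (Num.bound (t / (t - c'))).
  have [Fx] := Tx i Logic.I; apply; split => //; exists k.-1.
    by rewrite prednK// leq_maxl.
  rewrite prednK// (le_trans kc')// lerXn2r ?nnegrE ?(ltW c'0) ?(ltW (c0 _))//.
  rewrite /c mulrBr mulr1 lerBrDr addrC -lerBrDr ler_pdivrMr//.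
  have : t / (t - c') <= i.+2%:R.
    rewrite ltW// (lt_le_trans (archi_boundP _))//.
      by rewrite divr_ge0// ltW.
    by rewrite ler_nat (leq_trans (leq_maxr k _))// -/i ltnW// ltnW.
  by rewrite ler_pdivrMr// mulrC.
Qed.

(* Passing to subfamilies of [G] is what allows conditioning on finitely many
   sample points; a box that cannot be shrunk by more than [d] while staying
   rich is then almost full. *)
Definition tight t d G F := forall G' F', G' `<=` G -> meas F' ->
  (forall b, F' b `<=` F b) -> rich t G' F' -> mass F <= mass F' + d.

(** By tightness, the points whose sieve is still rich fill the box up to mass [d], and there the
    induction applies, since sieving preserves tightness. A step at most doubles the error and adds
    [2 ^+ k * d]. *)
Lemma tight_full t d G F k : meas F -> 0 < t -> 0 <= d -> rich t G F ->
  tight t d G F -> mass F ^+ k <= patterns F k G + k%:R * 2 ^+ k * d.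
Proof.
move=> mF t0 d0; elim: k G => [|k IH] G rG tG.
  by rewrite !mul0r addr0; have := rG 0%N.
have [F' [mF' F'F rF' hF']] := rich_step mF t0 rG.
have M2 : mass F <= 2 by exact: mass_le2.
have M0 : 0 <= mass F := mass_ge0 F.
set A := mass F ^+ k - k%:R * 2 ^+ k * d.
have lo : mass F' * A <= patterns F k.+1 G.
  apply: (@le_trans _ _ (level (on F') (patterns F k) G)).
    apply: level_on_lb => //; first exact: smooth_patterns.
    move=> b x F'x; rewrite /A lerBlDr; apply: IH; first exact: hF'.
    move=> G' F'' G'G; apply: tG; apply: subset_trans G'G _.
    exact: sieve_sub.
  rewrite patternsS (@level_onD F F' (fun b => F b `\` F' b))//.
  - rewrite lerDl; apply: smooth_ge0; apply: smooth_level; last exact: smooth_patterns.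
    by move=> b; apply: bounded_measurable_indic; exact: measurableD.
  - by move=> b; exact: measurableD.
  - exact: smooth_patterns.
  - by move=> b; rewrite setDUK.
  - by move=> b; rewrite setDE setICA setICr setI0.
have P0 := patterns_ge0 k.+1 G mF.
set E := k%:R * 2 ^+ k * d in A lo *.
have E0 : 0 <= E by rewrite !mulr_ge0 ?exprn_ge0.
have Ek : k.+1%:R * 2 ^+ k.+1 * d = 2 * E + 2 * (2 ^+ k * d).
  by rewrite /E exprS -natr1; ring.
have dk0 : 0 <= 2 ^+ k * d by rewrite mulr_ge0 ?exprn_ge0.
have ME : mass F * E <= 2 * E by rewrite ler_wpM2r.
rewrite Ek exprS; have [A0|A0] := leP 0 A.
  have h1 : mass F * A <= (mass F' + d) * A by rewrite ler_wpM2r//; exact: tG rF'.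
  have h2 : A <= 2 ^+ k.
    rewrite /A (@le_trans _ _ (mass F ^+ k))//; first by rewrite gerBl.
    by rewrite lerXn2r ?nnegrE.
  have h3 : d * A <= 2 ^+ k * d by rewrite mulrC ler_wpM2r.
  have -> : mass F * mass F ^+ k = mass F * A + mass F * E by rewrite /A; ring.
  by rewrite [leRHS]mulrDl in h1; lra.
have : mass F * mass F ^+ k <= mass F * E.
  by rewrite ler_wpM2l//; move: A0; rewrite /A subr_lt0 => /ltW.
by lra.
Qed.

Definition rich_state t (s : set I * (bool -> set (borel T))) :=
  meas s.2 /\ rich t s.1 s.2.

Definition refines t (s' s : set I * (bool -> set (borel T))) :=
  [/\ s'.1 `<=` s.1, forall b, s'.2 b `<=` s.2 b & rich_state t s'].

Lemma refines_refl t s : rich_state t s -> refines t s s.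
Proof. by move=> rs; split => // b; exact: subset_refl. Qed.

Lemma refines_trans t s1 s2 s3 : refines t s1 s2 -> refines t s2 s3 -> refines t s1 s3.
Proof.
move=> [h1 h2 h3] [k1 k2 _]; split => //; first exact: subset_trans k1.
by move=> b; exact: subset_trans (k2 b).
Qed.

Lemma refines_minimal t s e : rich_state t s -> 0 < e -> exists s', refines t s' s /\
  forall s'', refines t s'' s' -> mass s'.2 <= mass s''.2 + e.
Proof.
move=> rs e0; pose E : set R := [set mass s'.2 | s' in [set s' | refines t s' s]].
have hE : has_inf E.
  split; first by exists (mass s.2); exists s => //; exact: refines_refl.
  by exists 0; apply/lbP => _ [s' _ <-]; exact: mass_ge0.
have [_ [s' ss' <-] ls'] := inf_adherent e0 hE.
exists s'; split => // s'' ss''; rewrite (le_trans (ltW ls'))// lerD2r.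
apply: ge_inf; first by case: hE.
by exists s'' => //; exact: refines_trans ss'' ss'.
Qed.

(** Nearly minimal refinements are iterated with slack tending to 0. Only the boxes are intersected;
    no limit of the families is formed, since approximate fullness for each smaller family passes up
    to [G] by monotonicity. *)
Lemma exists_full_box t G F0 : meas F0 -> 0 < t -> rich t G F0 ->
  exists F, [/\ meas F, t <= mass F & forall k, mass F ^+ k <= patterns F k G].
Proof.
move=> mF0 t0 rF0.
(* For [choice] the step has to be total: a state that is not rich stays as it is. *)
have step (p : nat * (set I * (bool -> set (borel T)))) : exists s',
    rich_state t p.2 -> refines t s' p.2 /\
    forall s'', refines t s'' s' -> mass s'.2 <= mass s''.2 + p.1.+1%:R^-1.
  case: p => n s; have [rs|nrs] := pselect (rich_state t s); last first.
    by exists s => rs; case: (nrs rs).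
  have e0 : 0 < n.+1%:R^-1 :> R by rewrite invr_gt0.
  by have [s' hs'] := refines_minimal rs e0; exists s'.
have [f hf] := choice step.
pose u := fix u n := if n is n'.+1 then f (n', u n') else (G, F0).
have ru n : rich_state t (u n).
  elim: n => [//|n IH] /=.
  by have [[]] := hf (n, u n) IH.
have uS n := hf (n, u n) (ru n).
have un i j : (i <= j)%N -> refines t (u j) (u i).
  move=> /subnK <-; elim: (j - i)%N => [|k IH]; first exact: refines_refl.
  by have [h _] := uS (k + i)%N; exact: refines_trans h IH.
pose F b := \bigcap_n (u n).2 b.
have mu n : meas (u n).2 by case: (ru n).
have mF : meas F by apply: meas_bigcap.
have Fu n b : F b `<=` (u n).2 b by apply: bigcap_inf.
have rF i : rich t (u i).1 F.
  (* Dropping an initial segment does not change the intersection, and from [i] on all boxes are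
     rich for families inside [(u i).1]. *)
  have -> : F = fun b => \bigcap_j (u (maxn i j)).2 b.
    apply/funext => b; apply/seteqP; split => x Fx j _; first exact: Fx.
    by have [_ + _] := un j (maxn i j) (leq_maxr i j); apply; exact: Fx.
  apply: rich_bigcap => // [j k b jk|j].
    have : (maxn i j <= maxn i k)%N by rewrite geq_max leq_maxl (leq_trans jk)// leq_maxr.
    by move=> /un[].
  have [h1 _ [h2 h3]] := un i (maxn i j) (leq_maxl i j).
  exact: (rich_sub h2 h1 h3).
exists F; split => //; first exact: rich_mass (rF 0%N).
move=> k; apply/ler_addgt0Pr => e e0.
have [n ne] : exists n : nat, k%:R * 2 ^+ k / n.+1%:R <= e.
  have x0 : 0 <= k%:R * 2 ^+ k / e.
    by apply: divr_ge0; [apply: mulr_ge0 => //; exact: exprn_ge0|exact: ltW].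
  exists (Num.bound (k%:R * 2 ^+ k / e)).
  rewrite ler_pdivrMr// [e * _]mulrC -ler_pdivrMr//.
  by rewrite (le_trans (ltW (archi_boundP x0)))// ler_nat.
have tn : tight t n.+1%:R^-1 (u n.+1).1 F.
  move=> G' F' G'u mF' F'F rF'; have [_ h] := uS n.
  apply: (@le_trans _ _ (mass (u n.+1).2)); first exact: mass_le.
  apply: (h (G', F')); split => //= b; exact: subset_trans (F'F b) (Fu n.+1 b).
have := tight_full k mF t0 _ (rF n.+1) tn.
move=> /(_ ltac:(by rewrite invr_ge0)) /le_trans; apply.
by apply: lerD => //; apply: patterns_le => //; case: (un 0%N n.+1 (leq0n _)).
Qed.

(** * From full boxes to shattered sets *)

Lemma weightI_ge (A B : set (borel T)) : measurable A -> measurable B ->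
  w A + w B - 1 <= w (A `&` B).
Proof.
move=> mA mB; have mAB : measurable (A `&` B) by exact: measurableI.
have AI : A `&` B `<=` A by move=> x [].
have mD : measurable (A `\` (A `&` B)) by exact: measurableD.
have mC : measurable (setT `\` B) by exact: measurableD.
have := weight_le m mD mC.
rewrite weightD// weightD// weightT => h.
have /h : A `\` (A `&` B) `<=` setT `\` B by move=> x [Ax nB]; split => // Bx; exact: nB.
lra.
Qed.

(** The probability that independent points all fall into [E] and some member of the family contains
    exactly those prescribed by [bs], as an iterated expectation. *)
Definition pattern_prob (E : set (borel T)) (bs : seq bool) : functional :=
  foldr (fun b => draw (\1_E) b) has_member bs.

Lemma smooth_pattern_prob E bs : measurable E -> smooth (pattern_prob E bs).
Proof.
move=> mE; elim: bs => [|b bs IH] /=; first exact: smooth_has_member.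
by apply: smooth_draw => //; exact: bounded_measurable_indic.
Qed.

Lemma draw_indic_cst (A : set (borel T)) b c G : measurable A -> 
  draw (\1_A) b (fun=> c) G = w A * c.
Proof.
move=> mA; rewrite -(expect_indic m mA) mulrC -expectZ; last exact: bounded_measurable_indic.
by apply: expect_eq => x; rewrite mulrC.
Qed.

(* The deficit of a full box bounds the deficit of every pattern in its
   diagonal. *)
Lemma pattern_prob_deficit F E bs G : meas F -> measurable E ->
  (forall b, E `<=` F b) ->
  patterns F (size bs) G + w E ^+ size bs <=
  mass F ^+ size bs + pattern_prob E bs G.
Proof.
move=> mF mE EF; elim: bs G => [|b bs IH] G; first by rewrite addrC.
have -> : size (b :: bs) = (size bs).+1 by [].
have -> : pattern_prob E (b :: bs) G = draw (\1_E) b (pattern_prob E bs) G by [].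
set n := size bs in IH *.
have sP := smooth_patterns n mF; have sQ := smooth_pattern_prob bs mE.
have M0 : 0 <= mass F ^+ n by rewrite exprn_ge0 ?mass_ge0.
have wE0 : 0 <= w E ^+ n by rewrite exprn_ge0 ?weight_ge0.
have bE : bm (\1_E) by exact: bounded_measurable_indic.
have bF c : bm (\1_(F c)) by exact: bounded_measurable_indic.
have one c : draw (on F c) c (patterns F n) G <= w (F c) * mass F ^+ n.
  rewrite -(@draw_indic_cst (F c) c (mass F ^+ n) G)//.
  apply: draw_le; [exact: bF|exact: sP|exact: smooth_cst|].
  by move=> x _; exact: patterns_ub1.
have two : draw (on F b) b (patterns F n) G + w E ^+ n.+1 <=
    w (F b) * mass F ^+ n + draw (\1_E) b (pattern_prob E bs) G.
  rewrite exprS -(@draw_indic_cst E b (w E ^+ n) G)//.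
  rewrite -(@draw_indic_cst (F b) b (mass F ^+ n) G)//.
  have bc (A : set (borel T)) (c : R) : measurable A -> 0 <= c ->
      bm (fun x => \1_A x * c).
    move=> mA c0; apply: bounded_measurableM; first exact: bounded_measurable_indic.
    exact: bounded_measurable_cst.
  have bi (A : set (borel T)) Phi : measurable A -> smooth Phi ->
      bm (fun x => \1_A x * Phi (sieve G b x)).
    by move=> mA sPhi; apply: draw_integrand => //; exact: bounded_measurable_indic.
  rewrite !drawE -!expectD//; try by [exact: bc|exact: bi].
  apply: expect_le => [||x].
  - by apply: bounded_measurableD; [exact: bi|exact: bc].
  - by apply: bounded_measurableD; [exact: bc|exact: bi].
  rewrite [on F b x]indicE !indicE; have [xE|xE] := boolP (x \in E).
    have -> : x \in F b by rewrite inE; apply: EF; exact: set_mem.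
    by rewrite !mul1r; exact: IH.
  by rewrite !mul0r !addr0 ler_wpM2l// patterns_ub1.
have ME : mass F * mass F ^+ n = w (F true) * mass F ^+ n + w (F false) * mass F ^+ n.
  by rewrite -mulrDl.
have := one (~~ b); rewrite patternsS levelE [mass F ^+ n.+1]exprS ME.
by case: b two => two /= oneb; lra.
Qed.

Theorem exists_shattered t G : 1 < t -> rich t G (fun=> setT) ->
  exists E : set (borel T), [/\ measurable E, 0 < w E &
    forall bs, w E ^+ size bs <= pattern_prob E bs G].
Proof.
move=> t1 rG; have t0 : 0 < t by lra.
have [F [mF tF full]] := @exists_full_box t G (fun=> setT) (fun=> measurableT) t0 rG.
have mE : measurable (F true `&` F false) by exact: measurableI.
exists (F true `&` F false); split => //.
  have := weightI_ge (mF true) (mF false).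
  by move: tF; rewrite /mass; lra.
move=> bs; have h : forall b, F true `&` F false `<=` F b by move=> [] x [].
have := pattern_prob_deficit bs G mF mE h; have := full (size bs); lra.
Qed.

(** * Exponential moments *)

Lemma iter_level_comm al be n Phi : (forall b, bm (al b)) -> (forall b, bm (be b)) ->
  smooth Phi ->
  level al (iter n (level be) Phi) = iter n (level be) (level al Phi).
Proof.
move=> bal bbe sP; elim: n => [//|n IH]; rewrite !iterS -IH.
by apply/funext => G; rewrite level_comm//; exact: smooth_iter_level.
Qed.

Lemma iter_level_le al n Phi Psi G : (forall b, bm (al b)) -> smooth Phi ->
  smooth Psi -> (forall G, Phi G <= Psi G) ->
  iter n (level al) Phi G <= iter n (level al) Psi G.
Proof.
move=> bal sP sQ PQ; elim: n G => [//|n IH] G; rewrite !iterS.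
by apply: level_le => //; exact: smooth_iter_level.
Qed.

Lemma iter_levelZ al n Phi c : (forall b, bm (al b)) -> smooth Phi -> 0 <= c ->
  iter n (level al) (fun G => c * Phi G) = (fun G => c * iter n (level al) Phi G).
Proof.
move=> bal sP c0; elim: n => [//|n IH]; rewrite !iterS IH.
by apply/funext => G; rewrite levelZ//; exact: smooth_iter_level.
Qed.

Definition tilt (s : R) : bool -> T -> R := fun b _ => if b then expR s else 1.

Definition flat : bool -> T -> R := fun _ _ => 1.

Definition cosh (s : R) : R := (expR s + expR (- s)) / 2.

Lemma cosh_ge1 s : 1 <= cosh s.
Proof.
have := expR_ge1Dx s; have := expR_ge1Dx (- s).
by rewrite /cosh ler_pdivlMr//; lra.
Qed.

(** [expR x <= (1 - x)^-1] bounds [cosh s] by [(1 - s ^+ 2)^-1]. *)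
Lemma cosh_le s : `|s| <= 1 / 2 -> cosh s <= 1 + 2 * s ^+ 2.
Proof.
rewrite ler_norml => /andP[s1 s2].
have up x : x <= 1 / 2 -> expR x <= (1 - x)^-1.
  move=> x2; have x0 : 0 < 1 - x by lra.
  rewrite -[expR x]invrK lef_pV2 ?posrE ?invr_gt0 ?expR_gt0// -expRN.
  exact: expR_ge1Dx.
have h1 : expR s <= (1 - s)^-1 by apply: up; lra.
have h2 : expR (- s) <= (1 - - s)^-1 by apply: up; lra.
have p1 : 0 < 1 - s by lra.
have p2 : 0 < 1 + s by lra.
apply: (@le_trans _ _ (((1 - s)^-1 + (1 + s)^-1) / 2)).
  by rewrite opprK in h2; rewrite /cosh ler_pM2r ?invr_gt0//; lra.
have -> : ((1 - s)^-1 + (1 + s)^-1) / 2 = ((1 - s) * (1 + s))^-1.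
  by field; rewrite !gt_eqF.
have q0 : 0 < (1 - s) * (1 + s) by rewrite mulr_gt0.
rewrite -[leLHS]mul1r ler_pdivrMr//.
have s20 : 0 <= s ^+ 2 by exact: sqr_ge0.
have s24 : s ^+ 2 <= 1 / 4.
  have -> : (1 / 4 : R) = (1 / 2) ^+ 2 by field.
  by rewrite -[s ^+ 2]real_normK ?num_real// lerXn2r ?nnegrE// ler_norml; lra.
have : 0 <= s ^+ 2 * (1 / 4 - s ^+ 2) by rewrite mulr_ge0//; lra.
by rewrite (_ : (1 + _) * _ = 1 + s ^+ 2 - 2 * (s ^+ 2 * s ^+ 2)); [nra|ring].
Qed.

Lemma bm_tilt s b : bm (tilt s b).
Proof.
by case: b; apply: bounded_measurable_cst => //; exact/ltW/expR_gt0.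
Qed.

Lemma bm_flat b : bm (flat b).
Proof. exact: bounded_measurable_cst. Qed.

(* Exchanging the two points drawn by the tilted steps averages the weights
   [expR s] and [expR (- s)] of the mixed patterns. *)
Lemma level_tilt_pair s Phi G : smooth Phi ->
  level (tilt s) (level (tilt (- s)) Phi) G <= cosh s * level flat (level flat Phi) G.
Proof.
move=> sP; have b1 : bm (fun=> 1) by exact: bounded_measurable_cst.
have sD b : smooth (draw (fun=> 1) b Phi) by exact: smooth_draw.
have lE al (c0 c1 : R) Psi H : smooth Psi -> al true = (fun=> c1) -> al false = (fun=> c0) ->
    level al Psi H = c1 * draw (fun=> 1) true Psi H + c0 * draw (fun=> 1) false Psi H.
  move=> sQ h1 h0; rewrite levelE h1 h0.
  by rewrite (@draw_cst c1 true Psi H sQ) (@draw_cst c0 false Psi H sQ).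
have dlE al (c0 c1 : R) b H : 0 <= c0 -> 0 <= c1 ->
    al true = (fun=> c1) -> al false = (fun=> c0) ->
    draw (fun=> 1) b (level al Phi) H =
    c1 * draw (fun=> 1) b (draw (fun=> 1) true Phi) H +
    c0 * draw (fun=> 1) b (draw (fun=> 1) false Phi) H.
  move=> p0 p1 h1 h0.
  have -> : level al Phi = fun G => c1 * draw (fun=> 1) true Phi G +
      c0 * draw (fun=> 1) false Phi G.
    by apply/funext => H'; exact: lE.
  rewrite drawD//; try exact: smoothZ.
  rewrite !drawE -!expectZ//; try by apply: draw_integrand.
  by congr (_ + _); apply: expect_eq => x; rewrite !mul1r.
have e0 (x : R) : 0 <= expR x by exact/ltW/expR_gt0.
rewrite (@lE _ 1 (expR s))//; last by apply: smooth_level => //; exact: bm_tilt.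
rewrite (@lE _ 1 1 (level flat Phi))//; last by apply: smooth_level => //; exact: bm_flat.
rewrite !(@dlE (tilt (- s)) 1 (expR (- s)))// ?e0// !(@dlE flat 1 1)//.
rewrite (draw_comm false true b1 b1 sP G).
have P b b' : 0 <= draw (fun=> 1) b (draw (fun=> 1) b' Phi) G.
  by rewrite (smooth_ge0 _ (smooth_draw _ b1 (sD b'))).
move: (P true true) (P true false) (P false false).
move: (draw _ true (draw _ true _) G) (draw _ true (draw _ false _) G)
  (draw _ false (draw _ false _) G) => X Y Z X0 Y0 Z0.
have ee : expR s * expR (- s) = 1 by rewrite -expRD subrr expR0.
have c1 := cosh_ge1 s.
have -> : expR s * (expR (- s) * X + 1 * Y) + 1 * (expR (- s) * Y + 1 * Z) =
    X + 2 * cosh s * Y + Z.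
  by rewrite mulrDr mulrA ee /cosh; field.
have : 0 <= (cosh s - 1) * X by rewrite mulr_ge0//; lra.
have : 0 <= (cosh s - 1) * Z by rewrite mulr_ge0//; lra.
lra.
Qed.

(** Symmetrization of two samples of size [n]: commuting levels brings each step tilted by [s] next
    to one tilted by [- s]. *)
Lemma iter_tilt_le s n Phi G : smooth Phi ->
  iter n (level (tilt s)) (iter n (level (tilt (- s))) Phi) G <=
  cosh s ^+ n * iter (n + n) (level flat) Phi G.
Proof.
have c0 : 0 <= cosh s by rewrite (le_trans _ (cosh_ge1 s)).
elim: n Phi => [|n IH] Phi sP; first by rewrite mul1r.
have bs := @bm_tilt s; have bs' := @bm_tilt (- s); have bf := bm_flat.
have sL : smooth (level (tilt s) (level (tilt (- s)) Phi)) by do 2!apply: smooth_level => //.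
have sF : smooth (level flat (level flat Phi)) by do 2!apply: smooth_level => //.
rewrite iterSr [iter n.+1 (level (tilt (- s))) Phi]iterSr iter_level_comm//; last first.
  exact: smooth_level.
apply: (@le_trans _ _ (iter n (level (tilt s)) (iter n (level (tilt (- s)))
    (fun G => cosh s * level flat (level flat Phi) G)) G)).
  apply: iter_level_le; [exact: bs|exact: smooth_iter_level| |].
    by apply: smooth_iter_level; [exact: bs'|exact: smoothZ].
  move=> H; apply: iter_level_le; [exact: bs'|exact: sL|exact: smoothZ|].
  by move=> H'; exact: level_tilt_pair.
rewrite iter_levelZ// iter_levelZ//; last exact: smooth_iter_level.
rewrite exprS -mulrA ler_wpM2l// addSn addnS !iterSr; exact: IH.
Qed.

(** Jensen's inequality [expR (s * p) <= p * expR s + (1 - p)] for the probability [p] of the set of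
    one fixed member [a], obtained by averaging the tangent of the exponential at [s * p]. *)
Lemma level_tilt_lb s Phi G a k : smooth Phi -> 0 <= k ->
  (forall G', G' a -> k <= Phi G') -> G a ->
  k * expR (s * w (C a)) <= level (tilt s) Phi G.
Proof.
move=> sP k0 kP Ga; have b1 : bm (fun=> 1) by exact: bounded_measurable_cst.
have mC : measurable (C a : set (borel T)).
  by apply: sub_sigma_algebra; have [] := C_clopen a.
have D b (A : set (borel T)) : measurable A -> (forall x, A x -> `[< C a x >] = b) ->
    k * w A <= draw (fun=> 1) b Phi G.
  move=> mA hA; rewrite -(expect_indic m mA) -expectZ; last exact: bounded_measurable_indic.
  apply: expect_le; last first.
  - move=> x; rewrite indicE mul1r; have [/set_mem Ax|_] := boolP (x \in A).
      by rewrite mulr1; apply: kP; split => //; exact: hA.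
    by rewrite mulr0 (smooth_ge0 _ sP).
  - exact: draw_integrand.
  - by apply: bounded_measurableZ => //; exact: bounded_measurable_indic.
have h1 : k * w (C a) <= draw (fun=> 1) true Phi G by apply: (D true (C a)) => // x; exact: asboolT.
have h0 : k * (1 - w (C a)) <= draw (fun=> 1) false Phi G.
  have -> : 1 - w (C a) = w (~` C a) by rewrite -setTD weightD// weightT.
  apply: (D false (~` C a)); first exact: measurableC.
  by move=> x; exact: asboolF.
have lE : level (tilt s) Phi G =
    expR s * draw (fun=> 1) true Phi G + draw (fun=> 1) false Phi G.
  by rewrite levelE (@draw_cst (expR s) true Phi G sP).
have e0 : 0 < expR s by exact: expR_gt0.
apply: (@le_trans _ _ (expR s * (k * w (C a)) + k * (1 - w (C a)))); last first.
  by rewrite lE lerD// ler_pM2l.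
have -> : expR s * (k * w (C a)) + k * (1 - w (C a)) =
    k * (w (C a) * expR s + (1 - w (C a))) by ring.
rewrite ler_wpM2l//; set p := w (C a).
have p0 : 0 <= p := weight_ge0 m _; have p1 : p <= 1 := weight_le1 m mC.
set E := expR (s * p); have E0 : 0 < E by exact: expR_gt0.
have t1 : E * (1 + (s - s * p)) <= expR s.
  have -> : expR s = E * expR (s - s * p) by rewrite -expRD addrC subrK.
  by rewrite ler_pM2l// expR_ge1Dx.
have t0 : E * (1 + (0 - s * p)) <= 1.
  have {2}-> : 1 = E * expR (0 - s * p) by rewrite -expRD sub0r subrr expR0.
  by rewrite ler_pM2l// expR_ge1Dx.
have : p * (E * (1 + (s - s * p))) <= p * expR s by rewrite ler_wpM2l.
have : (1 - p) * (E * (1 + (0 - s * p))) <= (1 - p) * 1 by rewrite ler_wpM2l//; lra.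
nra.
Qed.

Lemma iter_tilt_lb s n G a : G a ->
  expR (s * (n%:R * w (C a))) <= iter n (level (tilt s)) has_member G.
Proof.
elim: n G => [|n IH] G Ga.
  by rewrite mul0r mulr0 expR0 /= has_member1//; exists a.
have -> : s * (n.+1%:R * w (C a)) = s * (n%:R * w (C a)) + s * w (C a).
  by rewrite -natr1; ring.
rewrite expRD iterS; apply: level_tilt_lb => //.
by apply: smooth_iter_level; [exact: bm_tilt|exact: smooth_has_member].
Qed.

(** * Tilted samples with frozen points *)

Definition at_point s (x : T) Phi : functional :=
  fun G => expR s * Phi (sieve G true x) + Phi (sieve G false x).

Definition at_points s (v : seq T) Phi : functional := foldr (at_point s) Phi v.

Lemma bm_at_points s v Phi G : smooth Phi ->
  bm (fun x => at_points s v (at_point s x Phi) G).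
Proof.
move=> sP; have e0 : 0 <= expR s by exact/ltW/expR_gt0.
elim: v G => [|y v IH] G /=; apply: bounded_measurableD;
  try (apply: bounded_measurableZ => //); try exact: smooth_bounded_measurable; exact: IH.
Qed.

Lemma at_points_level s v Phi G : smooth Phi ->
  at_points s v (level (tilt s) Phi) G =
  expect m (fun x => at_points s (rcons v x) Phi G).
Proof.
move=> sP; have e0 : 0 <= expR s by exact/ltW/expR_gt0.
have b1 : bm (fun=> 1) by exact: bounded_measurable_cst.
transitivity (expect m (fun x => at_points s v (at_point s x Phi) G)); last first.
  by apply: expect_eq => x; rewrite /at_points foldr_rcons.
elim: v G => [|y v IH] G /=.
  rewrite levelE !drawE -expectD; try exact: (draw_integrand _ _ (bm_tilt s _) sP).
  by apply: expect_eq => x; rewrite /tilt mul1r.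
rewrite {1}/at_point !IH -expectZ; last exact: bm_at_points.
rewrite -expectD; last exact: bm_at_points.
  by [].
by apply: bounded_measurableZ => //; exact: bm_at_points.
Qed.

Lemma at_points_lb s v Phi G a k : 0 <= k -> (forall G', G' a -> k <= Phi G') ->
  G a -> (forall G', 0 <= Phi G') ->
  k * expR (s * \sum_(x <- v) \1_(C a) x) <= at_points s v Phi G.
Proof.
move=> k0 kP Ga P0; have e0 : 0 <= expR s by exact/ltW/expR_gt0.
have A0 u H : 0 <= at_points s u Phi H.
  by elim: u H => [|x u IH] H //=; rewrite addr_ge0// mulr_ge0.
elim: v G Ga => [|x v IH] G Ga; first by rewrite big_nil mulr0 expR0 mulr1; exact: kP.
rewrite big_cons mulrDr expRD indicE /= /at_point.
have [/set_mem xa|/negP xa] := boolP (x \in C a).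
  rewrite mulr1 mulrCA; apply: (@le_trans _ _ (expR s * at_points s v Phi (sieve G true x))).
    by rewrite ler_wpM2l//; apply: IH; split => //; exact: asboolT.
  by rewrite lerDl; exact: A0.
rewrite mulr0 expR0 mul1r; apply: (@le_trans _ _ (at_points s v Phi (sieve G false x))).
  by apply: IH; split => //; apply: asboolF => h; apply: xa; rewrite inE.
by rewrite lerDr mulr_ge0//; exact: A0.
Qed.

(** [W] need not be measurable, so one variable is integrated at a time: with the earlier points
    frozen, the functional is a measurable majorant of a multiple of [W], and [theta] acts as the
    upper integral of [W]. *)
Lemma at_points_iter s (W : T -> R) theta j v Phi G kappa :
  smooth Phi -> 0 <= kappa -> (forall x, 0 <= W x) -> 0 <= theta ->
  (forall h c, bm h -> 0 <= c -> (forall x, c * W x <= h x) -> c * theta <= expect m h) ->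
  (forall u, size u = j -> kappa * \prod_(x <- v ++ u) W x <= at_points s (v ++ u) Phi G) ->
  kappa * (\prod_(x <- v) W x) * theta ^+ j <=
  at_points s v (iter j (level (tilt s)) Phi) G.
Proof.
move=> sP k0 W0 th0 hth; elim: j v => [|j IH] v hv.
  by rewrite mulr1; have := hv [::] erefl; rewrite cats0.
have sI : smooth (iter j (level (tilt s)) Phi).
  by apply: smooth_iter_level => //; exact: bm_tilt.
rewrite iterS at_points_level// exprSr mulrA; apply: hth.
- rewrite (_ : (fun x => _) = fun x =>
      at_points s v (at_point s x (iter j (level (tilt s)) Phi)) G).
    exact: bm_at_points.
  by apply/funext => x; rewrite /at_points foldr_rcons.
- apply: mulr_ge0; last exact: exprn_ge0.
  by apply: mulr_ge0 => //; apply: prodr_ge0.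
- move=> x; have := IH (rcons v x); rewrite -cats1 big_cat big_seq1 /=.
  rewrite -!mulrA [theta ^+ j * _]mulrC; apply => u uj.
  by rewrite -catA; apply: hv => /=; rewrite uj.
Qed.

Lemma level_flat : level (on (fun=> setT)) = level flat.
Proof.
by congr level; apply/funext => b; apply/funext => x; rewrite /on indicT.
Qed.

(** * Squeezing an unmeasured integrand *)

Variables (G : set I) (g : T -> R) (r : R).
Hypothesis unshattered : forall E : set (borel T), measurable E -> 0 < w E ->
  exists bs, pattern_prob E bs G < w E ^+ size bs.
Hypothesis approximable : forall (s : R) (v : seq T) (e : R), 0 < e ->
  exists a, G a /\ s * (\sum_(x <- v) g x - (size v)%:R * r) - e <=
    s * (\sum_(x <- v) \1_(C a) x - (size v)%:R * w (C a)).
Hypothesis g01 : forall x, 0 <= g x <= 1.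

Lemma subexponential d : 0 < d -> exists n, (0 < n)%N /\
  patterns (fun=> setT) n G <= (1 + d) ^+ n.
Proof.
move=> d0; apply: contrapT => nh.
have [||E [mE E0 hE]] := @exists_shattered (1 + d) G; first by lra.
(* At [n = 0] richness says that [G] is nonempty; the empty sample in [approximable] provides a
   member. *)
- move=> [|n].
    rewrite expr0; have [a [Ga _]] := approximable 0 [::] ltr01.
    by rewrite /patterns /= has_member1//; exists a.
  by rewrite leNgt; apply/negP => h; apply: nh; exists n.+1; split => //; exact: ltW.
- by have [bs] := unshattered mE E0; rewrite ltNge hE.
Qed.

Definition upper_exp (s : R) : R :=
  inf [set expect m h | h in [set h | bm h /\ forall x, expR (s * (g x - r)) <= h x]].

Lemma upper_exp_has_inf s :
  has_inf [set expect m h | h in [set h | bm h /\ forall x, expR (s * (g x - r)) <= h x]].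
Proof.
split; last first.
  by exists 0; apply/lbP => _ [h [bh _] <-]; apply: expect_ge0 => x; exact: bounded_measurable_ge0.
exists (expect m (fun=> expR (`|s| * (1 + `|r|)))), (fun=> expR (`|s| * (1 + `|r|))) => //.
split; first by apply: bounded_measurable_cst; exact/ltW/expR_gt0.
move=> x; rewrite ler_expR (le_trans (ler_norm _))// normrM ler_wpM2l//.
rewrite (le_trans (ler_normB _ _))// lerD2r.
by have /andP[g0 g1] := g01 x; rewrite ger0_norm.
Qed.

Lemma upper_exp_le s h c : bm h -> 0 <= c ->
  (forall x, c * expR (s * (g x - r)) <= h x) -> c * upper_exp s <= expect m h.
Proof.
move=> bh c0 hh; have [->|cn0] := eqVneq c 0.
  by rewrite mul0r; apply: expect_ge0 => x; exact: bounded_measurable_ge0.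
have cp : 0 < c by rewrite lt_neqAle eq_sym cn0.
rewrite mulrC -ler_pdivlMr// mulrC -expectZ//; apply: ge_inf.
  by case: (upper_exp_has_inf s).
exists (fun x => c^-1 * h x) => //; split.
  by apply: bounded_measurableZ => //; rewrite invr_ge0.
by move=> x; rewrite [c^-1 * _]mulrC ler_pdivlMr// [_ * c]mulrC.
Qed.

Lemma upper_exp_ge0 s : 0 <= upper_exp s.
Proof.
have [h0 _] := upper_exp_has_inf s; apply: lb_le_inf => //.
by move=> _ [h [bh _] <-]; apply: expect_ge0 => x; exact: bounded_measurable_ge0.
Qed.

(** For a first sample [u], take [a] from [approximable]. It contributes the exponential of [s]
    times its hits on [u] and, through [iter_tilt_lb] at [- s], a lower bound over the second
    sample; together these dominate the product of the [expR (s * (g x - r))] up to [expR (- e)].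
    The upper bound is [cosh s ^+ n] times the patterns on [n + n] points, at most
    [(1 + d) ^+ (2 * n)]. *)
Lemma upper_exp_cosh s : upper_exp s <= cosh s.
Proof.
set th := upper_exp s; have th0 : 0 <= th := upper_exp_ge0 s.
have c1 := cosh_ge1 s; have c0 : 0 < cosh s by lra.
suff step d : 0 < d -> d <= 1 -> th <= cosh s * (1 + 3 * d).
  (* Chosen so that [d <= 1] and [3 * cosh s * d <= e]; the 3 comes from
     [(1 + d) ^+ 2 <= 1 + 3 * d]. *)
  apply/ler_addgt0Pr => e e0; pose d := e / (3 * cosh s + e).
  have D0 : 0 < 3 * cosh s + e by lra.
  have d0 : 0 < d by rewrite divr_gt0.
  have dD : d * (3 * cosh s + e) = e by rewrite divfK// gt_eqF.
  have d1 : d <= 1 by rewrite ler_pdivrMr//; lra.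
  have := step d d0 d1; have : 0 < d * e by rewrite mulr_gt0.
  by lra.
move=> d0 d1; have [n [n0 hn]] := subexponential d0.
have P0 := patterns_ge0 n G (fun=> measurableT).
set N := n; have hN : th ^+ n <= (cosh s * (1 + d) ^+ 2) ^+ n.
  have X0 : 0 <= (cosh s * (1 + d) ^+ 2) ^+ n.
    by apply: exprn_ge0; apply: mulr_ge0; [exact: ltW|exact: sqr_ge0].
  have main e : 0 < e -> expR (- e) * th ^+ n <= (cosh s * (1 + d) ^+ 2) ^+ n.
    move=> e0; have sB : smooth (iter n (level (tilt (- s))) has_member).
      by apply: smooth_iter_level; [exact: bm_tilt|exact: smooth_has_member].
    have := @at_points_iter s (fun x => expR (s * (g x - r))) th n [::]
      (iter n (level (tilt (- s))) has_member) G (expR (- e)) sB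
      (ltW (expR_gt0 _)) (fun x => ltW (expR_gt0 _)) th0 (@upper_exp_le s).
    rewrite big_nil mulr1 => /(_ _)/le_trans; apply.
      move=> u un; rewrite cat0s; have [a [Ga ha]] := approximable s u e0.
      rewrite -expR_sum; apply: (@le_trans _ _
        (expR (- s * (n%:R * w (C a))) * expR (s * \sum_(x <- u) \1_(C a) x))).
        rewrite -!expRD ler_expR -mulr_sumr big_split /= sumrN big_const_seq.
        rewrite count_predT iter_addr_0 un -mulr_natl.
        by move: ha; rewrite un !mulrBr mulNr; lra.
      apply: at_points_lb => //.
      - by move=> G' G'a; exact: iter_tilt_lb.
      - by move=> G'; rewrite (smooth_ge0 _ sB).
    rewrite /at_points /= (le_trans (iter_tilt_le _ _ _ smooth_has_member))//.
    rewrite [leRHS]exprMn ler_wpM2l ?exprn_ge0 ?(ltW c0)// -level_flat.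
    rewrite (le_trans (patternsD_le n n G (fun=> measurableT)))//.
    by rewrite -exprM mulnC exprM expr2 ler_pM.
  apply/ler_addgt0Pr => e e0.
  have e'0 : 0 < e / (th ^+ n + 1) by rewrite divr_gt0// ltr_wpDl// exprn_ge0.
  have := main _ e'0; set t := th ^+ n in e'0 *.
  have t0 : 0 <= t by exact: exprn_ge0.
  have h1 : (1 - e / (t + 1)) * t <= expR (- (e / (t + 1))) * t.
    by rewrite ler_wpM2r// expR_ge1Dx.
  have h2 : e / (t + 1) * t <= e.
    by rewrite mulrAC ler_pdivrMr ?ler_pM2l//; lra.
  by rewrite mulrBl mul1r in h1; lra.
have {hN} : th <= cosh s * (1 + d) ^+ 2.
  rewrite -(ler_pXn2r n0)// nnegrE.
  by apply: mulr_ge0; [exact: ltW|exact: sqr_ge0].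
move=> /le_trans; apply; rewrite ler_pM2l//.
have : d * d <= d by rewrite ler_piMl// ltW.
by rewrite expr2; lra.
Qed.

Lemma exp_majorant s e : 0 < e -> exists h,
  [/\ bm h, forall x, 1 + s * (g x - r) <= h x & expect m h <= cosh s + e].
Proof.
move=> e0; have [_ [h [bh hh] <-] hle] := inf_adherent e0 (upper_exp_has_inf s).
exists h; split => //; first by move=> x; rewrite (le_trans _ (hh x))// expR_ge1Dx.
by rewrite (le_trans (ltW hle))// lerD2r; exact: upper_exp_cosh.
Qed.

Lemma affine_majorant (f : T -> R) (q e : R) : 0 < e -> (forall x, 0 <= f x) ->
  (forall s e', 0 < s -> 0 < e' -> exists h, [/\ bm h,
    forall x, 1 + s * (f x - q) <= h x & expect m h <= cosh s + e']) ->
  exists k, [/\ bm k, forall x, f x <= k x & expect m k <= q + e].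
Proof.
(* The loss will be [(2 * s ^+ 2 + s ^+ 2) / s = 3 * s]; the bound [1 / 2] is the range of
   [cosh_le]. *)
move=> e0 f0 hf; pose s := Num.min (e / 3) (1 / 2).
have s0 : 0 < s by rewrite /s lt_min divr_gt0//= divr_gt0.
have s2 : s <= 1 / 2 by rewrite /s ge_min lexx orbT.
have se : 3 * s <= e.
  have : s <= e / 3 by rewrite /s ge_min lexx.
  by lra.
have e'0 : 0 < s ^+ 2 by exact: exprn_gt0.
have [h [bh hh hle]] := hf s _ s0 e'0.
have fk x : f x <= (h x - 1) / s + q.
  by rewrite -lerBlDr ler_pdivlMr// mulrC lerBrDl.
have cs : cosh s <= 1 + 2 * s ^+ 2 by rewrite cosh_le// ger0_norm// ltW.
pose k x := (h x - 1) / s + q.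
have bk : bm k.
  have [mh [K hK]] := bh; split.
    apply: measurable_funD => //.
    apply: measurable_funM => //.
    exact: measurable_funB.
  exists ((K - 1) / s + q) => x; rewrite (le_trans (f0 x) (fk x)) /k.
  by rewrite lerD2r ler_pM2r ?invr_gt0// lerD2r; have /andP[] := hK x.
exists k; split => //.
(* Expectations are manipulated for nonnegative functions, while [q] may be negative: multiples of
   its absolute value are added on both sides. *)
have q0 : 0 <= q + `|q| by have := ler_norm (- q); rewrite normrN; lra.
have b1 : bm (fun=> 1 + s * `|q|).
  by apply: bounded_measurable_cst; rewrite addr_ge0// mulr_ge0// ltW.
have b2 : bm (fun=> s * (q + `|q|)).
  by apply: bounded_measurable_cst; rewrite mulr_ge0// ltW.
have b3 : bm (fun x => s * k x) by apply: bounded_measurableZ => //; exact: ltW.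
have E : s * expect m k + (1 + s * `|q|) = expect m h + s * (q + `|q|).
  rewrite -expectZ// -(expect_cst m (1 + s * `|q|)) -(expect_cst m (s * (q + `|q|))).
  by rewrite -!expectD//; apply: expect_eq => x; rewrite /k; field; rewrite gt_eqF.
rewrite -(ler_pM2l s0).
have h3 : s * (3 * s) <= s * e by rewrite ler_pM2l.
by rewrite expr2 in cs hle; lra.
Qed.

Theorem sandwich e : 0 < e -> exists k k',
  [/\ bm k, bm k', forall x, g x <= k x /\ 1 - g x <= k' x,
      expect m k <= r + e & expect m k' <= 1 - r + e].
Proof.
move=> e0.
have [k [bk gk rk]] : exists k, [/\ bm k, forall x, g x <= k x & expect m k <= r + e].
  apply: affine_majorant => // [x|s e' s0 e'0]; first by have /andP[] := g01 x.
  exact: exp_majorant.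
have [k' [bk' gk' rk']] : exists k', [/\ bm k', forall x, 1 - g x <= k' x &
    expect m k' <= 1 - r + e].
  apply: affine_majorant => // [x|s e' s0 e'0].
    by rewrite subr_ge0; have /andP[] := g01 x.
  (* [cosh] is even, and [1 - s * (g x - r)] equals [1 + s * ((1 - g x) - (1 - r))]. *)
  have [h [bh hh hle]] := exp_majorant (- s) e'0; exists h; split => //.
    by move=> x; have := hh x; lra.
  by move: hle; rewrite /cosh opprK addrC [expR _ + _]addrC [_ + e']addrC.
by exists k, k'; split.
Qed.

End functionals.

(** * Patterns in powers of a measure *)

Lemma weight_partition (d : measure_display) (S : measurableType d) (R : realType)
  (P : probability S R) (J : finType) (f : S -> J) (A : set S) :
  measurable A -> (forall j, measurable [set s | f s = j]) ->
  weight P A = \sum_j weight P (A `&` [set s | f s = j]).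
Proof.
move=> mA mf; have mAf j : measurable (A `&` [set s | f s = j]) by exact: measurableI.
rewrite -(expect_indic P mA).
under eq_bigr do rewrite -(expect_indic P (mAf _)).
rewrite -expect_sum; last by move=> j; exact: bounded_measurable_indic.
apply: expect_eq => s; rewrite (bigD1 (f s))//= big1 => [|j jf].
  by rewrite addr0 !indicE in_setI [X in _ && X]mem_set// andbT.
by rewrite indicE memNset//= => -[_ fj]; rewrite fj eqxx in jf.
Qed.

Section pattern_measure.
Context (R : realType) (T : ptopologicalType) (I : Type).
Variables (m : probability (borel T) R) (C : I -> set T).
Hypothesis C_clopen : forall a, clopen (C a).
Hypothesis inner_regular : forall O : set T, open O -> forall e : R, 0 < e ->
  exists K : set T, [/\ compact K, measurable (K : set (borel T)), K `<=` O &
    weight m O <= weight m K + e].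
Context (d : measure_display) (S : measurableType d) (P : probability S R).
Variables (rho : nat -> S -> borel T) (k : nat).
Hypothesis rho_measurable : forall i, measurable_fun setT (rho i).
Hypothesis rho_independent : forall E : nat -> set (borel T),
  (forall i, measurable (E i)) ->
  weight P [set s | forall i, (i < k)%N -> E i (rho i s)] =
  \prod_(i < k) weight m (E i).
Variable E : set (borel T).
Hypothesis mE : measurable E.
Notation pattern_prob := (pattern_prob m C).

Definition realizes (j : nat) (bs : seq bool) (a : I) (s : S) : Prop :=
  forall i, (i < size bs)%N ->
    E (rho (j + i) s) /\ `[< C a (rho (j + i) s) >] = nth false bs i.

Lemma measurable_rho i (A : set (borel T)) : measurable A ->
  measurable [set s | A (rho i s)].
Proof. by move=> mA; have := rho_measurable i measurableT mA; rewrite setTI. Qed.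

Lemma measurable_box j (B : nat -> set (borel T)) : (forall i, measurable (B i)) ->
  measurable [set s | forall i, (i < j)%N -> B i (rho i s)].
Proof.
move=> mB; rewrite (_ : [set s | _] =
    \bigcap_i [set s | (i < j)%N -> B i (rho i s)]); last first.
  by apply/seteqP; split => s h i => [_|]; exact: h.
apply: bigcapT_measurable => i; have [ij|ij] := ltnP i j; last first.
  rewrite (_ : [set s | _] = setT); first exact: measurableT.
  by apply/seteqP; split => s.
rewrite (_ : [set s | _] = [set s | B i (rho i s)]); first exact: measurable_rho.
by apply/seteqP; split => s /= => [h|h _]; [exact: h|].
Qed.

Lemma measurable_realizes j bs a : measurable [set s | realizes j bs a s].
Proof.
have [Co Cc] := C_clopen a.
have mC : measurable (C a : set (borel T)) by exact: sub_sigma_algebra.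
have mCb b : measurable ([set x | `[< C a x >] = b] : set (borel T)).
  case: b.
    by rewrite (_ : [set x | _] = C a)//; apply/seteqP; split => x /= /asboolP.
  rewrite (_ : [set x | _] = ~` C a); first exact: measurableC.
  apply/seteqP; split => x /=; first by move=> /negbT/asboolPn.
  by move=> /asboolPn/negbTE.
rewrite (_ : [set s | _] = \bigcap_i [set s | (i < size bs)%N ->
    (E `&` [set x | `[< C a x >] = nth false bs i]) (rho (j + i) s)]); last first.
  by apply/seteqP; split => s h i => [_|] ib; exact: h.
apply: bigcapT_measurable => i; have [ib|ib] := ltnP i (size bs); last first.
  rewrite (_ : [set s | _] = setT); first exact: measurableT.
  by apply/seteqP; split => s.
rewrite (_ : [set s | _] =
    [set s | (E `&` [set x | `[< C a x >] = nth false bs i]) (rho (j + i) s)]).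
  by apply: measurable_rho; exact: measurableI.
by apply/seteqP; split => s /= => [h|h _]; [exact: h|].
Qed.

Lemma measurable_exists_member (l : seq I) (G : set I) (Q : I -> set S) :
  G `<=` members l -> (forall a, measurable (Q a)) ->
  measurable [set s | exists a, G a /\ Q a s].
Proof.
move=> + mQ; elim: l G => [|c l IH] G Gl.
  rewrite (_ : [set s | _] = set0); first exact: measurable0.
  by apply/seteqP; split => s // -[a [/Gl]].
have mI : measurable [set s | exists a, (G `&` members l) a /\ Q a s].
  by apply: IH => a [].
have [Gc|Gc] := pselect (G c).
  rewrite (_ : [set s | _] = Q c `|` [set s | exists a, (G `&` members l) a /\ Q a s]).
    exact: measurableU.
  apply/seteqP; split => s /=; last by move=> [?|[a [[Ga _] Qa]]]; [exists c|exists a].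
  by move=> [a [Ga Qa]]; case: (Gl a Ga) => [->|al]; [left|right; exists a].
rewrite (_ : [set s | _] = [set s | exists a, (G `&` members l) a /\ Q a s])//.
apply/seteqP; split => s /=; last by move=> [a [[Ga _] Qa]]; exists a.
move=> [a [Ga Qa]]; exists a; split => //; split => //.
by case: (Gl a Ga) => // ca; rewrite ca in Gc.
Qed.

(** Identifies iterated expectations with probabilities on a sample space, for finite families.
    Conditioning on the trace of coordinate [j] makes the sieved family constant, and the cell is
    then absorbed into the box as [B' j]. *)
Lemma pattern_measure bs : forall j (B : nat -> set (borel T)) l (G : set I),
  (j + size bs)%N = k -> (forall i, measurable (B i)) -> G `<=` members l ->
  weight P ([set s | forall i, (i < j)%N -> B i (rho i s)] `&`
            [set s | exists a, G a /\ realizes j bs a s]) =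
  (\prod_(i < j) weight m (B i)) * pattern_prob E bs G.
Proof.
elim: bs => [|b bs IH] j B l G jk mB Gl.
  rewrite addn0 in jk; rewrite /pattern_prob /=.
  have [[a Ga]|nG] := pselect (G !=set0).
    rewrite (_ : [set s | exists a, _] = setT); last first.
      by apply/seteqP; split => s // _; exists a.
    by rewrite setIT jk rho_independent// has_member1 ?mulr1//; exists a.
  rewrite (_ : [set s | exists a, _] = set0); last first.
    by apply/seteqP; split => s // -[a [Ga _]]; apply: nG; exists a.
  by rewrite setI0 weight0 has_member0// mulr0.
pose D (t : (size l).-tuple bool) : set (borel T) := [set x | trace C l x = t].
have mD t : measurable (D t) by exact: measurable_trace.
have mA : measurable ([set s | forall i, (i < j)%N -> B i (rho i s)] `&`
    [set s | exists a, G a /\ realizes j (b :: bs) a s]).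
  apply: measurableI; first exact: measurable_box.
  by apply: (measurable_exists_member Gl) => a; exact: measurable_realizes.
rewrite (weight_partition (f := fun s => trace C l (rho j s)) P mA); last first.
  by move=> t; apply: (measurable_rho j (mD t)).
have sQ := smooth_pattern_prob C_clopen inner_regular bs mE.
have -> : pattern_prob E (b :: bs) G =
    expect m (fun x => \1_E x * pattern_prob E bs (sieve C G b x)) by [].
rewrite (@expect_trace _ _ _ m C C_clopen l (\1_E)
  (fun x => pattern_prob E bs (sieve C G b x))); last 3 first.
- exact: bounded_measurable_indic.
- by move=> x; rewrite (smooth_ge0 _ sQ).
- by move=> x y xy; rewrite (sieve_trace _ Gl xy).
rewrite mulr_sumr; apply: eq_bigr => t _.
have -> : expect m (fun x => \1_E x * \1_(D t) x) = weight m (E `&` D t).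
  by rewrite -expect_indic; [apply: expect_eq => x; rewrite indicI|exact: measurableI].
pose B' i := if i == j then E `&` D t else B i.
have mB' i : measurable (B' i) by rewrite /B'; case: ifP => // _; exact: measurableI.
have Gl' : sieve C G b (trace_point C t) `<=` members l.
  exact: subset_trans (@sieve_sub _ _ _ _ _ _) Gl.
have jk' : (j.+1 + size bs)%N = k by rewrite -jk /= addSnnS.
have B'j : B' j = E `&` D t by rewrite /B' eqxx.
have B'i i : (i < j)%N -> B' i = B i by move=> ij; rewrite /B' ltn_eqF.
have := IH j.+1 B' l _ jk' mB' Gl'; rewrite big_ord_recr /= B'j.
under eq_bigr => i _ do rewrite B'i//.
rewrite mulrA => <-; congr (weight P _); apply/seteqP; split => s.
  move=> [[Bs [a [Ga ra]]] ts]; have [Ej Cj] := ra 0%N (ltn0Sn _).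
  rewrite addn0 /= in Ej Cj; split.
    move=> i; rewrite ltnS leq_eqVlt => /predU1P[->|ij].
      by rewrite B'j.
    by rewrite B'i//; exact: Bs.
  exists a; split; last by move=> i ib; rewrite addSnnS; exact: ra i.+1 ib.
  split => //; rewrite -Cj -ts; apply: (traceP (s := l)); last exact: Gl.
  exact: trace_pointK.
move=> [Bs [a [[Ga Ca] ra]]].
have [Es ts] : (E `&` D t) (rho j s) by have := Bs j (ltnSn j); rewrite B'j.
split => //; split.
  by move=> i ij; have := Bs i (ltnW ij); rewrite B'i.
exists a; split => // -[|i] ib; last by rewrite -addSnnS; exact: ra.
rewrite addn0; split => //=; rewrite -Ca -ts; apply: (traceP (s := l)); last exact: Gl.
by rewrite trace_pointK.
Qed.

Lemma realizes_full (G : set I) bs e : size bs = k ->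
  weight m E ^+ k <= pattern_prob E bs G -> 0 < e ->
  exists l, members l `<=` G /\
    weight m E ^+ k <= weight P [set s | exists a, members l a /\ realizes 0 bs a s] + e.
Proof.
move=> bk hG e0; have [_ _ iP] := smooth_pattern_prob C_clopen inner_regular bs mE.
have [l [lG hl]] := iP G e e0; exists l; split => //.
have := @pattern_measure bs 0%N (fun=> setT) l (members l) bk (fun=> measurableT)
  (@subset_refl _ _).
rewrite big_ord0 mul1r (_ : [set s | forall i, _] = setT) ?setTI.
  by move=> ->; exact: le_trans hl.
by apply/seteqP; split.
Qed.

End pattern_measure.

(** * Type spaces *)

Section type_topology.
Variables (A : pointedType) (I : Type) (D : I -> set A).
Implicit Types p q : typ D.

(** Types are indexed by formulas, not by definable sets; a common realization of two truth values
    makes equivalent formulas agree. *)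
Lemma truth_congr p i j : D i = D j -> p i = p j.
Proof.
move=> ij; have [a ha] := finitely_satisfiable p (fun b : 'I_2 => if b == ord0 then i else j).
have := ha ord0; have := ha ord_max => /= -> ->.
by rewrite ij.
Qed.

Lemma In_nth (J : Type) (x0 : J) l j : List.In j l ->
  exists k : 'I_(size l), nth x0 l k = j.
Proof.
elim: l => [//|c l IH] [->|/IH[k <-]]; first by exists ord0.
by exists (lift ord0 k).
Qed.

Lemma finitely_satisfiable_seq p l :
  exists a, forall i, List.In i l -> truth p i = `[< D i a >].
Proof.
case: l => [|i0 l]; first by exists point.
have [a ha] := finitely_satisfiable p (fun k : 'I_(size (i0 :: l)) => nth i0 (i0 :: l) k).
by exists a => i /(In_nth i0)[k <-]; exact: ha.
Qed.

Lemma cvg_typ (F : set_system (typ D)) p : Filter F ->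
  (forall i, F [set q | truth q i = truth p i]) -> F --> p.
Proof.
move=> FF Fp B [W [[V oV <-] Vp] WB]; apply: filterS WB _.
suff : (fun q : typ D => (truth q : {ptws I -> bool})) @ F --> (truth p : {ptws I -> bool}).
  by apply; apply: open_nbhs_nbhs.
apply/cvg_sup => i B' [W' [[V' oV' <-] Vp'] WB'].
suff : F (fun q : typ D => B' (truth q)) by [].
apply: filterS (Fp i) => q qp; apply: WB'; have {}qp : truth q i = truth p i := qp.
by rewrite /= qp.
Qed.

Lemma nbhs_typ p (B : set (typ D)) : nbhs p B -> exists l : seq I,
  forall q, (forall i, List.In i l -> truth q i = truth p i) -> B q.
Proof.
pose basic l := [set q : typ D | forall i, List.In i l -> truth q i = truth p i].
pose F : set_system (typ D) := filter_from setT basic.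
have FF : Filter F.
  apply: filter_from_filter; first by exists [::].
  move=> l l' _ _; exists (l ++ l') => // q h.
  by split => i il; apply: h; apply: List.in_or_app; [left|right].
have : F --> p.
  apply: cvg_typ => i; exists [:: i] => // q; apply; by left.
by move=> Fp /Fp[l _ h]; exists l.
Qed.

Lemma clopen_truth i : clopen [set p : typ D | truth p i].
Proof.
have c : continuous (fun p : typ D => truth p i) by exact: truth_continuous.
apply: (@preimage_clopen _ bool (fun p : typ D => truth p i) [set b : bool | b]) => //.
by split; [exact: discrete_open|exact: discrete_closed].
Qed.

Lemma open_truth i c : open [set p : typ D | truth p i = c].
Proof.
have [oi ci] := clopen_truth i; case: c => //.
rewrite (_ : [set p | _] = ~` [set p : typ D | truth p i]); first exact: closed_openC.
by apply/seteqP; split => p /=; [move=> ->|move/negP/negbTE].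
Qed.

Lemma hausdorff_typ : hausdorff_space (typ D).
Proof.
rewrite open_hausdorff => p q pq.
have [i pqi] : exists i, truth p i != truth q i.
  apply: contrapT => h; move/eqP: pq; apply; apply: typ_inj => i.
  by apply/eqP; apply: contrapT => /negP pqi; apply: h; exists i.
exists ([set s : typ D | truth s i = truth p i], [set s : typ D | truth s i = truth q i]).
  by split; rewrite inE.
split; [exact: open_truth|exact: open_truth|]; apply/eqP/seteqP; split => // s /= [-> h].
by rewrite h eqxx in pqi.
Qed.

(** The limit of the truth values along an ultrafilter is again finitely satisfiable, as any
    finitely many of its values are those of an actual type. *)
Lemma compact_typ : compact [set: typ D].
Proof.
rewrite compact_ultra => F UF _; pose t i := `[< F [set q | truth q i] >].
have Ft i : F [set q | truth q i = t i].
  rewrite /t; case: asboolP => [|nF].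
    by apply: filterS => q /= ->.
  have [//|] := in_ultra_setVsetC [set q : typ D | truth q i] UF.
  by apply: filterS => q /= /negP/negbTE.
have tfs n (s : 'I_n -> I) : exists a : A, forall j, t (s j) = `[< D (s j) a >].
  have : F [set q | forall j, truth q (s j) = t (s j)].
    by apply: filter_forall => j; exact: Ft.
  move=> /filter_ex[q hq]; have [a ha] := finitely_satisfiable q s.
  by exists a => j; rewrite -hq.
exists (Typ tfs); split => //; exact: cvg_typ.
Qed.

Lemma compact_typ_closed (B : set (typ D)) : closed B -> compact B.
Proof. by move=> cB; apply: subclosed_compact cB compact_typ _. Qed.

End type_topology.

Section type_maps.
Variables (A : pointedType) (I J : Type) (D : I -> set A) (E : J -> set A).
Variables (h : J -> I) (hE : forall j, D (h j) = E j).

(** Every finite part of [q] is realized in [A]; a cluster point of the types of such realizations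
    is mapped to [q]. *)
Lemma type_map_surjective (q : typ E) : exists p : typ D, type_map hE p = q.
Proof.
pose F : set_system (typ D) := filter_from [set: seq J]
  (fun l => [set p | forall j, List.In j l -> truth p (h j) = truth q j]).
have FF : ProperFilter F.
  apply: filter_from_proper; last first.
    move=> l _; have [a ha] := finitely_satisfiable_seq q l.
    by exists (type_of D a) => j jl /=; rewrite hE ha.
  apply: filter_from_filter; first by exists [::].
  move=> l l' _ _; exists (l ++ l') => // p hp.
  by split => j jl; apply: hp; apply: List.in_or_app; [left|right].
have [p [_ cp]] := compact_typ FF filterT.
exists p; apply: typ_inj => j /=.
have := cp [set s | truth s (h j) = truth q j] [set s | truth s (h j) = truth p (h j)].
move=> /(_ _ _)[||s /= [-> ->]] //.
  by exists [:: j] => // s; apply; left.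
  by apply: open_nbhs_nbhs; split => //; exact: open_truth.
Qed.

End type_maps.

(** * Measurability for the completion *)

Section sandwiched_functions.
Context (d : measure_display) (T : measurableType d) (R : realType).
Implicit Type m : probability T R.

(** The majorant [k'] of [1 - f] encodes a minorant of [f] by a nonnegative function. *)
Definition sandwiched m (f : T -> R) (r : R) : Prop := forall e, 0 < e ->
  exists k k', [/\ bounded_measurable k, bounded_measurable k',
    forall x, f x <= k x /\ 1 - f x <= k' x,
    expect m k <= r + e & expect m k' <= 1 - r + e].

Lemma completion_measurable m (A : set T) : measurable A ->
  measurable (A : set (completed_space m)).
Proof. by move=> mA; apply: sub_caratheodory; exact: sub_sigma_algebra. Qed.

Lemma completionE m (A : set T) : measurable A -> completion m A = m A.
Proof. by move=> mA; rewrite /completed_measure_extension measurable_mu_extE. Qed.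

Lemma completion_measurable_fun m d' (S : measurableType d') (f : T -> S) :
  measurable_fun setT f -> measurable_fun [set: completed_space m] f.
Proof.
move=> mf _ B mB; have := mf measurableT B mB; rewrite !setTI => mfB.
exact: completion_measurable.
Qed.

Lemma completion_integral m (f : T -> R) : bounded_measurable f ->
  (\int[completion m]_x (f x)%:E = (expect m f)%:E)%E.
Proof.
move=> bf; have [mf _] := bf.
have mid : measurable_fun [set: completed_space m] (idfun : completed_space m -> T).
  by apply: completion_measurable_fun; exact: measurable_id.
have mfE : measurable_fun setT (EFin \o f) by exact/measurable_EFinP.
have := @ge0_integral_pushforward _ _ _ _ R _ mid (completion m) setT (EFin \o f)
  measurableT mfE (fun y _ => bounded_measurable_ge0 y bf).
rewrite preimage_setT => <-.
rewrite (eq_measure_integral m); last by move=> A mA _; exact: completionE.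
rewrite /expect /Rintegral fineK//.
exact: integrable_fin_num (bounded_measurable_integrable m bf).
Qed.

Lemma infimum_majorant m (f : T -> R) (k : nat -> T -> R) (r : R) :
  (forall n, bounded_measurable (k n)) -> (forall n x, f x <= k n x) ->
  (forall n, expect m (k n) <= r + n.+1%:R^-1) ->
  exists u, [/\ bounded_measurable u, forall x, f x <= u x & expect m u <= r].
Proof.
move=> bk fk kr; pose u x := infs (k^~ x) 0.
have lb x : has_lbound (range (k^~ x)).
  by exists 0 => _ [n _ <-]; exact: bounded_measurable_ge0.
have u_le n x : u x <= k n x.
  rewrite /u /infs; apply: ge_inf; last by exists n.
  by exists 0 => _ [j _ <-]; exact: bounded_measurable_ge0.
have u_ge c x : (forall n, c <= k n x) -> c <= u x.
  move=> ck; apply: lb_le_inf; first by exists (k 0%N x), 0%N.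
  by move=> _ [j _ <-]; exact: ck.
have bu : bounded_measurable u.
  split; first by apply: measurable_fun_infs => [x _|n]; [exact: lb|case: (bk n)].
  have [_ [K hK]] := bk 0%N; exists K => x; apply/andP; split.
    by apply: u_ge => n; exact: bounded_measurable_ge0.
  by rewrite (le_trans (u_le 0%N x))//; have /andP[] := hK x.
exists u; split => //; first by move=> x; apply: u_ge => n.
apply/ler_addgt0Pr => e e0.
have [n ne] : exists n : nat, n.+1%:R^-1 <= e.
  exists (Num.bound e^-1); rewrite invf_ple ?posrE//.
  by rewrite (le_trans (ltW (archi_boundP _))) ?invr_ge0 ?(ltW e0)// ler_nat.
apply: (@le_trans _ _ (expect m (k n))); first exact: expect_le.
by rewrite (le_trans (kr n))// lerD2l.
Qed.

(** [f] lies between the Borel functions [1 - v] and [u], whose difference [z] has expectation 0.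
    Hence [f = u] almost everywhere, and completeness gives measurability. *)
Lemma sandwiched_completion m f r : sandwiched m f r ->
  measurable_fun [set: completed_space m] f /\
  (\int[completion m]_x (f x)%:E = r%:E)%E.
Proof.
move=> sf.
have [kk hkk] : exists kk : nat -> (T -> R) * (T -> R), forall n,
    [/\ bounded_measurable (kk n).1, bounded_measurable (kk n).2,
    forall x, f x <= (kk n).1 x /\ 1 - f x <= (kk n).2 x,
    expect m (kk n).1 <= r + n.+1%:R^-1 & expect m (kk n).2 <= 1 - r + n.+1%:R^-1].
  have h (n : nat) : exists kk : (T -> R) * (T -> R),
      [/\ bounded_measurable kk.1, bounded_measurable kk.2,
      forall x, f x <= kk.1 x /\ 1 - f x <= kk.2 x,
      expect m kk.1 <= r + n.+1%:R^-1 & expect m kk.2 <= 1 - r + n.+1%:R^-1].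
    have n0 : 0 < n.+1%:R^-1 :> R by rewrite invr_gt0.
    by have [k [k' hk]] := sf _ n0; exists (k, k').
  by have [kk hkk] := choice h; exists kk.
have [u [bu fu ur]] : exists u,
    [/\ bounded_measurable u, forall x, f x <= u x & expect m u <= r].
  apply: (@infimum_majorant m f (fun n => (kk n).1)) => n; try by case: (hkk n).
  by move=> x; case: (hkk n) => _ _ /(_ x)[].
have [v [bv fv vr]] : exists v,
    [/\ bounded_measurable v, forall x, 1 - f x <= v x & expect m v <= 1 - r].
  apply: (@infimum_majorant m (fun x => 1 - f x) (fun n => (kk n).2)) => n; try by case: (hkk n).
  by move=> x; case: (hkk n) => _ _ /(_ x)[].
have buv := bounded_measurableD bu bv.
have uv1 : expect m (fun x => u x + v x) <= 1 by rewrite expectD//; lra.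
pose z x := u x + v x - 1.
have z0 x : 0 <= z x by have := fu x; have := fv x; rewrite /z; lra.
have bz : bounded_measurable z.
  split; first by apply: measurable_funB => //; case: buv.
  have [_ [K hK]] := buv; exists K => x; rewrite z0 /= /z.
  by have /andP[_] := hK x; lra.
have ez : expect m z = 0.
  apply/eqP; rewrite eq_le expect_ge0// andbT.
  have : expect m (fun x => z x + 1) = expect m (fun x => u x + v x).
    by apply: expect_eq => x; rewrite /z subrK.
  by rewrite expectD ?expect_cst//; [lra|exact: bounded_measurable_cst].
have mz : measurable_fun setT (EFin \o z).
  by apply/measurable_EFinP; case: bz.
have fuE : (\forall x \ae (completion m), setT x -> (EFin \o u) x = (EFin \o f) x).
  have : (\int[m]_x `|(EFin \o z) x| = 0)%E.
    under eq_integral do rewrite gee0_abs ?lee_fin//.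
    rewrite -[LHS]fineK; last exact: integrable_fin_num (bounded_measurable_integrable m bz).
    by congr EFin.
  move=> /(ae_eq_integral_abs m measurableT mz)[N [mN N0 hN]].
  exists N; split; [exact: completion_measurable|by rewrite [LHS]completionE|].
  apply: subset_trans hN => x /= hx hz; apply: hx => _.
  have := hz Logic.I; rewrite /z => -[] h; congr EFin.
  by have := fu x; have := fv x; lra.
have muE : measurable_fun [set: completed_space m] (EFin \o u).
  apply: (@completion_measurable_fun m _ _ (EFin \o u)).
  by apply/measurable_EFinP; case: bu.
have mfE : measurable_fun [set: completed_space m] (EFin \o f).
  apply: (ae_measurable_fun _ fuE muE).
  exact: measure_is_complete_caratheodory.
split; first exact/measurable_EFinP.
have mC : measurable [set: completed_space m] by exact: measurableT.
rewrite -[LHS](@ae_eq_integral _ (completed_space m) R (completion m) setT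
  (EFin \o f) (EFin \o u) mC muE mfE fuE).
rewrite [LHS](completion_integral m bu); congr EFin.
have : 1 <= expect m (fun x => u x + v x).
  rewrite -[leLHS](expect_cst m); apply: expect_le => //.
    exact: bounded_measurable_cst.
  by move=> x; have := z0 x; rewrite /z; lra.
by rewrite expectD//; lra.
Qed.

Lemma sandwiched_expect m (f : T -> R) : measurable_fun setT f -> (forall x, 0 <= f x <= 1) ->
  sandwiched m f (expect m f).
Proof.
move=> mf f01 e e0; have bf : bounded_measurable f by split => //; exists 1.
have bf' : bounded_measurable (fun x => 1 - f x).
  split; first exact: measurable_funB.
  by exists 1 => x; have /andP[] := f01 x; lra.
exists f, (fun x => 1 - f x); split => //; first by rewrite lerDl ltW.
have : expect m (fun x => f x + (1 - f x)) = 1.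
  by rewrite -[RHS](expect_cst m); apply: expect_eq => x; rewrite addrC subrK.
by rewrite expectD//; lra.
Qed.

End sandwiched_functions.

Lemma expect_image (d d' : measure_display) (S : measurableType d)
  (T : measurableType d') (R : realType) (m' : probability S R)
  (m : probability T R) (h : S -> T) (f : T -> R) :
  measurable_fun setT h -> (forall A, measurable A -> m A = m' (h @^-1` A)) ->
  bounded_measurable f -> expect m f = expect m' (f \o h).
Proof.
move=> mh mE bf; have [mf _] := bf.
have mfE : measurable_fun setT (EFin \o f) by exact/measurable_EFinP.
rewrite /expect /Rintegral (eq_measure_integral (pushforward m' h)); last first.
  by move=> A mA _; exact: mE.
rewrite (ge0_integral_pushforward mh)// => y _.
exact: bounded_measurable_ge0.
Qed.

Lemma bounded_measurable_comp (d d' : measure_display) (S : measurableType d)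
  (T : measurableType d') (R : realType) (h : S -> T) (f : T -> R) :
  measurable_fun setT h -> bounded_measurable f -> bounded_measurable (f \o h).
Proof.
move=> mh [mf [K hK]]; split; first exact: measurableT_comp.
by exists K => x; exact: hK.
Qed.

Lemma sandwiched_image (d d' : measure_display) (S : measurableType d)
  (T : measurableType d') (R : realType) (m' : probability S R)
  (m : probability T R) (h : S -> T) (f : T -> R) r :
  measurable_fun setT h -> (forall A, measurable A -> m A = m' (h @^-1` A)) ->
  sandwiched m f r -> sandwiched m' (f \o h) r.
Proof.
move=> mh mE sf e e0; have [k [k' [bk bk' fk kr k'r]]] := sf e e0.
exists (k \o h), (k' \o h); split.
- exact: bounded_measurable_comp.
- exact: bounded_measurable_comp.
- by move=> x; exact: fk.
- by rewrite -(expect_image mh mE).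
- by rewrite -(expect_image mh mE).
Qed.

Section type_push.
Variables (A B : pointedType) (I J : Type) (D : I -> set A) (E : J -> set B).
Variables (g : A -> B) (h : J -> I) (hE : forall j, D (h j) = g @^-1` E j).

Lemma type_push_subproof (p : typ D) n (s : 'I_n -> J) :
  exists a : B, forall j, truth p (h (s j)) = `[< E (s j) a >].
Proof.
have [a pa] := finitely_satisfiable p (h \o s).
by exists (g a) => j; have := pa j; rewrite /= hE.
Qed.

(** Unlike [type_map], this also changes the space of realizations, as needed for adjoining the
    tuple [b] to [d]. *)
Definition type_push (p : typ D) : typ E :=
  @Typ B J E (fun j => truth p (h j)) (@type_push_subproof p).

Lemma type_push_continuous : continuous type_push.
Proof.
move=> p; apply: cvg_typ; first exact: (fmap_filter _ (nbhs_filter p)).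
move=> j.
suff : nbhs p [set q : typ D | truth q (h j) = truth p (h j)] by [].
by apply: open_nbhs_nbhs; split => //; exact: open_truth.
Qed.

End type_push.

(** * Finitely satisfiable measures *)

Section boolean_types.
Variables (L : language) (U : structure L) (X : Type).
Implicit Types (p : global_type U X) (phi psi : formula L (X + U)).

Definition negation phi := Defs.Implies phi Falsum.

Definition conjunction phi psi := negation (Defs.Implies phi (negation psi)).

Lemma truth_negation p phi : truth p (negation phi) = ~~ truth p phi.
Proof.
have [a ha] := finitely_satisfiable p (fun b : 'I_2 => if b == ord0 then phi else negation phi).
have := ha ord0; have := ha ord_max => /= -> ->.
apply/idP/negP => [/asboolP h /asboolP|h]; first exact: h.
by apply/asboolP => k; apply: h; apply/asboolP.
Qed.

Lemma truth_conjunction p phi psi :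
  truth p (conjunction phi psi) = truth p phi && truth p psi.
Proof.
have [a ha] := finitely_satisfiable p (fun b : 'I_3 =>
  if b == ord0 then phi else if b == ord_max then psi else conjunction phi psi).
have := ha ord0; have := ha ord_max; have := ha (inord 1).
rewrite -!val_eqE /= !inordK// => -> -> ->.
apply/asboolP/andP => [h|[/asboolP h1 /asboolP h2] h]; last exact: (h h1).
by split; apply/asboolP; apply: contrapT => k; apply: h => // h' /k.
Qed.

Definition literals (l : seq (formula L (X + U) * bool)) : formula L (X + U) :=
  foldr (fun i => conjunction (if i.2 then i.1 else negation i.1)) (negation Falsum) l.

Lemma truth_literals p l :
  truth p (literals l) <-> forall i, List.In i l -> truth p i.1 = i.2.
Proof.
have pT : truth p (negation Falsum).
  have [a ha] := finitely_satisfiable p (fun b : 'I_1 => negation Falsum).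
  by rewrite (ha ord0); apply/asboolP; exact: (fun h => h).
elim: l => [|[phi c] l IH]; first by split.
rewrite [literals _]/= truth_conjunction; split.
  move=> /andP[h /IH h'] i [<-|/h'//] /=.
  by case: c h => //=; rewrite truth_negation => /negbTE.
move=> h; apply/andP; split; last by apply/IH => i il; apply: h; right.
have := h (phi, c) (or_introl erefl) => /=; case: c h => // _.
by rewrite truth_negation => ->.
Qed.

Lemma truth_inst_id p phi : truth p (inst phi id) = truth p phi.
Proof. by apply: truth_congr; exact: instances_inst. Qed.

End boolean_types.

Lemma compact_measurable (S : ptopologicalType) (K : set S) :
  hausdorff_space S -> compact K -> measurable (K : set (borel S)).
Proof.
move=> hS cK; rewrite -[K]setCK; apply: measurableC; apply: sub_sigma_algebra.
by apply: closed_openC; exact: compact_closed.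
Qed.

Lemma image_inner_regular (R : realType) (L : language) (U : structure L)
  (X : Type) (nu : keisler R U X) (S : ptopologicalType)
  (f : global_type U X -> S) (cf : continuous f) : hausdorff_space S ->
  forall V : set S, open V -> forall e : R, 0 < e ->
  exists K : set S, [/\ compact K, measurable (K : set (borel S)), K `<=` V &
    weight (image_measure cf nu) V <= weight (image_measure cf nu) K + e].
Proof.
move=> hS V oV e e0.
have oA : open (f @^-1` V) by apply: open_comp => // x _; exact: cf.
have mA : measurable (f @^-1` V : set (borel (global_type U X))).
  exact: sub_sigma_algebra.
have [K [G [cK oG KA AG GK]]] := keisler_regular nu mA e0.
have cfK : compact (f @` K).
  by apply: continuous_compact => //; exact: continuous_subspaceT.
have mfK := compact_measurable hS cfK.
exists (f @` K); split => //; first by move=> _ [x Kx <-]; exact: KA.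
have mK := compact_measurable (@hausdorff_typ _ _ _) cK.
have mG : measurable (G : set (borel (global_type U X))) by exact: sub_sigma_algebra.
have mI : measurable (f @^-1` (f @` K) : set (borel (global_type U X))).
  have := @continuous_borel_measurable _ _ f cf measurableT _ mfK.
  by rewrite setTI.
have -> : weight (image_measure cf nu) V = weight nu (f @^-1` V) by [].
have -> : weight (image_measure cf nu) (f @` K) = weight nu (f @^-1` (f @` K)) by [].
have h1 : weight nu (f @^-1` V) <= weight nu G by exact: weight_le.
have h2 : weight nu K <= weight nu (f @^-1` (f @` K)).
  by apply: weight_le => // x Kx; exists x.
have KG : K `<=` G by exact: subset_trans AG.
have h3 : weight nu (G `\` K) < e.
  by rewrite -lte_fin weightE//; exact: measurableD.
by rewrite weightD// in h3; lra.
Qed.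

(** Finite satisfiability speaks of single formulas. A compact subset of [V] of positive weight is
    covered by finitely many formulas defining subsets of [V], and one of them has positive
    weight. *)
Lemma satisfiable_open (R : realType) (L : language) (U : structure L)
  (X : Type) (nu : keisler R U X) (M : set U) (V : set (global_type U X)) :
  satisfiable_in nu M -> open V -> 0 < weight nu V ->
  exists a : X -> U, (forall x, M (a x)) /\ V (type_of _ a).
Proof.
move=> fs oV wV.
have mV : measurable (V : set (borel (global_type U X))) by exact: sub_sigma_algebra.
(* The allowed error is the weight of [V] itself, so [K] cannot be null. *)
have [K [G [cK oG KV VG GK]]] := keisler_regular nu mV wV.
have mK := compact_measurable (@hausdorff_typ _ _ _) cK.
have mG : measurable (G : set (borel (global_type U X))) by exact: sub_sigma_algebra.
have wK : 0 < weight nu K.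
  have h3 : weight nu (G `\` K) < weight nu V.
    by rewrite -lte_fin [X in (X < _)%E]weightE//; exact: measurableD.
  rewrite weightD// in h3; last exact: subset_trans VG.
  by have := weight_le nu mV mG VG; lra.
pose box (l : {classic seq (formula L (X + U) * bool)}) :=
  [set p : global_type U X | truth p (literals l)].
have cb l : clopen (box l) by exact: clopen_truth.
rewrite compact_cover in cK.
have [|p Kp|D DV KD] := cK _ [set l | box l `<=` V] box.
- by move=> l _; case: (cb l).
- have [l hl] := nbhs_typ (open_nbhs_nbhs (conj oV (KV p Kp))).
  exists [seq (i, truth p i) | i <- l].
    move=> q /truth_literals hq; apply: hl => i il.
    by apply: (hq (i, truth p i)); apply: List.in_map il.
  by apply/truth_literals => i /List.in_map_iff[j [<-]].
have /finite_seqP[r Dr] := finite_fset D.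
have [l [lV wl]] : exists l, box l `<=` V /\ 0 < weight nu (box l).
  apply: contrapT => h; have : weight nu K <= 0; last by rewrite leNgt wK.
  have {}DV l : l \in r -> box l `<=` V.
    by move=> lr; have : [set` r] l by []; rewrite -Dr => /DV; rewrite inE.
  have mb l : measurable (box l : set (borel (global_type U X))).
    by apply: sub_sigma_algebra; case: (cb l).
  have {}KD : K `<=` [set p | exists l, l \in r /\ box l p].
    move=> p /KD[l lD bl]; exists l; split => //.
    by have : [set` r] l by rewrite -Dr.
  have : measurable ([set p | exists l, l \in r /\ box l p] : set (borel (global_type U X))) /\
      weight nu [set p | exists l, l \in r /\ box l p] <= 0.
    elim: r DV {Dr KD} => [|l r IH] DV.
      rewrite (_ : [set p | _] = set0); first by rewrite weight0.
      by apply/seteqP; split => p // [l []].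
    rewrite (_ : [set p | _] = box l `|` [set p | exists l, l \in r /\ box l p]).
      have [|mr wr] := IH; first by move=> l' l'r; apply: DV; rewrite inE l'r orbT.
      split; first exact: measurableU.
      rewrite (le_trans (weightU_le nu (mb l) mr))//.
      have : weight nu (box l) <= 0.
        rewrite leNgt; apply/negP => wl; apply: h; exists l; split => //.
        by apply: DV; exact: mem_head.
      by lra.
    apply/seteqP; split => p /=.
      by move=> [l' []]; rewrite inE => /predU1P[->|l'r] bl'; [left|right; exists l'].
    move=> [bl|[l' [l'r bl']]]; first by exists l; rewrite mem_head.
    by exists l'; rewrite inE l'r orbT.
  by move=> [mr wr]; rewrite (le_trans _ wr)// weight_le.
have [|a [Ma ha]] := fs (literals l).
  have mb : measurable (box l : set (borel (global_type U X))).
    by apply: sub_sigma_algebra; case: (cb l).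
  rewrite /value (_ : [set p | _] = box l).
    by rewrite -(weightE nu mb) lte_fin.
  by apply/seteqP; split => p; rewrite /= truth_inst_id.
exists a; split => //; apply: lV; rewrite /box /=.
exact/asboolP.
Qed.

(** * The definable side *)

(** The form in which saturation enters. *)
Definition realizing (L : language) (U : structure L) (N : set U) : Prop :=
  forall (X : finType) (p : type_over N X), exists a : X -> U, tp N a = p.

Lemma sat_dual (L : language) (U : structure L) (X Y Z : Type)
  (phi : formula L (X + (Y + Z))) (d : Y -> U) (c : X -> U) (b : Z -> U) :
  sat (dual phi) (assign d (assign c b)) = sat phi (assign c (assign d b)).
Proof.
by rewrite /dual sat_rename; congr (sat phi _); apply/funext => -[x|[y|z]].
Qed.

Section fibers.
Variables (L : language) (U : structure L) (X Y Z : Type).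
Variables (phi : formula L (X + (Y + Z))) (b : Z -> U) (N : set U).
Hypothesis bN : forall z, N (b z).

Definition param (z : Z) : N := SigSub (mem_set (bN z)).

Lemma fiber_over_subproof (c : X -> N) :
  instances set_val (inst (dual phi) (assign c param)) =
  instances (assign (set_val \o c) b) (dual phi).
Proof.
rewrite instances_inst; congr (instances _ (dual phi)).
by apply/funext => -[x|z].
Qed.

Definition fiber_over : type_over N Y -> fiber_type phi b N :=
  type_map fiber_over_subproof.

Lemma fiber_over_continuous : continuous fiber_over.
Proof. exact: type_map_continuous. Qed.

Lemma fiber_partE p : fiber_part phi b N p = fiber_over (restrict_type N p).
Proof.
apply: typ_inj => c /=; apply: truth_congr; rewrite !instances_inst.
by congr (instances _ (dual phi)); apply/funext => -[x|z].
Qed.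

Lemma fiber_over_tp d : fiber_over (tp N d) = fiber_tp phi b N d.
Proof. by apply: typ_inj => c /=; rewrite fiber_over_subproof. Qed.

Lemma fiber_measureE (R : realType) (nu : keisler R U Y)
  (A : set (borel (fiber_type phi b N))) :
  fiber_measure nu phi b N A = restriction nu N (fiber_over @^-1` A).
Proof.
have -> : fiber_measure nu phi b N A = nu (fiber_part phi b N @^-1` A) by [].
by congr (nu _); apply/funext => p /=; rewrite fiber_partE.
Qed.

Lemma fiber_part_surjective q : exists p, fiber_part phi b N p = q.
Proof. exact: type_map_surjective. Qed.

End fibers.

Lemma fiber_realized (L : language) (U : structure L) (X Z : Type) (Y : finType)
  (phi : formula L (X + (Y + Z))) (b : Z -> U) (N : set U) :
  (forall z, N (b z)) -> realizing N ->
  forall q : fiber_type phi b N, exists d, fiber_tp phi b N d = q.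
Proof.
move=> bN rN q; have [p <-] := type_map_surjective (fiber_over_subproof phi bN) q.
have [d <-] := rN Y p.
by exists d; exact: esym (fiber_over_tp phi bN d).
Qed.

Lemma restrict_measurable (L : language) (U : structure L) (X : Type) (N : set U) :
  measurable_fun setT
    (restrict_type N : borel (global_type U X) -> borel (type_over N X)).
Proof. exact: (continuous_borel_measurable (@restrict_type_continuous _ _ N X)). Qed.

Section definable_side.
Variables (R : realType) (L : language) (U : structure L) (X Y Z : finType).
Variables (mu : keisler R U X) (lambda : keisler R U Y).
Variables (phi : formula L (X + (Y + Z))) (b : Z -> U) (M : set U).
Variable F : type_over M (Y + Z)%type -> R.
Hypothesis F_continuous : continuous F.
Hypothesis F_value : forall c, value mu phi c = (F (tp M c))%:E.
Hypothesis M_realizing : realizing M.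

Definition push_subst (v : (Y + Z) + M) : Y + U :=
  match v with
  | inl (inl y) => inl y
  | inl (inr z) => inr (b z)
  | inr a => inr (set_val a)
  end.

Lemma push_global_subproof (psi : formula L ((Y + Z) + M)) :
  instances id (rename push_subst psi) =
  (fun d : Y -> U => assign d b) @^-1` instances set_val psi.
Proof.
apply/seteqP; split => d; rewrite /instances /= sat_rename;
  by congr (sat psi _); apply/funext => -[[y|z]|a].
Qed.

Definition push_global : global_type U Y -> type_over M (Y + Z)%type :=
  type_push push_global_subproof.

Lemma push_global_type_of d : push_global (type_of _ d) = tp M (assign d b).
Proof. by apply: typ_inj => psi /=; rewrite push_global_subproof. Qed.

Definition integrand (p : global_type U Y) : R := F (push_global p).

Lemma integrand_continuous : continuous integrand.
Proof.
by move=> p; apply: continuous_comp; [exact: type_push_continuous|exact: F_continuous].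
Qed.

Lemma integrand_type_of d : value mu phi (assign d b) = (integrand (type_of _ d))%:E.
Proof. by rewrite /integrand push_global_type_of F_value. Qed.

Lemma F_range q : 0 <= F q <= 1.
Proof.
have [c <-] := M_realizing q; rewrite -!lee_fin -F_value.
rewrite measure_ge0 probability_le1//.
apply: sub_sigma_algebra; exact: (clopen_truth _ _).1.
Qed.

Lemma continuous_measurable (S : ptopologicalType) (f : S -> R) : continuous f ->
  measurable_fun [set: borel S] (f : borel S -> R).
Proof.
move=> /continuousP cf; apply: (measurability _ (RGenOInfty.measurableE R)).
move=> _ [_ [t ->] <-]; rewrite setTI; apply: sub_sigma_algebra.
apply: cf; rewrite (_ : [set` _] = [set x | t < x]); first exact: open_gt.
by apply/seteqP; split => x /=; rewrite in_itv /= andbT.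
Qed.

Definition product_value : R := expect lambda (integrand : borel (global_type U Y) -> R).

Variable N : set U.
Hypothesis bN : forall z, N (b z).
Hypothesis MN : M `<=` N.
Hypothesis N_realizing : realizing N.

Definition raise (a : M) : N := SigSub (mem_set (MN (set_valP a))).

Definition push_over_subst (v : (Y + Z) + M) : Y + N :=
  match v with
  | inl (inl y) => inl y
  | inl (inr z) => inr (param bN z)
  | inr a => inr (raise a)
  end.

Lemma push_over_subproof (psi : formula L ((Y + Z) + M)) :
  instances set_val (rename push_over_subst psi) =
  (fun d : Y -> U => assign d b) @^-1` instances set_val psi.
Proof.
apply/seteqP; split => d; rewrite /instances /= sat_rename;
  by congr (sat psi _); apply/funext => -[[y|z]|a].
Qed.

Definition push_over : type_over N Y -> type_over M (Y + Z)%type :=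
  type_push push_over_subproof.

Lemma push_over_tp d : push_over (tp N d) = tp M (assign d b).
Proof. by apply: typ_inj => psi /=; rewrite push_over_subproof. Qed.

Lemma push_globalE p : push_global p = push_over (restrict_type N p).
Proof.
apply: typ_inj => psi /=; apply: truth_congr.
by rewrite instances_inst push_over_subproof push_global_subproof.
Qed.

Lemma morley_definable : morley_value mu lambda phi b N product_value.
Proof.
split.
- exists (fun q => F (push_over q)).
  have cf : continuous (fun q => F (push_over q)).
    by move=> p; apply: continuous_comp; [exact: type_push_continuous|exact: F_continuous].
  have mf := continuous_measurable cf.
  have eF : expect (restriction lambda N) (fun q => F (push_over q)) = product_value.
    rewrite /product_value (@expect_image _ _ (borel (global_type U Y))
      (borel (type_over N Y)) R lambda (restriction lambda N) (restrict_type N)).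
    - by apply: expect_eq => p; rewrite /integrand push_globalE.
    - exact: restrict_measurable.
    - by [].
    - by split => //; exists 1 => q; exact: F_range.
  have [|mc ic] := @sandwiched_completion _ _ _ (restriction lambda N)
    (fun q => F (push_over q)) product_value.
    by rewrite -eF; apply: sandwiched_expect => // q; exact: F_range.
  by split => // d; rewrite push_over_tp F_value.
- move=> m f hf.
  (* [f] is prescribed only at types of actual tuples; since types over [N] are realized, this
     determines it everywhere. *)
  have fE p : f (fiber_part phi b N p) = integrand p.
    have [d hd] := N_realizing (restrict_type N p).
    rewrite (fiber_partE phi bN) -hd fiber_over_tp /integrand push_globalE -hd.
    by rewrite push_over_tp; apply: EFin_inj; rewrite -hf F_value.
  (* [fiber_part] is a closed map of a compact space onto a Hausdorff space, so continuity of
     [integrand] descends to [f]. *)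
  have cf : continuous (f : fiber_type phi b N -> R).
    apply/continuousP => V oV; rewrite -[_ @^-1` _]setCK; apply: closed_openC.
    rewrite (_ : ~` _ = fiber_part phi b N @` (integrand @^-1` (~` V))); last first.
      apply/seteqP; split => [q|_ [p Vp <-]] /=; last by rewrite fE.
      by have [p <-] := fiber_part_surjective q; rewrite fE => Vp; exists p.
    apply: compact_closed; first exact: hausdorff_typ.
    apply: continuous_compact; first exact/continuous_subspaceT/fiber_part_continuous.
    apply: compact_typ_closed; apply: closed_comp; last exact: open_closedC.
    by move=> p _; exact: integrand_continuous.
  have f01 q : 0 <= f q <= 1.
    by have [p <-] := fiber_part_surjective q; rewrite fE; exact: F_range.
  have mf := continuous_measurable cf.
  have ef : expect (fiber_measure lambda phi b N) f = product_value.
    rewrite /product_value (@expect_image _ _ (borel (global_type U Y))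
      (borel (fiber_type phi b N)) R lambda (fiber_measure lambda phi b N)
      (fiber_part phi b N)).
    - by apply: expect_eq => p; exact: fE.
    - exact: (continuous_borel_measurable (@fiber_part_continuous _ _ _ _ _ phi b N)).
    - by [].
    - by split => //; exists 1 => q; exact: f01.
  apply: sandwiched_completion; rewrite -ef.
  exact: sandwiched_expect.
Qed.

End definable_side.

(** * The finitely satisfiable side *)

Section power_patterns.
Context (R : realType) (S T : ptopologicalType) (I : Type).
Variables (m : probability (borel T) R) (C : I -> set T).
Hypothesis C_clopen : forall a, clopen (C a).
Hypothesis inner_regular : forall V : set T, open V -> forall e : R, 0 < e ->
  exists K : set T, [/\ compact K, measurable (K : set (borel T)), K `<=` V &
    weight m V <= weight m K + e].
Variables (m' : probability (borel S) R) (h : S -> T).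
Hypothesis h_continuous : continuous h.
Hypothesis m_image : forall A : set (borel T), measurable A -> m A = m' (h @^-1` A).
Variables (k : nat) (P : probability (borel {ptws 'I_k.+1 -> S}) R).
Hypothesis P_power : is_power m' P.
Variables (G : set I) (E : set (borel T)).
Hypothesis mE : measurable E.
Hypothesis E_full : forall bs, weight m E ^+ size bs <= pattern_prob m C E bs G.

Let rho (i : nat) (p : borel {ptws 'I_k.+1 -> S}) : borel T := h (p (inord i)).

Let rho_measurable i : measurable_fun setT (rho i).
Proof.
apply: (@continuous_borel_measurable {ptws 'I_k.+1 -> S} T (rho i)) => p.
apply: (@continuous_comp {ptws 'I_k.+1 -> S} S T (fun p => p (inord i)) h).
  exact: proj_continuous.
exact: h_continuous.
Qed.

Let rho_independent (D : nat -> set (borel T)) : (forall i, measurable (D i)) ->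
  weight P [set s | forall i, (i < k.+1)%N -> D i (rho i s)] =
  \prod_(i < k.+1) weight m (D i).
Proof.
move=> mD; have mhD i : measurable (h @^-1` D i : set (borel S)).
  have := continuous_borel_measurable h_continuous measurableT (mD i).
  by rewrite setTI.
rewrite (_ : [set s | _] = [set p : borel {ptws 'I_k.+1 -> S} |
    forall i : 'I_k.+1, (h @^-1` D i) (p i)]); last first.
  apply/seteqP; split => p hp i; first by have := hp i (ltn_ord i); rewrite /rho inord_val.
  by move=> ik; have := hp (inord i); rewrite /rho /= inordK.
have [_ /(_ (fun i => h @^-1` D i) (fun i => mhD i)) hP] := P_power.
rewrite /weight [X in fine X](_ : _ = (\prod_(i < k.+1) weight m (D i))%:E)//.
rewrite [LHS]hP -prodEFin; apply: eq_bigr => i _.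
by rewrite weightE// m_image.
Qed.

(** [W] is only compared in outer measure: from above with the box, from below with an intersection
    of measurable sets [Q J], on each of which a finite subfamily realizes the pattern of [J]. There
    are [2 ^ k.+1] patterns, whence the error allotted to each. *)
Lemma completion_shattered (W : set {ptws 'I_k.+1 -> S}) :
  W `<=` [set p | forall i, E (h (p i))] ->
  (forall p, (forall i, E (h (p i))) ->
    (forall J : {set 'I_k.+1}, exists a, G a /\
      forall i, `[< C a (h (p i)) >] = (i \notin J)) -> W p) ->
  completion P (W : set (completed_space P)) = (weight m E ^+ k.+1)%:E.
Proof.
move=> WE EW; pose box := [set p : borel {ptws 'I_k.+1 -> S} | forall i, E (h (p i))].
have boxE : box = [set s | forall i, (i < k.+1)%N -> E (rho i s)].
  apply/seteqP; split => p hp i; first by move=> _; exact: hp.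
  by have := hp i (ltn_ord i); rewrite /rho inord_val.
have mbox : measurable box.
  by rewrite boxE; exact: (@measurable_box _ _ _ _ rho_measurable k.+1 (fun=> E) (fun=> mE)).
have wbox : weight P box = weight m E ^+ k.+1.
  by rewrite boxE (rho_independent (fun=> mE)) prodr_const card_ord.
apply/eqP; rewrite eq_le; apply/andP; split.
  rewrite -wbox weightE// -(completionE P mbox).
  exact: (@le_mu_ext _ _ R P W box).
apply/lee_addgt0Pr => e e0.
have [Q hQ] : exists Q : {set 'I_k.+1} -> set (borel {ptws 'I_k.+1 -> S}), forall J,
    [/\ measurable (Q J), weight P box <= weight P (Q J) + e / (2 ^ k.+1)%:R &
    forall p, Q J p -> exists a, G a /\
      forall i, E (h (p i)) /\ `[< C a (h (p i)) >] = (i \notin J)].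
  have step (J : {set 'I_k.+1}) : exists Q : set (borel {ptws 'I_k.+1 -> S}),
      [/\ measurable Q, weight P box <= weight P Q + e / (2 ^ k.+1)%:R &
      forall p, Q p -> exists a, G a /\
        forall i, E (h (p i)) /\ `[< C a (h (p i)) >] = (i \notin J)].
    pose bs := mkseq (fun i => inord i \notin J) k.+1.
    have sbs : size bs = k.+1 by rewrite size_mkseq.
    have e'0 : 0 < e / (2 ^ k.+1)%:R by rewrite divr_gt0// ltr0n expn_gt0.
    have := E_full bs; rewrite sbs => hbs.
    have [l [lG hl]] := realizes_full C_clopen inner_regular rho_measurable
      rho_independent mE sbs hbs e'0.
    exists [set s | exists a, members l a /\ realizes C rho E 0 bs a s]; split.
    - apply: (measurable_exists_member (@subset_refl _ _)) => a.
      exact: (measurable_realizes C_clopen rho_measurable mE).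
    - by rewrite wbox.
    - move=> p [a [al ra]]; exists a; split; first exact: lG.
      move=> i; have := ra i; rewrite sbs => /(_ (ltn_ord i)).
      by rewrite add0n nth_mkseq// /rho inord_val.
  by have [Q hQ] := choice step; exists Q.
have mQ J : measurable (Q J) by case: (hQ J).
have QE J : Q J `<=` box by move=> p; case: (hQ J) => _ _ /[apply] -[a [_ ha]] i; case: (ha i).
(* All sets intersected lie in the box, so their deficits add up. *)
have bound (s : seq {set 'I_k.+1}) :
    measurable (\big[setI/box]_(J <- s) Q J) /\
    weight P box <= weight P (\big[setI/box]_(J <- s) Q J) +
      (size s)%:R * (e / (2 ^ k.+1)%:R).
  elim: s => [|J s [ms IH]]; first by rewrite big_nil mul0r addr0.
  rewrite big_cons; set A := \big[_/_]_(_ <- s) _ in ms IH *.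
  split; first exact: measurableI.
  have Abox : A `<=` box.
    by rewrite /A; elim/big_rec: _ => // J' x _ xb p [_ /xb].
  have [_ hJ _] := hQ J.
  have mQA : measurable (Q J `&` A) by exact: measurableI.
  have : weight P (Q J `\` (Q J `&` A)) <= weight P (box `\` A).
    apply: weight_le; [exact: measurableD|exact: measurableD|].
    by move=> p [Qp nQA]; split; [exact: (QE J)|move=> Ap; apply: nQA; split].
  rewrite weightD// weightD// => h1.
  rewrite /= -(natr1 (size s)) mulrDl mul1r.
  move: hJ IH h1; move: (e / _) => e'; lra.
have [mV hV] := bound (enum {set 'I_k.+1}).
set V0 := \big[_/_]_(_ <- _) _ in mV hV.
have V0J p J : V0 p -> Q J p.
  rewrite /V0; have : J \in enum {set 'I_k.+1} by rewrite mem_enum.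
  elim: (enum _) => // J' s IH; rewrite inE big_cons => /predU1P[->|Js] [Qp Vp] //.
  exact: IH.
have V0box p : V0 p -> box p by move=> /(V0J _ finset.set0)/QE.
have V0W : V0 `<=` W.
  move=> p Vp; apply: EW; first exact: V0box.
  move=> J; have [_ _ /(_ p (V0J p J Vp))[a [Ga ha]]] := hQ J.
  by exists a; split => // i; case: (ha i).
have h1 : ((weight P V0)%:E <= completion P (W : set (completed_space P)))%E.
  by rewrite weightE// -(completionE P mV); exact: (@le_mu_ext _ _ R P V0 W).
apply: (@le_trans _ _ ((weight P V0)%:E + e%:E)%E); last by rewrite leeD2r.
rewrite -EFinD lee_fin -wbox (le_trans hV)// lerD2l.
have -> : size (enum {set 'I_k.+1}) = (2 ^ k.+1)%N.
  by rewrite -cardE -cardsT -powersetT card_powerset cardsT card_ord.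
by rewrite mulrCA divff ?mulr1// pnatr_eq0 -lt0n expn_gt0.
Qed.

End power_patterns.

(** Otherwise [f - g] would stay below its mean by [e] almost surely. Constants are added on both
    sides to keep the integrands nonnegative. *)
Lemma expect_exceeded (d : measure_display) (S : measurableType d) (R : realType)
  (P : probability S R) (f g : S -> R) (e : R) :
  bounded_measurable f -> bounded_measurable g -> 0 < e ->
  measurable [set x | expect P f - expect P g - e < f x - g x] /\
  0 < weight P [set x | expect P f - expect P g - e < f x - g x].
Proof.
move=> bf bg e0; have [[mf [Kf hf]] [mg [Kg hg]]] := (bf, bg).
set c := expect P f - expect P g - e; set V := [set x | _].
have mV : measurable V.
  have := measurable_funB mf mg measurableT (@measurable_itv R `]c, +oo[).
  rewrite setTI (_ : _ @^-1` _ = V)//.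
  by apply/seteqP; split => x; rewrite /V /= in_itv /= andbT.
split => //; rewrite lt_neqAle weight_ge0 andbT; apply/eqP => V0.
have K0 : 0 <= Kf by have /andP[f0 fK] := hf point; exact: le_trans fK.
have c0 : 0 <= `|c| + c by rewrite -[c in _ + c]opprK subr_ge0 -normrN ler_norm.
have D0 : 0 <= Kf + `|c| + `|c| by rewrite !addr_ge0.
have bV := bounded_measurable_indic R mV.
have bDV := bounded_measurableZ D0 bV.
have bc := @bounded_measurable_cst _ S R _ (normr_ge0 c).
have bcc := @bounded_measurable_cst _ S R _ c0.
have bcV := bounded_measurableD bcc bDV.
have : expect P (fun x => f x + `|c|) <=
    expect P (fun x => g x + (`|c| + c + (Kf + `|c| + `|c|) * \1_V x)).
  apply: expect_le; [exact: bounded_measurableD|exact: bounded_measurableD|].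
  move=> x; have /andP[f0 fK] := hf x; have /andP[g0 gK] := hg x.
  have nc := ler_norm (- c); rewrite normrN in nc.
  have n0 := normr_ge0 c.
  have [Vx|Vx] := pselect (V x).
    by rewrite indicE mem_set//= mulr1; lra.
  have fg : f x - g x <= c by rewrite leNgt; exact/negP.
  by rewrite indicE memNset//= mulr0 addr0; lra.
rewrite (expectD P bf bc) (expectD P bg bcV) (expectD P bcc bDV) (expectZ P _ bV).
by rewrite expect_indic// !expect_cst -V0 mulr0; move: (normr_ge0 c); rewrite /c; lra.
Qed.

Lemma clopen_indic_continuous (S : topologicalType) (R : realType) (A : set S) :
  clopen A -> continuous (\1_A : S -> R).
Proof.
move=> [oA cA]; apply/continuousP => V _; rewrite preimage_indic.
case: ifP => _; case: ifP => _ //; first exact: openT.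
  exact: closed_openC.
exact: open0.
Qed.

Lemma continuous_sum (S : topologicalType) (R : realType) (J : Type) (v : seq J)
  (f : J -> S -> R) : (forall j, continuous (f j)) ->
  continuous (fun x => \sum_(j <- v) f j x).
Proof.
move=> cf; elim: v => [|j v IH] x.
  by under eq_fun do rewrite big_nil; exact: cvg_cst.
by under eq_fun do rewrite big_cons; apply: cvgD; [exact: cf|exact: IH].
Qed.

Lemma open_exceeded (S : topologicalType) (R : realType) (f g : S -> R) (c : R) :
  continuous f -> continuous g -> open [set x | c < f x - g x].
Proof.
move=> cf cg; apply: (@open_comp _ _ (fun x => f x - g x) [set y | c < y]).
  by move=> x _; apply: cvgB; [exact: cf|exact: cg].
exact: open_gt.
Qed.

Section satisfiable_side.
Variables (R : realType) (L : language) (U : structure L) (X Y Z : finType).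
Variables (mu : keisler R U X) (lambda : keisler R U Y).
Variables (phi : formula L (X + (Y + Z))) (b : Z -> U) (M N : set U).
Variable F : type_over M (Y + Z)%type -> R.
Hypothesis F_continuous : continuous F.
Hypothesis F_value : forall c, value mu phi c = (F (tp M c))%:E.
Hypothesis M_realizing : realizing M.
Hypothesis bN : forall z, N (b z).
Hypothesis MN : M `<=` N.
Hypothesis N_realizing : realizing N.
Hypothesis mu_dependent : dependent mu.
Hypothesis lambda_satisfiable : satisfiable_in lambda M.
Notation fibers := (fiber_type (dual phi) b N).
Notation m := (fiber_measure mu (dual phi) b N).

Definition cylinder (d : Y -> N) : set fibers := [set q | truth q d].

Definition section (c : X -> U) : set (global_type U Y) :=
  [set p | truth p (inst (dual phi) (assign c b))].

Definition pointwise_in : set (Y -> N) := [set d | forall y, M (set_val (d y))].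

Lemma clopen_cylinder d : clopen (cylinder d).
Proof. exact: clopen_truth. Qed.

Lemma clopen_section c : clopen (section c).
Proof. exact: clopen_truth. Qed.

Lemma measurable_section c : measurable (section c : set (borel (global_type U Y))).
Proof. by apply: sub_sigma_algebra; case: (clopen_section c). Qed.

Lemma fibers_inner_regular (V : set fibers) : open V -> forall e : R, 0 < e ->
  exists K : set fibers, [/\ compact K, measurable (K : set (borel fibers)),
    K `<=` V & weight m V <= weight m K + e].
Proof. by apply: image_inner_regular; exact: hausdorff_typ. Qed.

Lemma cylinder_tp (d : Y -> N) (c : X -> U) :
  cylinder d (fiber_tp (dual phi) b N c) <->
  sat phi (assign c (assign (set_val \o d) b)).
Proof.
rewrite /cylinder /= -sat_dual -sat_dual; split=> [/asboolP|] //.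
by move=> h; apply/asboolP.
Qed.

Lemma section_type_of (d : Y -> N) (c : X -> U) :
  section c (type_of _ (set_val \o d)) <-> cylinder d (fiber_tp (dual phi) b N c).
Proof.
rewrite cylinder_tp -sat_dual /section /= instances_inst.
by split=> [/asboolP|] // h; apply/asboolP.
Qed.

Lemma lift_in (a : Y -> U) : (forall y, M (a y)) ->
  exists d, pointwise_in d /\ a = set_val \o d.
Proof.
move=> Ma; exists (fun y => SigSub (mem_set (MN (Ma y)))); split => //.
Qed.

(** If the set difference of the sections had positive weight, it would contain a tuple of [M],
    hence of [N], on which the equal fiber types would disagree. *)
Lemma section_weight_le c c' :
  fiber_tp (dual phi) b N c = fiber_tp (dual phi) b N c' ->
  weight lambda (section c) <= weight lambda (section c').
Proof.
move=> cc'; have [oc _] := clopen_section c; have [_ cc] := clopen_section c'.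
have mc := measurable_section c; have mc' := measurable_section c'.
have mD : measurable (section c `\` section c' : set (borel (global_type U Y))).
  exact: measurableD.
have D0 : weight lambda (section c `\` section c') <= 0.
  rewrite leNgt; apply/negP => h.
  have [|a [Ma [ac ac']]] := satisfiable_open lambda_satisfiable _ h.
    by apply: openI => //; exact: closed_openC.
  have [d [_ ad]] := lift_in Ma; apply: ac'; rewrite ad in ac *.
  by apply/section_type_of; rewrite -cc'; apply/section_type_of.
have : weight lambda (section c) <=
    weight lambda (section c' `|` (section c `\` section c')).
  apply: weight_le => //; first exact: measurableU.
  by move=> p cp; have [|nc'] := pselect (section c' p); [left|right].
by have := weightU_le lambda mc' mD; lra.
Qed.

Definition realization (q : fibers) : X -> U :=
  sval (cid (fiber_realized bN N_realizing q)).

Lemma realizationK q : fiber_tp (dual phi) b N (realization q) = q.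
Proof. by rewrite /realization; case: cid. Qed.

Definition fiber_value (q : fibers) : R := weight lambda (section (realization q)).

Lemma fiber_value_tp c :
  value lambda (dual phi) (assign c b) = (fiber_value (fiber_tp (dual phi) b N c))%:E.
Proof.
have -> : fiber_value (fiber_tp (dual phi) b N c) = weight lambda (section c).
  by apply/eqP; rewrite eq_le !section_weight_le ?realizationK.
by rewrite weightE//; exact: measurable_section.
Qed.

Lemma fiber_value01 q : 0 <= fiber_value q <= 1.
Proof. by rewrite weight_ge0 weight_le1//; exact: measurable_section. Qed.

Notation psi := (integrand b F).

Lemma integrand01 p : 0 <= psi p <= 1.
Proof. exact: (F_range F_value M_realizing). Qed.

Lemma bounded_integrand : @bounded_measurable _ (borel (global_type U Y)) R psi.
Proof.
split; last by exists 1; exact: integrand01.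
by apply: continuous_measurable; exact: integrand_continuous.
Qed.

Lemma weight_cylinder d : weight m (cylinder d) = psi (type_of _ (set_val \o d)).
Proof.
apply: EFin_inj; rewrite weightE; last first.
  by apply: sub_sigma_algebra; case: (clopen_cylinder d).
rewrite -(integrand_type_of b F_value) /value.
have -> : m (cylinder d) = mu (fiber_part (dual phi) b N @^-1` cylinder d) by [].
congr (mu _); apply/funext => p; rewrite /cylinder /=; congr is_true.
apply: truth_congr; rewrite !instances_inst; apply/seteqP.
by split => c; rewrite /instances /= !sat_dual.
Qed.

(** With [v] fixed, the right-hand side is a continuous function of the type of [d], and its mean
    under [lambda] is the left-hand side without [e]. The open set where it exceeds its mean less
    [e] has positive weight, hence a point in [M]. *)
Lemma approximable s (v : seq fibers) e : 0 < e -> exists d, pointwise_in d /\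
  s * (\sum_(q <- v) fiber_value q - (size v)%:R * product_value lambda b F) - e <=
  s * (\sum_(q <- v) \1_(cylinder d) q - (size v)%:R * weight m (cylinder d)).
Proof.
move=> e0; pose f p : R := \sum_(q <- v) \1_(section (realization q)) p.
pose h p : R := (size v)%:R * psi p.
have cf : continuous f.
  by apply: continuous_sum => q; exact: clopen_indic_continuous (clopen_section _).
have cZ c (k : global_type U Y -> R) : continuous k -> continuous (fun p => c * k p).
  by move=> ck p; apply: (@cvgM R _ (nbhs p)); [exact: cvg_cst|exact: ck].
have ch : continuous h by apply: cZ; exact: integrand_continuous.
have bf : @bounded_measurable _ (borel (global_type U Y)) R f.
  apply: bounded_measurable_sum => q; apply: bounded_measurable_indic.
  exact: measurable_section.
have bh : @bounded_measurable _ (borel (global_type U Y)) R h.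
  by apply: bounded_measurableZ => //; exact: bounded_integrand.
have Ef : expect lambda f = \sum_(q <- v) fiber_value q.
  rewrite expect_sum.
    by apply: eq_bigr => q _; rewrite expect_indic//; exact: measurable_section.
  by move=> q; apply: bounded_measurable_indic; exact: measurable_section.
have Eh : expect lambda h = (size v)%:R * product_value lambda b F.
  by rewrite expectZ//; exact: bounded_integrand.
suff [a [Ma ha]] : exists a : Y -> U, (forall y, M (a y)) /\
    s * (expect lambda f - expect lambda h) - e < s * (f (type_of _ a) - h (type_of _ a)).
  have [d [Gd ad]] := lift_in Ma; exists d; split => //.
  rewrite -Ef -Eh (le_trans (ltW ha))// ad /h weight_cylinder.
  rewrite (_ : f _ = \sum_(q <- v) \1_(cylinder d) q)// /f.
  apply: eq_bigr => q _; rewrite !indicE; congr (_ %:R); congr nat_of_bool.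
  apply/idP/idP => /set_mem hq; apply/mem_set.
    by rewrite -(realizationK q); apply/section_type_of.
  by apply/section_type_of; rewrite realizationK.
have [s0|s0] := leP 0 s.
  have [_] := expect_exceeded lambda (bounded_measurableZ s0 bf) (bounded_measurableZ s0 bh) e0.
  move=> /(satisfiable_open lambda_satisfiable)[].
    by apply: open_exceeded; exact: cZ.
  move=> a [Ma] /=; rewrite (expectZ _ _ bf) (expectZ _ _ bh) => ha.
  by exists a; split => //; rewrite !mulrBr.
have ns : 0 <= - s by lra.
have [_] := expect_exceeded lambda (bounded_measurableZ ns bh) (bounded_measurableZ ns bf) e0.
move=> /(satisfiable_open lambda_satisfiable)[].
  by apply: open_exceeded; exact: cZ.
move=> a [Ma] /=; rewrite (expectZ _ _ bf) (expectZ _ _ bh) => ha.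
by exists a; split => //; move: ha; rewrite !mulrBr; lra.
Qed.

(** Dependence treats all parameters of [phi] alike, whereas the fibers keep [b] fixed. The joined
    tuple lies in [N] but perhaps not in [M], so dependence is applied over [N] and in [N]. *)
Definition join (d : Y -> N) (v : Y + Z) : N :=
  match v with inl y => d y | inr z => param bN z end.

Lemma local_fiber_subproof (d : Y -> N) :
  local_instances phi (join d) =
  instances (assign (set_val \o d) b) (dual (dual phi)) :> set (X -> U).
Proof.
apply/seteqP; split => c; rewrite /local_instances /instances /= !sat_dual;
  by congr (sat phi (assign _ _)); apply/funext => -[y|z].
Qed.

Definition local_fiber : local_type phi N -> fibers := type_map local_fiber_subproof.

Lemma local_fiber_part p :
  local_fiber (psi_part phi N (restrict_type N p)) = fiber_part (dual phi) b N p.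
Proof.
apply: typ_inj => d /=; apply: truth_congr; rewrite !instances_inst.
rewrite -local_fiber_subproof; apply/seteqP.
by split => c; rewrite /instances /local_instances.
Qed.

Lemma local_fiber_continuous : continuous local_fiber.
Proof. exact: type_map_continuous. Qed.

Lemma fiber_measure_local (A : set (borel fibers)) :
  m A = local_measure mu phi N (local_fiber @^-1` A).
Proof.
have -> : m A = mu (fiber_part (dual phi) b N @^-1` A) by [].
have -> : local_measure mu phi N (local_fiber @^-1` A) =
  mu (restrict_type N @^-1` (psi_part phi N @^-1` (local_fiber @^-1` A))) by [].
by congr (mu _); apply/funext => p /=; rewrite local_fiber_part.
Qed.

Lemma unshattered (E : set (borel fibers)) : measurable E -> 0 < weight m E ->
  exists bs, pattern_prob m cylinder E bs pointwise_in < weight m E ^+ size bs.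
Proof.
move=> mE E0; apply: contrapT => nex.
have E_full bs : weight m E ^+ size bs <= pattern_prob m cylinder E bs pointwise_in.
  by rewrite leNgt; apply/negP => h; apply: nex; exists bs.
have mE' : measurable (local_fiber @^-1` E : set (borel (local_type phi N))).
  have := continuous_borel_measurable local_fiber_continuous measurableT mE.
  by rewrite setTI.
have wE : completion (local_measure mu phi N) (local_fiber @^-1` E) = (weight m E)%:E.
  by rewrite [LHS]completionE// -fiber_measure_local weightE.
apply: (mu_dependent (@subset_refl _ N)).
exists (local_fiber @^-1` E); split.
- exact: completion_measurable.
- by rewrite wE lte_fin.
case=> // k P _ Pm; rewrite wE -EFin_expe.
apply: (completion_shattered clopen_cylinder fibers_inner_regular
  local_fiber_continuous _ Pm mE E_full) => //.
- by move=> A _; exact: fiber_measure_local.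
- by move=> p [].
- move=> p Ep hp; split => // J; have [d [_ hd]] := hp J.
  exists (join d); split; first by move=> z; exact: set_valP.
  move=> i; rewrite -hd /cylinder /=.
  by apply/idP/asboolP.
Qed.

Lemma morley_satisfiable :
  morley_value lambda mu (dual phi) b N (product_value lambda b F).
Proof.
have sg : sandwiched m fiber_value (product_value lambda b F).
  by move=> e e0; exact: (sandwich clopen_cylinder fibers_inner_regular unshattered
    approximable fiber_value01 e0).
split.
- have sf : sandwiched (restriction mu N) (fiber_value \o fiber_over (dual phi) bN)
      (product_value lambda b F).
    apply: (@sandwiched_image _ _ (borel (type_over N X)) (borel fibers) R
      (restriction mu N) m (fiber_over (dual phi) bN)) sg.
      exact: (continuous_borel_measurable (@fiber_over_continuous _ _ _ _ _ (dual phi) b N bN)).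
    by move=> A _; exact: (fiber_measureE bN).
  exists (fiber_value \o fiber_over (dual phi) bN).
  have [mf If] := sandwiched_completion sf; split => // c.
  by rewrite /= fiber_over_tp fiber_value_tp.
(* All fiber types over [N] are realized, which leaves [fiber_value] as the only candidate. *)
- move=> m' f hf; have -> : f = fiber_value; last exact: sandwiched_completion.
  apply/funext => q; rewrite -(realizationK q).
  by apply: EFin_inj; rewrite -hf fiber_value_tp.
Qed.

End satisfiable_side.

Theorem theorem4p8 (R : realType) (L : language) (T : theory L)
    (U : structure L) (K : Type) (M : set U) (X Y : finType)
    (mu : keisler R U X) (lambda : keisler R U Y) :
  complete_theory T -> monster T U K -> small_model K M ->
  dependent mu -> definable mu M -> satisfiable_in lambda M ->
  forall (Z : finType) (phi : formula L (X + (Y + Z))) (b : Z -> U),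
  exists r : R, forall N : set U,
    small_model K N -> M `<=` N -> range b `<=` N ->
    morley_value mu lambda phi b N r /\
    morley_value lambda mu (dual phi) b N r.
Proof.
move=> _ [_ _ satU _] [_ sM] dep_mu def_mu sat_lambda Z phi b.
have real_of (N : set U) : smaller N K -> realizing N.
  by move=> sN V p; exact: satU.
(* [b] is treated as a variable along with [Y], because it need not lie in [M]. *)
have [F [cF hF]] := def_mu _ phi.
(* An integral over global types, hence the same for all [N]. *)
exists (product_value lambda b F) => N [_ sN] MN bN.
have {}bN z : N (b z) by apply: bN; exists z.
have rM := real_of _ sM; have rN := real_of _ sN.
split; first exact: (morley_definable lambda cF hF rM bN MN rN).
exact: (morley_satisfiable cF hF rM bN MN rN dep_mu sat_lambda).
Qed.
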